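(* Let $X$ be a complex Banach space, let $T\in B(X)$ with $\sigma(T)\subset\overline{\mathbb{D}}$, and let $m\ge 1$ be an integer. The following assertions are equivalent: (i) $T$ has property $(GFS)_m$; (ii) $T$ has $1$-derivative bounded functional calculus; (iii) $T$ has $m$-derivative bounded functional calculus.
   Context: $\mathbb{D}$ and $\overline{\mathbb{D}}$ are the open and closed unit discs of $\mathbb{C}$; $r\mathbb{D}$ is the open disc of radius $r$ centred at $0$. $B(X)$ is the algebra of bounded operators on $X$, $\sigma(T)$ is the spectrum of $T$, and $R(\lambda,T)=(\lambda I_X-T)^{-1}$. For $r>0$, $H^\infty(r\mathbb{D})$ is the space of bounded analytic functions $\phi:r\mathbb{D}\to\mathbb{C}$ with norm $\|\phi\|_{H^\infty(r\mathbb{D})}=\sup_{z\in r\mathbb{D}}|\phi(z)|$. If $\sigma(T)\subset\overline{\mathbb{D}}$, $r>1$, $\phi\in H^\infty(r\mathbb{D})$ and $m\ge1$, the operator $\phi^{(m)}(T)\in B(X)$ is given by the Riesz–Dunford calculus: $\phi^{(m)}(T)=\frac{1}{2\pi}\int_0^{2\pi}\rho e^{it}\phi^{(m)}(\rho e^{it})R(\rho e^{it},T)\,dt$ for any $1<\rho<r$ (independent of $\rho$). Property $(GFS)_m$ ($m\ge1$ an integer): $\sigma(T)\subset\overline{\mathbb{D}}$ and there is $C>0$ such that for all $r>1$, $x\in X$, $x^*\in X^*$, $$\int_0^{2\pi}|\langle R(re^{it},T)^{m+1}x,x^*\rangle|\,dt\le\frac{C}{(r+1)(r-1)^m}\|x\|\,\|x^*\|.$$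 $m$-derivative bounded functional calculus: there is $C>0$ such that for all $r>1$ and all $\phi\in H^\infty(r\mathbb{D})$, $\|\phi^{(m)}(T)\|\le\frac{C}{(r-1)^m}\|\phi\|_{H^\infty(r\mathbb{D})}$. *)

(* Defs.v *)
(* A complex Banach space is a
   [CompleteNormedModule C_AbsRing]; Coquelicot's [is_linear] means "linear and
   bounded". *)
From Stdlib Require Import Reals Lra.
From Stdlib Require Import Classical ClassicalEpsilon.
From Stdlib Require Import FunctionalExtensionality PropExtensionality.
From Coquelicot Require Import Coquelicot.

Set Implicit Arguments.
Unset Strict Implicit.
Unset Printing Implicit Defensive.

Open Scope R_scope.

Record blop (X Y : NormedModule C_AbsRing) := Blop {
  blop_fun :> X -> Y;
  blop_linear : is_linear blop_fun }.

Definition opnorm (X Y : NormedModule C_AbsRing) (A : blop X Y) : R :=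
  real (Lub_Rbar (fun v : R => exists x : X, norm x <= 1 /\ v = norm (A x))).

Section NormedBlop.

Variables X Y : NormedModule C_AbsRing.
Implicit Types A B D : blop X Y.

Lemma blop_ext A B : (forall x, A x = B x) -> A = B.
Proof.
destruct A as [f hf]; destruct B as [g hg]; simpl; intros H.
assert (E : f = g) by (apply functional_extensionality; exact H).
subst g; f_equal; apply proof_irrelevance.
Qed.

Lemma norm_scal_C (V : NormedModule C_AbsRing) (c : C) (v : V) :
  norm (scal c v) = Cmod c * norm v.
Proof.
apply Rle_antisym; [exact (norm_scal c v)|].
destruct (Ceq_dec c 0) as [->|Hc].
- rewrite Cmod_0, Rmult_0_l; apply norm_ge_0.
- assert (E : scal (Cinv c) (scal c v) = v).
  { rewrite scal_assoc.
    change (scal (Cmult (Cinv c) c) v = v).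
    rewrite Cinv_l by exact Hc; apply (scal_one v). }
  assert (H : norm v <= Cmod (/ c) * norm (scal c v)).
  { rewrite <- E at 1; exact (norm_scal (K := C_AbsRing) (Cinv c) (scal c v)). }
  rewrite Cmod_inv in H by exact Hc.
  assert (Hp : 0 < Cmod c) by (apply Cmod_gt_0; exact Hc).
  apply Rmult_le_compat_l with (r := Cmod c) in H; [|lra].
  rewrite <- Rmult_assoc, Rinv_r, Rmult_1_l in H by lra. exact H.
Qed.

Lemma opnorm_lub A :
  is_lub_Rbar (fun v : R => exists x : X, norm x <= 1 /\ v = norm (A x))
    (opnorm A).
Proof.
unfold opnorm.
set (E := fun v : R => _).
assert (HL := Lub_Rbar_correct E).
destruct (linear_norm (blop_fun A) (blop_linear A)) as [M [HM HA]].
assert (Hub : is_ub_Rbar E M).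
{ intros v [x [Hx ->]]; simpl.
  apply Rle_trans with (1 := HA x). 
  rewrite <- (Rmult_1_r M) at 2. apply Rmult_le_compat_l; lra. }
assert (H0 : E 0).
{ exists zero; split; [rewrite norm_zero; lra|].
  rewrite (linear_zero (blop_fun A) (blop_linear A)), norm_zero; reflexivity. }
destruct (Lub_Rbar E) as [l| |] eqn:EL; [exact HL| |].
- destruct (proj2 HL _ Hub).
- destruct (proj1 HL 0 H0).
Qed.

Lemma opnorm_ge_0 A : 0 <= opnorm A.
Proof.
apply (proj1 (opnorm_lub A) 0).
exists zero; split; [rewrite norm_zero; lra|].
rewrite (linear_zero (blop_fun A) (blop_linear A)), norm_zero; reflexivity.
Qed.

Lemma opnorm_bound A x : norm (A x) <= opnorm A * norm x.
Proof.
destruct (Req_dec (norm x) 0) as [Hx|Hx].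
- rewrite (norm_eq_zero x Hx), (linear_zero (blop_fun A) (blop_linear A)).
  rewrite !norm_zero; lra.
- assert (Hp : 0 < norm x) by (assert (H := norm_ge_0 x); lra).
  set (c := RtoC (/ norm x)).
  assert (Hc : Cmod c = / norm x).
  { unfold c; rewrite Cmod_R; apply Rabs_pos_eq.
    left; apply Rinv_0_lt_compat; exact Hp. }
  assert (H : norm (A (scal c x)) <= opnorm A).
  { apply (proj1 (opnorm_lub A) (norm (A (scal c x)))).
    exists (scal c x); split; [|reflexivity].
    rewrite norm_scal_C, Hc, Rinv_l; lra. }
  rewrite (linear_scal (blop_fun A) (blop_linear A)), norm_scal_C, Hc in H.
  apply Rmult_le_compat_r with (r := norm x) in H; [|lra].
  rewrite (Rmult_comm (/ _)), Rmult_assoc, Rinv_l in H; lra.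
Qed.

Lemma opnorm_le A M :
  0 <= M -> (forall x, norm (A x) <= M * norm x) -> opnorm A <= M.
Proof.
intros HM H.
apply (proj2 (opnorm_lub A) M).
intros v [x [Hx ->]]; simpl.
apply Rle_trans with (1 := H x).
rewrite <- (Rmult_1_r M) at 2. apply Rmult_le_compat_l; lra.
Qed.

Lemma blop_plus_linear A B : is_linear (fun x => plus (A x) (B x)).
Proof.
apply (is_linear_comp (fun x => (A x, B x)) (fun p : Y * Y => plus (fst p) (snd p))).
- apply is_linear_prod; apply blop_linear.
- apply is_linear_plus.
Qed.

Lemma blop_opp_linear A : is_linear (fun x => opp (A x)).
Proof. 
apply (is_linear_comp (blop_fun A) opp); [apply blop_linear|apply is_linear_opp].
Qed.

Lemma blop_scal_linear (c : C) A : is_linear (fun x => scal c (A x)).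
Proof.
apply (is_linear_comp (blop_fun A) (fun y => scal c y)); [apply blop_linear|].
apply (is_linear_scal_r (K := C_AbsRing) (V := Y) c); intros n m; apply Cmult_comm.
Qed.

Definition blop_zero : blop X Y := Blop is_linear_zero.
Definition blop_plus A B : blop X Y := Blop (blop_plus_linear A B).
Definition blop_opp A : blop X Y := Blop (blop_opp_linear A).
Definition blop_scal (c : C) A : blop X Y := Blop (blop_scal_linear c A).

Lemma blop_plus_comm A B : blop_plus A B = blop_plus B A.
Proof. apply blop_ext; intros x; apply plus_comm. Qed.
Lemma blop_plus_assoc A B D :
  blop_plus A (blop_plus B D) = blop_plus (blop_plus A B) D.
Proof. apply blop_ext; intros x; apply plus_assoc. Qed.
Lemma blop_plus_zero_r A : blop_plus A blop_zero = A.
Proof. apply blop_ext; intros x; exact (plus_zero_r (A x)). Qed.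
Lemma blop_plus_opp_r A : blop_plus A (blop_opp A) = blop_zero.
Proof. apply blop_ext; intros x; exact (plus_opp_r (A x)). Qed.

Definition blop_AbelianMonoid_mixin :=
  AbelianMonoid.Mixin _ _ _ blop_plus_comm blop_plus_assoc blop_plus_zero_r.
Canonical blop_AbelianMonoid :=
  AbelianMonoid.Pack (blop X Y) blop_AbelianMonoid_mixin (blop X Y).
Definition blop_AbelianGroup_mixin :=
  AbelianGroup.Mixin blop_AbelianMonoid _ blop_plus_opp_r.
Canonical blop_AbelianGroup :=
  AbelianGroup.Pack (blop X Y)
    (AbelianGroup.Class _ _ blop_AbelianGroup_mixin) (blop X Y).

Lemma blop_scal_assoc (c d : C_Ring) A :
  blop_scal c (blop_scal d A) = blop_scal (mult c d) A.
Proof. apply blop_ext; intros x; exact (scal_assoc (K := C_Ring) c d (A x)). Qed.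
Lemma blop_scal_one A : blop_scal (one : C_Ring) A = A.
Proof. apply blop_ext; intros x; exact (scal_one (K := C_Ring) (A x)). Qed.
Lemma blop_scal_distr_l (c : C_Ring) A B :
  blop_scal c (plus A B) = plus (blop_scal c A) (blop_scal c B).
Proof. apply blop_ext; intros x; exact (scal_distr_l (K := C_Ring) c (A x) (B x)). Qed.
Lemma blop_scal_distr_r (c d : C_Ring) A :
  blop_scal (plus c d) A = plus (blop_scal c A) (blop_scal d A).
Proof. apply blop_ext; intros x; exact (scal_distr_r (K := C_Ring) c d (A x)). Qed.

Definition blop_ModuleSpace_mixin :=
  ModuleSpace.Mixin C_Ring blop_AbelianGroup _
    blop_scal_assoc blop_scal_one blop_scal_distr_l blop_scal_distr_r.
Canonical blop_ModuleSpace :=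
  ModuleSpace.Pack C_Ring (blop X Y)
    (ModuleSpace.Class _ _ _ blop_ModuleSpace_mixin) (blop X Y).

Lemma opnorm_triangle A B : opnorm (plus A B) <= opnorm A + opnorm B.
Proof.
apply (opnorm_le (A := plus A B)).
- apply Rplus_le_le_0_compat; apply opnorm_ge_0.
- intros x; apply Rle_trans with (1 := norm_triangle (A x) (B x)).
  rewrite Rmult_plus_distr_r; apply Rplus_le_compat; apply opnorm_bound.
Qed.

Lemma opnorm_scal (c : C) A : opnorm (scal c A : blop X Y) <= Cmod c * opnorm A.
Proof.
apply (opnorm_le (A := scal c A)).
- apply Rmult_le_pos; [apply Cmod_ge_0|apply opnorm_ge_0].
- intros x; change (norm (scal c (A x)) <= Cmod c * opnorm A * norm x).
  rewrite norm_scal_C, Rmult_assoc.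
  apply Rmult_le_compat_l; [apply Cmod_ge_0|apply opnorm_bound].
Qed.

Lemma opnorm_eq_0 A : opnorm A = 0 -> A = zero.
Proof.
intros H; apply blop_ext; intros x; apply norm_eq_zero.
apply Rle_antisym; [|apply norm_ge_0].
rewrite <- (Rmult_0_l (norm x)), <- H; apply opnorm_bound.
Qed.

Definition blop_ball A (e : R) B : Prop := opnorm (minus B A) < e.

Lemma blop_ball_center A (e : posreal) : blop_ball A e A.
Proof.
unfold blop_ball. apply Rle_lt_trans with 0; [|apply cond_pos].
apply (opnorm_le (A := minus A A)); [lra|intros x].
replace (minus A A) with (zero : blop X Y) by (symmetry; exact (minus_eq_zero (G := blop_AbelianGroup) A)).
change (norm (zero : Y) <= 0 * norm x). rewrite norm_zero; lra.
Qed.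

Lemma blop_ball_sym A B e : blop_ball A e B -> blop_ball B e A.
Proof.
unfold blop_ball; intros H; apply Rle_lt_trans with (2 := H).
apply (opnorm_le (A := minus A B)); [apply opnorm_ge_0|intros x].
replace (minus A B) with (opp (minus B A)) by exact (opp_minus (G := blop_AbelianGroup) B A).
change (norm (opp (minus B A x)) <= opnorm (minus B A) * norm x).
rewrite norm_opp; apply opnorm_bound.
Qed.

Lemma blop_ball_triangle A B D e1 e2 :
  blop_ball A e1 B -> blop_ball B e2 D -> blop_ball A (e1 + e2) D.
Proof.
unfold blop_ball; intros H1 H2.
rewrite (minus_trans B D A).
apply Rle_lt_trans with (1 := opnorm_triangle _ _); lra.
Qed.

Definition blop_UniformSpace_mixin :=
  UniformSpace.Mixin (blop X Y) blop_zero blop_ball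
    blop_ball_center blop_ball_sym blop_ball_triangle.
Canonical blop_UniformSpace :=
  UniformSpace.Pack (blop X Y) blop_UniformSpace_mixin (blop X Y).
Canonical blop_NormedModuleAux :=
  NormedModuleAux.Pack C_AbsRing (blop X Y)
    (NormedModuleAux.Class _ _ (ModuleSpace.class _ blop_ModuleSpace)
       blop_UniformSpace_mixin) (blop X Y).

Lemma blop_norm_compat1 A B (e : R) : opnorm (minus B A) < e -> ball A e B.
Proof. intros H; exact H. Qed.
Lemma blop_norm_compat2 A B (e : posreal) :
  ball A e B -> opnorm (minus B A) < 1 * e.
Proof. intros H; rewrite Rmult_1_l; exact H. Qed.

Definition blop_NormedModule_mixin :=
  NormedModule.Mixin C_AbsRing blop_NormedModuleAux
    (@opnorm X Y) 1
    opnorm_triangle opnorm_scal blop_norm_compat1 blop_norm_compat2 opnorm_eq_0.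
Canonical blop_NormedModule :=
  NormedModule.Pack C_AbsRing (blop X Y)
    (NormedModule.Class _ _ _ blop_NormedModule_mixin) (blop X Y).

End NormedBlop.

Lemma norm_minus_sym (V : NormedModule C_AbsRing) (u v : V) :
  norm (minus u v) = norm (minus v u).
Proof. rewrite <- (opp_minus v u), norm_opp; reflexivity. Qed.

Lemma norm_minus_triangle (V : NormedModule C_AbsRing) (u v w : V) :
  norm (minus u w) <= norm (minus u v) + norm (minus v w).
Proof. rewrite (minus_trans v u w); apply norm_triangle. Qed.

Lemma eq_of_norm_small (V : NormedModule C_AbsRing) (u v : V) :
  (forall e, 0 < e -> norm (minus u v) <= e) -> u = v.
Proof.
intros H.
destruct (classic (u = v)) as [E|E]; [exact E|exfalso].
assert (Hp := norm_minus_gt_0 _ _ E).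
assert (H1 := H (norm (minus u v) / 2)); lra.
Qed.

Lemma minus_plus_plus (G : AbelianGroup) (a b u v : G) :
  minus (plus a b) (plus u v) = plus (minus a u) (minus b v).
Proof.
unfold minus; rewrite opp_plus, <- !plus_assoc; f_equal.
rewrite !plus_assoc; f_equal; apply plus_comm.
Qed.

Section PointwiseLimit.

Variables (X Y : NormedModule C_AbsRing) (F : (blop X Y -> Prop) -> Prop).
Hypotheses (PF : ProperFilter F) (CF : cauchy F).

Lemma blop_near_pair (e : posreal) :
  exists A0 : blop X Y, F (fun A : blop X Y => opnorm (minus A A0) < e).
Proof. destruct (CF e) as [A0 H]; exists A0; exact H. Qed.

Variable f : X -> Y.
Hypothesis Ff : forall (x : X) (e : R),
  0 < e -> F (fun A : blop X Y => norm (minus (A x) (f x)) < e).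

Lemma pointwise_limit_linear : is_linear f.
Proof.
split.
- intros x y; apply eq_of_norm_small; intros e He.
  assert (H3 : 0 < e / 3) by lra.
  destruct (filter_ex (F := F) _ (filter_and (F := F) _ _ (Ff (plus x y) H3)
    (filter_and (F := F) _ _ (Ff x H3) (Ff y H3))))
    as [A [Hxy [Hx Hy]]].
  rewrite (minus_trans (A (plus x y)) (f (plus x y))).
  apply Rle_trans with (1 := norm_triangle _ _).
  rewrite norm_minus_sym.
  rewrite (linear_plus (blop_fun A) (blop_linear A)) in *.
  assert (E : minus (plus (A x) (A y)) (plus (f x) (f y))
    = plus (minus (A x) (f x)) (minus (A y) (f y))).
  { exact (minus_plus_plus (A x) (A y) _ _). }
  rewrite E.
  assert (HT := norm_triangle (minus (A x) (f x))
    (minus (A y) (f y))).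
  replace e with (e / 3 + (e / 3 + e / 3)) by field.
  apply Rplus_le_compat; [left; exact Hxy|].
  apply Rle_trans with (1 := HT).
  apply Rplus_le_compat; left; assumption.
- intros c x; apply eq_of_norm_small; intros e He.
  assert (H2 : 0 < e / 2) by lra.
  assert (Hc := Cmod_ge_0 c).
  assert (H3 : 0 < e / 2 / (Cmod c + 1)) by (apply Rdiv_lt_0_compat; lra).
  destruct (filter_ex (F := F) _ (filter_and (F := F) _ _ (Ff (scal c x) H2)
    (Ff x H3))) as [A [Hcx Hx]].
  rewrite (minus_trans (A (scal c x)) (f (scal c x))).
  apply Rle_trans with (1 := norm_triangle _ _).
  rewrite norm_minus_sym.
  rewrite (linear_scal (blop_fun A) (blop_linear A)) in *.
  apply Rle_trans with (e / 2 + Cmod c * norm (minus (A x) (f x))).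
  { apply Rplus_le_compat; [left; exact Hcx|].
    rewrite <- norm_scal_C; apply Req_le, f_equal.
    exact (eq_sym (scal_minus_distr_l (K := C_Ring) c (A x) (f x))). }
  assert (HM : Cmod c * norm (minus (A x) (f x))
      <= (Cmod c + 1) * (e / 2 / (Cmod c + 1))).
  { apply Rmult_le_compat; [lra|apply norm_ge_0|lra|lra]. }
  replace ((Cmod c + 1) * (e / 2 / (Cmod c + 1))) with (e / 2) in HM
    by (field; lra).
  lra.
- destruct (blop_near_pair (mkposreal _ Rlt_0_1)) as [A0 HA0]; simpl in HA0.
  assert (H0 := opnorm_ge_0 A0).
  exists (opnorm A0 + 1); split; [lra|]; intros x.
  apply Rnot_lt_le; intros Hlt.
  set (e := norm (f x) - (opnorm A0 + 1) * norm x).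
  assert (He : 0 < e) by (unfold e; lra).
  destruct (filter_ex (F := F) _ (filter_and (F := F) _ _ HA0 (Ff x He)))
    as [A [HA Hx]].
  assert (HB := opnorm_bound (minus A A0) x).
  assert (HB0 := opnorm_bound A0 x).
  assert (HN : opnorm (minus A A0) * norm x <= 1 * norm x).
  { apply Rmult_le_compat_r; [apply norm_ge_0|lra]. }
  change (minus A A0 x) with (minus (A x) (A0 x)) in HB.
  assert (T1 : norm (A x) - norm (A0 x) <= norm (minus (A x) (A0 x))).
  { apply Rle_trans with (1 := Rle_abs _); apply norm_triangle_inv. }
  assert (T2 : norm (f x) - norm (A x)
      <= norm (minus (A x) (f x))).
  { rewrite norm_minus_sym.
    apply Rle_trans with (1 := Rle_abs _); apply norm_triangle_inv. }
  unfold e in Hx; lra.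
Qed.

Lemma pointwise_limit_cvg (L : blop X Y) (e : posreal) :
  (forall x, L x = f x) -> F (ball L e).
Proof.
intros HLf.
assert (He := cond_pos e).
assert (H4 : 0 < e / 4) by lra.
destruct (blop_near_pair (mkposreal _ H4)) as [A0 HA0]; simpl in HA0.
refine (filter_imp (F := F) _ _ _ HA0); intros A HA.
apply Rle_lt_trans with (e / 2); [|lra].
apply (opnorm_le (A := minus A L)); [lra|intros x].
change (minus A L x) with (minus (A x) (L x)).
rewrite HLf.
apply Rnot_lt_le; intros Hlt.
set (d := norm (minus (A x) (f x)) - e / 2 * norm x).
assert (Hd : 0 < d) by (unfold d; lra).
destruct (filter_ex (F := F) _ (filter_and (F := F) _ _ HA0 (Ff x Hd)))
  as [B [HB Hx]].
assert (N1 := opnorm_bound (minus A A0) x).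
assert (N2 := opnorm_bound (minus B A0) x).
change (minus A A0 x) with (minus (A x) (A0 x)) in N1.
change (minus B A0 x) with (minus (B x) (A0 x)) in N2.
assert (M1 : opnorm (minus A A0) * norm x <= e / 4 * norm x).
{ apply Rmult_le_compat_r; [apply norm_ge_0|lra]. }
assert (M2 : opnorm (minus B A0) * norm x <= e / 4 * norm x).
{ apply Rmult_le_compat_r; [apply norm_ge_0|lra]. }
assert (T1 := norm_minus_triangle (A x) (A0 x) (f x)).
assert (T2 := norm_minus_triangle (A0 x) (B x) (f x)).
rewrite norm_minus_sym in N2.
unfold d in Hx; lra.
Qed.

End PointwiseLimit.

Section CompleteBlop.

Variables (X : NormedModule C_AbsRing) (Y : CompleteNormedModule C_AbsRing).

Definition blop_lim_fun (F : (blop X Y -> Prop) -> Prop) (x : X) : Y :=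
  lim (fun P : Y -> Prop => F (fun A => P (A x))).

Definition blop_lim (F : (blop X Y -> Prop) -> Prop) : blop X Y :=
  match excluded_middle_informative (is_linear (blop_lim_fun F)) with
  | left H => Blop H
  | right _ => blop_zero X Y
  end.

Lemma blop_lim_fun_cvg (F : (blop X Y -> Prop) -> Prop) (PF : ProperFilter F)
    (CF : cauchy F) (x : X) (e : R) :
  0 < e -> F (fun A : blop X Y => norm (minus (A x) (blop_lim_fun F x)) < e).
Proof.
intros He.
set (G := fun P : Y -> Prop => F (fun A : blop X Y => P (A x))).
assert (PG : ProperFilter G).
{ split.
  - intros P HP; destruct (filter_ex (F := F) _ HP) as [A HA]; exists (A x); exact HA.
  - split.
    + exact (filter_true (F := F)).
    + intros P Q HP HQ; exact (filter_and (F := F) _ _ HP HQ).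
    + intros P Q H HP.
      apply (filter_imp (F := F) (fun A : blop X Y => P (A x))); [|exact HP].
      intros A; apply H. }
assert (CG : cauchy G).
{ intros d.
  assert (Hp : 0 < d / (norm x + 1)).
  { apply Rdiv_lt_0_compat; [apply cond_pos|].
    assert (H := norm_ge_0 x); lra. }
  destruct (blop_near_pair CF (mkposreal _ Hp)) as [A0 HA0].
  exists (A0 x). unfold G.
  refine (filter_imp (F := F) _ _ _ HA0); intros A HA; simpl in HA.
  apply (norm_compat1 (V := Y)).
  apply Rle_lt_trans with (opnorm (minus A A0) * norm x).
  - exact (opnorm_bound (minus A A0) x).
  - apply Rle_lt_trans with (d / (norm x + 1) * norm x).
    + apply Rmult_le_compat_r; [apply norm_ge_0|lra].
    + assert (H := norm_ge_0 x). assert (Hd := cond_pos d).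
      replace (pos d) with (d / (norm x + 1) * (norm x + 1)) at 2
        by (field; lra).
      apply Rmult_lt_compat_l; [exact Hp|lra]. }
assert (Hk : 0 < @norm_factor _ Y) by apply norm_factor_gt_0.
assert (Hp : 0 < e / @norm_factor _ Y) by (apply Rdiv_lt_0_compat; lra).
assert (H := complete_cauchy G PG CG (mkposreal _ Hp)).
unfold G in H. refine (filter_imp (F := F) _ _ _ H); intros A HA.
assert (HB := norm_compat2 (V := Y) _ _ _ HA); simpl in HB.
refine (Rlt_le_trans _ _ _ HB _); apply Req_le.
field; apply Rgt_not_eq; exact Hk.
Qed.

Lemma blop_lim_cvg (F : (blop X Y -> Prop) -> Prop) :
  ProperFilter F -> cauchy F -> forall e : posreal, F (ball (blop_lim F) e).
Proof.
intros PF CF e.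
apply (pointwise_limit_cvg PF CF (blop_lim_fun_cvg PF CF)).
intros x; unfold blop_lim.
destruct (excluded_middle_informative _) as [H|H]; [reflexivity|].
destruct (H (pointwise_limit_linear PF CF (blop_lim_fun_cvg PF CF))).
Qed.

Lemma blop_close_lim (F G : (blop X Y -> Prop) -> Prop) :
  filter_le F G -> filter_le G F -> close (blop_lim F) (blop_lim G).
Proof.
intros H1 H2.
replace G with F; [intros e; apply ball_center|].
apply functional_extensionality; intros P; apply propositional_extensionality.
split; [apply H2|apply H1].
Qed.

Definition blop_CompleteSpace_mixin :=
  CompleteSpace.Mixin (blop_UniformSpace X Y) blop_lim blop_lim_cvg blop_close_lim.
Canonical blop_CompleteSpace :=
  CompleteSpace.Pack (blop X Y)
    (CompleteSpace.Class _ _ blop_CompleteSpace_mixin) (blop X Y).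
Canonical blop_CompleteNormedModule :=
  CompleteNormedModule.Pack C_AbsRing (blop X Y)
    (CompleteNormedModule.Class _ _
       (NormedModule.class _ (blop_NormedModule X Y))
       blop_CompleteSpace_mixin) (blop X Y).

End CompleteBlop.

(* Coquelicot integrates functions with values in real Banach spaces: [V_R V] is
  the complex Banach space [V], with the same norm, seen as a real one.  It is
  deliberately not canonical. *)

Section RestrictScalars.

Variable V : CompleteNormedModule C_AbsRing.

Definition Rscal (a : R) (v : V) : V := scal (RtoC a) v.

Lemma Rscal_assoc (a b : R_Ring) (v : V) :
  Rscal a (Rscal b v) = Rscal (mult a b) v.
Proof.
unfold Rscal; rewrite (scal_assoc (K := C_Ring)); f_equal.
symmetry; apply RtoC_mult.
Qed.
Lemma Rscal_one (v : V) : Rscal (one : R_Ring) v = v.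
Proof. exact (scal_one (K := C_Ring) v). Qed.
Lemma Rscal_distr_l (a : R_Ring) (u v : V) :
  Rscal a (plus u v) = plus (Rscal a u) (Rscal a v).
Proof. exact (scal_distr_l (K := C_Ring) (RtoC a) u v). Qed.
Lemma Rscal_distr_r (a b : R_Ring) (v : V) :
  Rscal (plus a b) v = plus (Rscal a v) (Rscal b v).
Proof.
refine (eq_trans _ (scal_distr_r (K := C_Ring) (RtoC a) (RtoC b) v)).
unfold Rscal; f_equal; apply RtoC_plus.
Qed.

Definition V_R_ModuleSpace_mixin :=
  ModuleSpace.Mixin R_Ring _ Rscal
    Rscal_assoc Rscal_one Rscal_distr_l Rscal_distr_r.
Definition V_R_ModuleSpace : ModuleSpace R_Ring :=
  ModuleSpace.Pack R_Ring V (ModuleSpace.Class _ _ _ V_R_ModuleSpace_mixin) V.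
Definition V_R_NormedModuleAux : NormedModuleAux R_AbsRing :=
  NormedModuleAux.Pack R_AbsRing V
    (NormedModuleAux.Class R_AbsRing V (ModuleSpace.class _ V_R_ModuleSpace)
       (UniformSpace.class V)) V.

Lemma Rscal_norm (a : R) (v : V) : norm (Rscal a v) <= Rabs a * norm v.
Proof.
rewrite <- Cmod_R; apply (norm_scal (K := C_AbsRing) (RtoC a) v).
Qed.

Definition V_R_NormedModule_mixin :=
  NormedModule.Mixin R_AbsRing V_R_NormedModuleAux
    (fun v : V => norm v) (@norm_factor _ V)
    (@norm_triangle _ V) Rscal_norm (@norm_compat1 _ V) (@norm_compat2 _ V)
    (@norm_eq_zero _ V).
Definition V_R : CompleteNormedModule R_AbsRing :=
  CompleteNormedModule.Pack R_AbsRing V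
    (CompleteNormedModule.Class R_AbsRing V
       (NormedModule.Class R_AbsRing V _ V_R_NormedModule_mixin)
       (CompleteSpace.class V)) V.

End RestrictScalars.

Definition bounded_op (X : CompleteNormedModule C_AbsRing) :
    CompleteNormedModule C_AbsRing :=
  blop_CompleteNormedModule X X.

Definition dual (X : CompleteNormedModule C_AbsRing) : NormedModule C_AbsRing :=
  blop_NormedModule X C_NormedModule.

Section Operators.

Variable X : CompleteNormedModule C_AbsRing.
Implicit Types S T : blop X X.

Definition blop_id : blop X X := Blop is_linear_id.
Definition blop_comp S T : blop X X :=
  Blop (is_linear_comp (blop_fun T) (blop_fun S) (blop_linear T) (blop_linear S)).
Fixpoint blop_pow T (n : nat) : blop X X :=
  match n with
  | O => blop_id
  | Datatypes.S k => blop_comp T (blop_pow T k)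
  end.

Definition is_inverse S T : Prop :=
  blop_comp S T = blop_id /\ blop_comp T S = blop_id.

Definition spectrum T (lambda : C) : Prop :=
  ~ exists S, is_inverse S (minus (scal lambda blop_id) T).

(* R(lambda, T); an arbitrary operator when [lambda] is in the spectrum. *)
Definition resolvent (lambda : C) T : blop X X :=
  epsilon (inhabits (blop_zero X X))
    (fun S => is_inverse S (minus (scal lambda blop_id) T)).

Definition spectrum_in_closed_disc T : Prop :=
  forall lambda : C, spectrum T lambda -> Cmod lambda <= 1.

End Operators.

(* Elements of H^infty(rD) are represented by total functions, whose values
   outside the open disc are irrelevant. *)
Definition analytic_on_disc (r : R) (phi : C -> C) : Prop :=
  forall z : C, Cmod z < r -> ex_derive (K := C_AbsRing) phi z.

Definition Hinf (r : R) (phi : C -> C) : Prop :=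
  analytic_on_disc r phi /\
  exists M : R, forall z : C, Cmod z < r -> Cmod (phi z) <= M.

Definition Hinf_norm (r : R) (phi : C -> C) : R :=
  real (Lub_Rbar (fun v : R => exists z : C, Cmod z < r /\ v = Cmod (phi z))).

Definition C_derive_n (phi : C -> C) (n : nat) : C -> C := Nat.iter n C_derive phi.

Definition circle (rho t : R) : C := (rho * cos t, rho * sin t).

Section Calculus.

Variable X : CompleteNormedModule C_AbsRing.
Implicit Types T : blop X X.

(* phi^(m)(T), computed by the Riesz-Dunford integral over the circle of radius
   rho: a norm-convergent Riemann integral in B(X).  For phi in H^infty(rD) and
   spectrum of T in the closed unit disc it does not depend on rho in (1, r). *)
Definition derivative_calculus (m : nat) (phi : C -> C) (rho : R) T : blop X X :=
  scal (RtoC (/ (2 * PI)))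
    (RInt (V := V_R (bounded_op X))
       (fun t => scal (circle rho t * C_derive_n phi m (circle rho t))%C
                      (resolvent (circle rho t) T))
       0 (2 * PI)).

Definition derivative_bounded_calculus (m : nat) T : Prop :=
  exists K : R, 0 < K /\
    forall (r : R) (phi : C -> C), 1 < r -> Hinf r phi ->
    forall rho : R, 1 < rho < r ->
    norm (derivative_calculus m phi rho T) <= K / (r - 1) ^ m * Hinf_norm r phi.

Definition GFS (m : nat) T : Prop :=
  spectrum_in_closed_disc T /\
  exists K : R, 0 < K /\
    forall (r : R) (x : X) (x' : dual X), 1 < r ->
    RInt (fun t => Cmod (x' (blop_pow (resolvent (circle r t) T) (m + 1) x)))
      0 (2 * PI)
    <= K / ((r + 1) * (r - 1) ^ m) * norm x * norm x'.

End Calculus.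

(* Main.v *)
(** Write f_j(z) = <R(z,T)^j x, x*>, which is holomorphic for |z| > 1 with
    f_j' = - j f_(j+1).

    From (GFS)_m to the m-derivative calculus: integrating by parts m times on
    a circle turns <phi^(m)(T) x, x*> into m! times the mean of
    z phi(z) f_(m+1)(z), which (GFS)_m bounds; Hahn-Banach returns to operator
    norms.

    From the m-derivative calculus to (GFS)_(m+1): for h_j in the unit disc and
    equidistributed nodes w_j on the circle of radius s, the rational function
    phi(z) = sum_j h_j (w_j - z)^(-2) satisfies
    phi^(m)(T) = (m+1)! sum_j h_j R(w_j,T)^(m+2), while the Poisson kernel
    bounds it on the disc of radius (1+s)/2.  Choosing h_j to be the conjugate
    phases of f_(m+2)(w_j) makes this a Riemann sum of the (GFS)_(m+1) integral.

    From (GFS)_(k+1) to (GFS)_k: integrate the radial derivative of R^(k+1)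
    from r to infinity.  This is carried out on the Riemann sums, so that no
    integral depending on a parameter has to be differentiated.

    Together, the m-derivative calculus gives (GFS)_j, hence the j-derivative
    calculus, for every 1 <= j <= m + 1. *)
Require Import Defs.
From Stdlib Require Import Reals Lra Lia Factorial Classical ClassicalEpsilon FunctionalExtensionality.
From mathcomp.classical Require classical_sets.
From Coquelicot Require Import Coquelicot.

Open Scope R_scope.

(** * Complex and real differentiability *)

(** The exponent 2 of the test function is what gains an order. The mean of |w - z|^(-2) over the
    circle |w| = s is 1/(s^2 - |z|^2), so on the disc of radius (1+s)/2 the supremum norm costs a
    constant times 1/((s+1)(s-1)). This is exactly the extra power of s - 1, and the factor s + 1,
    that separate (GFS)_(m+1) from the bound of the m-derivative calculus; exponent 1 would produce
    a logarithm instead.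

    Finite sums are used because the phases of f_(m+2) may jump at its zeros, while a finite
    combination of kernels is visibly holomorphic and its calculus is a finite combination of
    resolvent powers. At equidistributed nodes the Poisson kernel sums in closed form, so the number
    of nodes depends only on a lower bound for s; the descent, where s runs to infinity, relies on
    this uniformity.

    [Hinf] provides complex differentiability at each point but no continuity of the derivative.
    Repeated integration by parts therefore rests on Goursat's theorem, and Goursat is proved here
    for parametrised rectangles so that it applies at once to families of circles. *)

Definition cdiff (f : C -> C) (z l : C) : Prop :=
  forall e, 0 < e -> exists d, 0 < d /\ forall w, Cmod (w - z) < d ->
    Cmod (f w - f z - l * (w - z)) <= e * Cmod (w - z).

(** Translates between the library derivative, in which analyticity is phrased, and the
    epsilon-delta form in which the estimates below are made. *)
Lemma is_derive_cdiff (f : C -> C) (z l : C) :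
  is_derive (K := C_AbsRing) (V := C_NormedModule) f z l <-> cdiff f z l.
Proof.
split.
- intros [_ H] e He.
  destruct (H z (fun P HP => HP) (mkposreal e He)) as [d Hd].
  exists d; split; [apply cond_pos|]; intros w Hw.
  assert (K := Hd w Hw). simpl in K.
  unfold minus, plus, opp, scal in K; simpl in K.
  change (Cmod (w + - z)) with (Cmod (w - z)) in K.
  replace (f w - f z - l * (w - z))%C with (f w + - f z + - (((w + - z) * l)))%C by ring.
  exact K.
- intros H; split; [apply is_linear_scal_l|].
  intros x Hx. assert (E : x = z) by (symmetry; apply (is_filter_lim_locally_unique (V := AbsRing_NormedModule C_AbsRing) z x Hx)).
  subst x. intros [e He]. destruct (H e He) as [d [Hd K]].
  exists (mkposreal d Hd). intros w Hw.
  assert (K1 := K w Hw).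
  replace (f w - f z - l * (w - z))%C with (f w + - f z + - (((w + - z) * l)))%C in K1 by ring.
  exact K1.
Qed.

Lemma ex_derive_cdiff (f : C -> C) (z : C) :
  ex_derive (K := C_AbsRing) (V := C_NormedModule) f z <-> exists l, cdiff f z l.
Proof.
split; intros [l Hl]; exists l; apply is_derive_cdiff; exact Hl.
Qed.

Lemma cdiff_derive (f : C -> C) (z l : C) : cdiff f z l -> C_derive f z = l.
Proof. intros H; apply is_C_derive_unique; apply is_derive_cdiff; exact H. Qed.

(** The velocity of a complex-valued curve; the real increment enters through [RtoC], which matches
    differentiability in the real space [VC]. *)
Definition rdiff (f : R -> C) (t : R) (l : C) : Prop :=
  forall e, 0 < e -> exists d, 0 < d /\ forall s, Rabs (s - t) < d ->
    Cmod (f s - f t - RtoC (s - t) * l) <= e * Rabs (s - t).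

Definition rcont (f : R -> C) (t : R) : Prop :=
  forall e, 0 < e -> exists d, 0 < d /\ forall s, Rabs (s - t) < d ->
    Cmod (f s - f t) < e.

Notation VC := (V_R C_CompleteNormedModule).

Lemma rdiff_is_derive (f : R -> C) (t : R) (l : C) :
  rdiff f t l -> is_derive (K := R_AbsRing) (V := VC) f t l.
Proof.
intros H; split; [apply (is_linear_scal_l (K := R_AbsRing) (V := VC))|].
intros x Hx. assert (E : x = t) by (symmetry; apply (is_filter_lim_locally_unique (V := AbsRing_NormedModule R_AbsRing) t x Hx)).
subst x. intros [e He]. destruct (H e He) as [d [Hd K]].
exists (mkposreal d Hd). intros w Hw. exact (K w Hw).
Qed.

Lemma rcont_continuous (f : R -> C) (t : R) :
  rcont f t -> continuous (U := VC) f t.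
Proof.
intros H. apply (proj2 (filterlim_locally_ball_norm (K := R_AbsRing) (U := VC) f (f t))).
intros [e He]. destruct (H e He) as [d [Hd K]].
exists (mkposreal d Hd). intros w Hw. exact (K w Hw).
Qed.

(* Coquelicot gives C two normed-module structures over itself, with different
   uniform structures; its product and chain rules use the one below. *)
Lemma is_derive_cdiff_ring (f : C -> C) (z l : C) :
  is_derive (K := C_AbsRing) (V := AbsRing_NormedModule C_AbsRing) f z l <-> cdiff f z l.
Proof.
split.
- intros [_ H] e He.
  destruct (H z (fun P HP => HP) (mkposreal e He)) as [d Hd].
  exists d; split; [apply cond_pos|]; intros w Hw.
  assert (K := Hd w Hw).
  replace (f w - f z - l * (w - z))%C with (f w + - f z + - (((w + - z) * l)))%C by ring.
  exact K.
- intros H; split; [apply is_linear_scal_l|].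
  intros x Hx. assert (E : x = z) by (symmetry; apply (is_filter_lim_locally_unique (V := AbsRing_NormedModule C_AbsRing) z x Hx)).
  subst x. intros [e He]. destruct (H e He) as [d [Hd K]].
  exists (mkposreal d Hd). intros w Hw.
  assert (K1 := K w Hw).
  replace (f w - f z - l * (w - z))%C with (f w + - f z + - (((w + - z) * l)))%C in K1 by ring.
  exact K1.
Qed.

Lemma cdiff_mult (f g : C -> C) (z l m : C) :
  cdiff f z l -> cdiff g z m -> cdiff (fun w => f w * g w)%C z (l * g z + f z * m)%C.
Proof.
intros Hf Hg. apply is_derive_cdiff_ring.
apply (is_derive_mult (K := C_AbsRing) f g z l m);
  [apply is_derive_cdiff_ring; exact Hf | apply is_derive_cdiff_ring; exact Hg | exact Cmult_comm].
Qed.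

Lemma cdiff_plus (f g : C -> C) (z l m : C) :
  cdiff f z l -> cdiff g z m -> cdiff (fun w => f w + g w)%C z (l + m)%C.
Proof.
intros Hf Hg. apply is_derive_cdiff_ring.
apply (is_derive_plus (K := C_AbsRing) (V := AbsRing_NormedModule C_AbsRing) f g z l m);
  apply is_derive_cdiff_ring; assumption.
Qed.

Lemma cdiff_comp (f g : C -> C) (z l m : C) :
  cdiff f (g z) l -> cdiff g z m -> cdiff (fun w => f (g w)) z (m * l)%C.
Proof.
intros Hf Hg. apply is_derive_cdiff_ring.
apply (is_derive_comp (K := C_AbsRing) (V := AbsRing_NormedModule C_AbsRing) f g z l m);
  apply is_derive_cdiff_ring; assumption.
Qed.

Lemma cdiff_const (a z : C) : cdiff (fun _ => a) z 0.
Proof. apply is_derive_cdiff_ring. exact (is_derive_const (K := C_AbsRing) (V := AbsRing_NormedModule C_AbsRing) a z). Qed.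

Lemma cdiff_id (z : C) : cdiff (fun w => w) z 1.
Proof. apply is_derive_cdiff_ring. exact (is_derive_id (K := C_AbsRing) z). Qed.

Lemma cdiff_eq (f : C -> C) (z l m : C) : cdiff f z l -> l = m -> cdiff f z m.
Proof. intros H <-; exact H. Qed.

Lemma cdiff_ext_loc (f g : C -> C) (z l : C) (d : R) : 0 < d ->
  (forall w, Cmod (w - z) < d -> f w = g w) -> cdiff f z l -> cdiff g z l.
Proof.
intros Hd E H e He. destruct (H e He) as [d' [Hd' K]].
exists (Rmin d d'); split; [apply Rmin_pos; lra|]. intros w Hw.
assert (H1 := Rmin_l d d'); assert (H2 := Rmin_r d d').
rewrite <- (E w) by lra. rewrite <- (E z).
- apply K; lra.
- replace (z - z)%C with (RtoC 0) by ring. rewrite Cmod_0; exact Hd.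
Qed.

(** The working criterion: for inverses, Cauchy kernels and resolvents the first-order remainder is
    known algebraically and is visibly O(|w - z|^2). *)
Lemma cdiff_quadratic (f : C -> C) (z l : C) (d K : R) : 0 < d -> 0 <= K ->
  (forall w, Cmod (w - z) < d -> Cmod (f w - f z - l * (w - z)) <= K * Cmod (w - z) ^ 2) ->
  cdiff f z l.
Proof.
intros Hd HK H e He.
assert (HK1 : 0 < K + 1) by lra.
assert (Hp : 0 < e / (K + 1)) by (apply Rdiv_lt_0_compat; lra).
exists (Rmin d (e / (K + 1))); split; [apply Rmin_pos; lra|]. intros w Hw.
assert (H1 := Rmin_l d (e / (K + 1))); assert (H2 := Rmin_r d (e / (K + 1))).
apply Rle_trans with (1 := H w ltac:(lra)).
assert (H0 := Cmod_ge_0 (w - z)).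
replace (K * Cmod (w - z) ^ 2) with ((K * Cmod (w - z)) * Cmod (w - z)) by ring.
apply Rmult_le_compat_r; [exact H0|].
apply Rle_trans with ((K + 1) * (e / (K + 1))); [|apply Req_le; field; lra].
apply Rmult_le_compat; lra.
Qed.

Lemma Cmod_minus_ge (u v : C) : Cmod u - Cmod v <= Cmod (u - v).
Proof.
assert (H := Cmod_triangle (u - v) v).
replace (u - v + v)%C with u in H by ring. lra.
Qed.

Lemma Cmod_minus_sym (u v : C) : Cmod (u - v) = Cmod (v - u).
Proof. replace (u - v)%C with (- (v - u))%C by ring. apply Cmod_opp. Qed.

Lemma Cmod_minus_le (u v : C) : Cmod (u - v) <= Cmod u + Cmod v.
Proof. replace (u - v)%C with (u + - v)%C by ring. rewrite <- (Cmod_opp v). apply Cmod_triangle. Qed.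

Lemma Cmod_neq (z : C) : 0 < Cmod z -> z <> 0%C.
Proof. intros H E; rewrite E, Cmod_0 in H; lra. Qed.

Lemma cdiff_inv (z : C) : z <> 0%C -> cdiff (fun w => / w)%C z (- / (z * z))%C.
Proof.
intros Hz. assert (Hp : 0 < Cmod z) by (apply Cmod_gt_0; exact Hz).
apply cdiff_quadratic with (Cmod z / 2) (/ (Cmod z * Cmod z * (Cmod z / 2))).
- lra.
- left; apply Rinv_0_lt_compat. repeat apply Rmult_lt_0_compat; lra.
- intros w Hw.
  assert (Hw2 : Cmod z / 2 <= Cmod w).
  { assert (H := Cmod_minus_ge z w). rewrite Cmod_minus_sym in H. lra. }
  assert (Hw0 : w <> 0%C) by (apply Cmod_neq; lra).
  (* The exact first-order remainder; |w| >= |z|/2 bounds its denominator from below. *)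
  replace (/ w - / z - - / (z * z) * (w - z))%C with (((w - z) * (w - z)) / (z * z * w))%C
    by (field; split; assumption).
  rewrite Cmod_div, !Cmod_mult by (repeat apply Cmult_neq_0; assumption).
  unfold Rdiv. rewrite Rmult_comm. simpl. rewrite Rmult_1_r.
  apply Rmult_le_compat_r; [apply Rmult_le_pos; apply Cmod_ge_0|].
  apply Rinv_le_contravar; [repeat apply Rmult_lt_0_compat; lra|].
  apply Rmult_le_compat_l; [apply Rmult_le_pos; apply Cmod_ge_0|lra].
Qed.

Lemma cdiff_cont (f : C -> C) (z l : C) : cdiff f z l ->
  forall e, 0 < e -> exists d, 0 < d /\ forall w, Cmod (w - z) < d -> Cmod (f w - f z) < e.
Proof.
intros H e He. destruct (H 1 Rlt_0_1) as [d [Hd K]].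
assert (Hl := Cmod_ge_0 l).
assert (Hp : 0 < e / (Cmod l + 2)) by (apply Rdiv_lt_0_compat; lra).
exists (Rmin d (e / (Cmod l + 2))); split; [apply Rmin_pos; lra|]. intros w Hw.
assert (H1 := Rmin_l d (e / (Cmod l + 2))); assert (H2 := Rmin_r d (e / (Cmod l + 2))).
assert (K1 := K w ltac:(lra)).
assert (T := Cmod_minus_ge (f w - f z) (l * (w - z))). rewrite Cmod_mult in T.
assert (H0 := Cmod_ge_0 (w - z)).
apply Rle_lt_trans with ((Cmod l + 1) * Cmod (w - z)); [lra|].
apply Rle_lt_trans with ((Cmod l + 1) * (e / (Cmod l + 2))).
- apply Rmult_le_compat_l; lra.
- apply Rlt_le_trans with ((Cmod l + 2) * (e / (Cmod l + 2))); [|apply Req_le; field; lra].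
  apply Rmult_lt_compat_r; lra.
Qed.

Lemma rdiff_lip (f : R -> C) (t : R) (l : C) : rdiff f t l ->
  exists d, 0 < d /\ forall s, Rabs (s - t) < d -> Cmod (f s - f t) <= (Cmod l + 1) * Rabs (s - t).
Proof.
intros H. destruct (H 1 Rlt_0_1) as [d [Hd K]]. exists d; split; [exact Hd|]. intros s Hs.
assert (K1 := K s Hs). assert (T := Cmod_minus_ge (f s - f t) (RtoC (s - t) * l)).
rewrite Cmod_mult, Cmod_R in T. lra.
Qed.

Lemma rdiff_rcont (f : R -> C) (t : R) (l : C) : rdiff f t l -> rcont f t.
Proof.
intros H e He. destruct (rdiff_lip _ _ _ H) as [d [Hd K]].
assert (Hl := Cmod_ge_0 l).
assert (Hp : 0 < e / (Cmod l + 2)) by (apply Rdiv_lt_0_compat; lra).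
exists (Rmin d (e / (Cmod l + 2))); split; [apply Rmin_pos; lra|]. intros w Hw.
assert (H1 := Rmin_l d (e / (Cmod l + 2))); assert (H2 := Rmin_r d (e / (Cmod l + 2))).
assert (K1 := K w ltac:(lra)).
apply Rle_lt_trans with (1 := K1).
apply Rle_lt_trans with ((Cmod l + 1) * (e / (Cmod l + 2))).
- apply Rmult_le_compat_l; lra.
- apply Rlt_le_trans with ((Cmod l + 2) * (e / (Cmod l + 2))); [|apply Req_le; field; lra].
  apply Rmult_lt_compat_r; lra.
Qed.

Lemma rdiff_comp (G : C -> C) (f : R -> C) (t : R) (l v : C) :
  cdiff G (f t) l -> rdiff f t v -> rdiff (fun s => G (f s)) t (l * v)%C.
Proof.
intros HG Hf e He.
assert (Hl := Cmod_ge_0 l). assert (Hv := Cmod_ge_0 v).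
set (eta := e / (Cmod v + 1 + Cmod l)).
assert (Heta : 0 < eta) by (apply Rdiv_lt_0_compat; lra).
destruct (HG eta Heta) as [d1 [Hd1 K1]].
destruct (Hf eta Heta) as [d2 [Hd2 K2]].
destruct (rdiff_lip _ _ _ Hf) as [d3 [Hd3 K3]].
assert (Hp : 0 < d1 / (Cmod v + 1)) by (apply Rdiv_lt_0_compat; lra).
exists (Rmin (d1 / (Cmod v + 1)) (Rmin d2 d3)); split; [repeat apply Rmin_pos; lra|].
intros s Hs.
assert (A1 := Rmin_l (d1 / (Cmod v + 1)) (Rmin d2 d3)).
assert (A2 := Rmin_r (d1 / (Cmod v + 1)) (Rmin d2 d3)).
assert (A3 := Rmin_l d2 d3). assert (A4 := Rmin_r d2 d3).
assert (B3 := K3 s ltac:(lra)). assert (B2 := K2 s ltac:(lra)).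
assert (B1 := K1 (f s)).
assert (Hlt : Cmod (f s - f t) < d1).
{ apply Rle_lt_trans with (1 := B3).
  apply Rlt_le_trans with ((Cmod v + 1) * (d1 / (Cmod v + 1))); [|apply Req_le; field; lra].
  apply Rmult_lt_compat_l; lra. }
specialize (B1 Hlt).
replace (G (f s) - G (f t) - RtoC (s - t) * (l * v))%C with
  ((G (f s) - G (f t) - l * (f s - f t)) + l * (f s - f t - RtoC (s - t) * v))%C by ring.
apply Rle_trans with (1 := Cmod_triangle _ _). rewrite Cmod_mult.
apply Rle_trans with (eta * ((Cmod v + 1) * Rabs (s - t)) + Cmod l * (eta * Rabs (s - t))).
- apply Rplus_le_compat.
  + apply Rle_trans with (1 := B1). apply Rmult_le_compat_l; lra.
  + apply Rmult_le_compat_l; lra.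
- apply Req_le. unfold eta; field; lra.
Qed.

Lemma rcont_comp (G : C -> C) (f : R -> C) (t : R) (l : C) :
  cdiff G (f t) l -> rcont f t -> rcont (fun s => G (f s)) t.
Proof.
intros HG Hf e He. destruct (cdiff_cont _ _ _ HG e He) as [d [Hd K]].
destruct (Hf d Hd) as [d' [Hd' K']]. exists d'; split; [exact Hd'|].
intros s Hs; apply K, K', Hs.
Qed.

Lemma rcont_const (a : C) (t : R) : rcont (fun _ => a) t.
Proof.
intros e He; exists 1; split; [lra|]; intros s _.
replace (a - a)%C with (RtoC 0) by ring. rewrite Cmod_0; exact He.
Qed.

Lemma rcont_plus (f g : R -> C) (t : R) : rcont f t -> rcont g t -> rcont (fun s => f s + g s)%C t.
Proof.
intros Hf Hg e He. destruct (Hf (e / 2)) as [d1 [Hd1 K1]]; [lra|].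
destruct (Hg (e / 2)) as [d2 [Hd2 K2]]; [lra|].
exists (Rmin d1 d2); split; [apply Rmin_pos; lra|]; intros s Hs.
assert (H1 := Rmin_l d1 d2); assert (H2 := Rmin_r d1 d2).
replace (f s + g s - (f t + g t))%C with ((f s - f t) + (g s - g t))%C by ring.
apply Rle_lt_trans with (1 := Cmod_triangle _ _).
assert (A := K1 s ltac:(lra)); assert (B := K2 s ltac:(lra)). lra.
Qed.

Lemma rcont_mult (f g : R -> C) (t : R) : rcont f t -> rcont g t -> rcont (fun s => f s * g s)%C t.
Proof.
intros Hf Hg e He.
assert (Hft := Cmod_ge_0 (f t)). assert (Hgt := Cmod_ge_0 (g t)).
set (M := Cmod (f t) + Cmod (g t) + 1).
assert (HM : 0 < M) by (unfold M; lra).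
set (eta := Rmin 1 (e / M)).
assert (Heta : 0 < eta) by (apply Rmin_pos; [lra|apply Rdiv_lt_0_compat; lra]).
destruct (Hf eta Heta) as [d1 [Hd1 K1]]. destruct (Hg eta Heta) as [d2 [Hd2 K2]].
exists (Rmin d1 d2); split; [apply Rmin_pos; lra|]; intros s Hs.
assert (H1 := Rmin_l d1 d2); assert (H2 := Rmin_r d1 d2).
assert (A := K1 s ltac:(lra)); assert (B := K2 s ltac:(lra)).
replace (f s * g s - f t * g t)%C with
  ((f s - f t) * (g s - g t) + ((f s - f t) * g t + f t * (g s - g t)))%C by ring.
assert (E1 := Rmin_l 1 (e / M)); assert (E2 := Rmin_r 1 (e / M)). fold eta in E1, E2.
assert (A0 := Cmod_ge_0 (f s - f t)). assert (B0 := Cmod_ge_0 (g s - g t)).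
apply Rle_lt_trans with (Cmod (f s - f t) * 1 + (Cmod (f s - f t) * Cmod (g t) + Cmod (f t) * eta)).
- apply Rle_trans with (1 := Cmod_triangle _ _). rewrite Cmod_mult.
  apply Rplus_le_compat; [apply Rmult_le_compat_l; lra|].
  apply Rle_trans with (1 := Cmod_triangle _ _). rewrite !Cmod_mult.
  apply Rplus_le_compat_l, Rmult_le_compat_l; lra.
- assert (E3 : M * eta <= e).
  { apply Rle_trans with (M * (e / M)); [apply Rmult_le_compat_l; lra|apply Req_le; field; lra]. }
  unfold M in E3.
  apply Rlt_le_trans with ((Cmod (g t) + 1) * eta + Cmod (f t) * eta); [|lra].
  assert ((Cmod (g t) + 1) * Cmod (f s - f t) < (Cmod (g t) + 1) * eta) by (apply Rmult_lt_compat_l; lra).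
  lra.
Qed.

(** A bounded linear map commutes with Riemann sums and is continuous, so it passes to the limit. It
    serves for multiplication by a complex constant and for A |-> x'(A x), which turns the integral
    in B(X) into a scalar one. *)
Lemma is_RInt_linear (V W : CompleteNormedModule C_AbsRing) (L : V -> W) (f : R -> V) (a b : R) (I : V) :
  is_linear L -> is_RInt (V := V_R V) f a b I -> is_RInt (V := V_R W) (fun t => L (f t)) a b (L I).
Proof.
intros HL H.
assert (HLR : is_linear (K := R_AbsRing) (U := V_R V) (V := V_R W) L).
{ split.
  - exact (linear_plus L HL).
  - intros k x. exact (linear_scal L HL (RtoC k) x).
  - exact (linear_norm L HL). }
unfold is_RInt in *.
apply filterlim_ext with (fun ptd => L (scal (K := R_Ring) (V := V_R V) (sign (b - a)) (Riemann_sum (V := V_R V) f ptd))).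
- intros ptd. rewrite (linear_scal (K := R_AbsRing) (U := V_R V) (V := V_R W) L HLR). f_equal.
  apply SF_cons_ind with (s := ptd).
  + intros x0. exact (linear_zero (K := R_AbsRing) (U := V_R V) (V := V_R W) L HLR).
  + intros h s IH. rewrite !Riemann_sum_cons.
    rewrite (linear_plus (K := R_AbsRing) (U := V_R V) (V := V_R W) L HLR), IH.
    f_equal. exact (linear_scal (K := R_AbsRing) (U := V_R V) (V := V_R W) L HLR _ _).
- eapply filterlim_comp; [exact H|].
  exact (linear_cont (K := R_AbsRing) (U := V_R V) (V := V_R W) L I HLR).
Qed.

(** * Goursat's theorem *)

Definition cint (f : R -> C) (a b : R) : C := RInt (V := VC) f a b.

Definition rcont_on (f : R -> C) (a b : R) : Prop := forall t, a <= t <= b -> rcont f t.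

Lemma cint_correct (f : R -> C) (a b : R) : a <= b -> rcont_on f a b ->
  is_RInt (V := VC) f a b (cint f a b).
Proof.
intros Hab H. apply (RInt_correct (V := VC)).
apply (ex_RInt_continuous (V := VC)). intros t Ht.
rewrite Rmin_left, Rmax_right in Ht by exact Hab.
apply rcont_continuous, H, Ht.
Qed.

Lemma cint_unique (f : R -> C) (a b : R) (I : C) : is_RInt (V := VC) f a b I -> cint f a b = I.
Proof. apply (is_RInt_unique (V := VC)). Qed.

Lemma cint_ext (f g : R -> C) (a b : R) : a <= b ->
  (forall t, a <= t <= b -> f t = g t) -> cint f a b = cint g a b.
Proof.
intros Hab H. apply (RInt_ext (V := VC)). intros t Ht.
rewrite Rmin_left, Rmax_right in Ht by exact Hab. apply H; lra.
Qed.

Lemma cint_plus (f g : R -> C) (a b : R) : a <= b -> rcont_on f a b -> rcont_on g a b ->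
  cint (fun t => f t + g t)%C a b = (cint f a b + cint g a b)%C.
Proof.
intros Hab Hf Hg. apply cint_unique.
apply (is_RInt_plus (V := VC)); apply cint_correct; assumption.
Qed.

Lemma cint_scal (c : C) (f : R -> C) (a b : R) : a <= b -> rcont_on f a b ->
  cint (fun t => c * f t)%C a b = (c * cint f a b)%C.
Proof.
intros Hab Hf. apply cint_unique.
apply (is_RInt_linear C_CompleteNormedModule C_CompleteNormedModule (fun z : C => (c * z)%C)).
- exact (is_linear_scal_r (K := C_AbsRing) (V := C_NormedModule) c Cmult_comm).
- apply cint_correct; assumption.
Qed.

Lemma cint_const (c : C) (a b : R) : cint (fun _ => c) a b = (RtoC (b - a) * c)%C.
Proof. apply (RInt_const (V := VC)). Qed.

Lemma cint_Chasles (f : R -> C) (a b c : R) : a <= b -> b <= c -> rcont_on f a c ->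
  (cint f a b + cint f b c)%C = cint f a c.
Proof.
intros Hab Hbc H. symmetry; apply cint_unique.
apply (is_RInt_Chasles (V := VC)) with b; apply cint_correct; try assumption;
  intros t Ht; apply H; lra.
Qed.

Lemma cint_norm_le_int (f : R -> C) (g : R -> R) (a b : R) : a <= b -> rcont_on f a b ->
  ex_RInt g a b -> (forall t, a <= t <= b -> Cmod (f t) <= g t) ->
  Cmod (cint f a b) <= RInt g a b.
Proof.
intros Hab Hf Hg H.
apply (norm_RInt_le (V := VC) f g a b); [exact Hab|exact H| |].
- apply cint_correct; assumption.
- apply (RInt_correct (V := R_CompleteNormedModule)); exact Hg.
Qed.

Lemma cint_norm_le (f : R -> C) (M : R) (a b : R) : a <= b -> rcont_on f a b ->
  (forall t, a <= t <= b -> Cmod (f t) <= M) ->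
  Cmod (cint f a b) <= (b - a) * M.
Proof.
intros Hab Hf H.
assert (E : RInt (fun _ => M) a b = (b - a) * M) by apply (RInt_const (V := R_CompleteNormedModule)).
rewrite <- E.
apply cint_norm_le_int; try assumption.
apply (ex_RInt_const (V := R_NormedModule)).
Qed.

Lemma cint_derive (f df : R -> C) (a b : R) : a <= b ->
  (forall t, a <= t <= b -> rdiff f t (df t)) -> rcont_on df a b ->
  cint df a b = (f b - f a)%C.
Proof.
intros Hab Hf Hdf. apply cint_unique.
apply (is_RInt_derive (V := VC) f df); intros t Ht;
  rewrite Rmin_left, Rmax_right in Ht by exact Hab.
- apply rdiff_is_derive, Hf, Ht.
- apply rcont_continuous, Hdf, Ht.
Qed.

Lemma rcont_scal (c : C) (f : R -> C) (t : R) : rcont f t -> rcont (fun s => c * f s)%C t.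
Proof. intros H; apply rcont_mult; [apply rcont_const|exact H]. Qed.

(** * Bisection of a rectangle *)

Section Bisection.

Variable beta : R -> R -> R -> R -> R.
Variables s0 s1 t0 t1 : R.
Hypotheses (Hs : s0 <= s1) (Ht : t0 <= t1).
Hypothesis beta_split : forall a b c d, s0 <= a -> a <= b -> b <= s1 ->
  t0 <= c -> c <= d -> d <= t1 ->
  let m := (a + b) / 2 in let n := (c + d) / 2 in
  beta a b c d <= beta a m c n + beta a m n d + beta m b c n + beta m b n d.
Hypothesis beta_local : forall s t, s0 <= s <= s1 -> t0 <= t <= t1 -> forall e, 0 < e ->
  exists r, 0 < r /\ forall a b c d, s0 <= a -> a <= s <= b -> b <= s1 ->
    t0 <= c -> c <= t <= d -> d <= t1 -> b - a < r -> d - c < r ->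
    beta a b c d <= e * ((b - a) + (d - c)) ^ 2.

(** Keeping the inclusion in the original rectangle inside the record lets bisection be iterated as
    a map from [rect] to itself. *)
Record rect := Rect { ra : R; rb : R; rc : R; rd : R;
  rect_ok : s0 <= ra /\ ra <= rb /\ rb <= s1 /\ t0 <= rc /\ rc <= rd /\ rd <= t1 }.

Definition rbeta (q : rect) : R := beta (ra q) (rb q) (rc q) (rd q).

Definition child (q p : rect) : Prop :=
  ra q <= ra p /\ rb p <= rb q /\ rc q <= rc p /\ rd p <= rd q /\
  rb p - ra p = (rb q - ra q) / 2 /\ rd p - rc p = (rd q - rc q) / 2 /\
  rbeta q <= 4 * rbeta p.

(** Pigeonhole: if every quarter had less than a fourth of [rbeta q], the four could not add up to
    it. *)
Lemma child_exists (q : rect) : exists p, child q p.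
Proof.
destruct q as [a b c d [H1 [H2 [H3 [H4 [H5 H6]]]]]].
assert (HB := beta_split a b c d H1 H2 H3 H4 H5 H6). simpl in HB.
set (m := (a + b) / 2) in *. set (n := (c + d) / 2) in *.
assert (a <= m <= b) by (unfold m; lra). assert (c <= n <= d) by (unfold n; lra).
destruct (Rle_dec (beta a b c d) (4 * beta a m c n)) as [K|K];
  [|destruct (Rle_dec (beta a b c d) (4 * beta a m n d)) as [K1|K1];
  [|destruct (Rle_dec (beta a b c d) (4 * beta m b c n)) as [K2|K2]]].
- unshelve eexists (@Rect a m c n _); [repeat split; lra|].
  unfold child, rbeta; simpl. unfold m, n in *; repeat split; lra.
- unshelve eexists (@Rect a m n d _); [repeat split; lra|].
  unfold child, rbeta; simpl. unfold m, n in *; repeat split; lra.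
- unshelve eexists (@Rect m b c n _); [repeat split; lra|].
  unfold child, rbeta; simpl. unfold m, n in *; repeat split; lra.
- unshelve eexists (@Rect m b n d _); [repeat split; lra|].
  unfold child, rbeta; simpl. unfold m, n in *; repeat split; lra.
Qed.

Definition next (q : rect) : rect := proj1_sig (constructive_indefinite_description _ (child_exists q)).

Lemma next_child (q : rect) : child q (next q).
Proof. exact (proj2_sig (constructive_indefinite_description _ (child_exists q))). Qed.

Lemma nested_point (u v : nat -> R) : (forall n, u n <= u (S n)) -> (forall n, v (S n) <= v n) ->
  (forall n, u n <= v n) -> exists x, forall n, u n <= x <= v n.
Proof.
intros Hu Hv Huv.
assert (Mu : forall n k, u n <= u (n + k)%nat).
{ intros n k; induction k as [|k IH]; [rewrite Nat.add_0_r; lra|].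
  rewrite Nat.add_succ_r. specialize (Hu (n + k)%nat); lra. }
assert (Mv : forall n k, v (n + k)%nat <= v n).
{ intros n k; induction k as [|k IH]; [rewrite Nat.add_0_r; lra|].
  rewrite Nat.add_succ_r. specialize (Hv (n + k)%nat); lra. }
assert (Muv : forall n k, u n <= v k).
{ intros n k. assert (A := Mu n k); assert (B := Mv k n). rewrite Nat.add_comm in B.
  specialize (Huv (n + k)%nat); lra. }
destruct (completeness (fun x => exists n, x = u n)) as [x [Hx1 Hx2]].
- exists (v 0%nat). intros x [n ->]; apply Muv.
- exists (u 0%nat), 0%nat; reflexivity.
- exists x; intros n; split; [apply Hx1; exists n; reflexivity|].
  apply Hx2; intros y [k ->]; apply Muv.
Qed.

(** After n bisections, [beta] of the whole is at most 4^n times its value on a rectangle of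
    half-perimeter L/2^n around a common point, hence at most e L^2 by the local hypothesis, with e
    as small as desired. In Goursat's theorem [beta] is the modulus of a boundary integral. *)
Lemma bisection_le_0 : beta s0 s1 t0 t1 <= 0.
Proof.
set (q0 := @Rect s0 s1 t0 t1 ltac:(repeat split; lra)).
set (q := fun n => Nat.iter n next q0).
assert (Hq : forall n, child (q n) (q (S n))) by (intros n; apply next_child).
destruct (nested_point (fun n => ra (q n)) (fun n => rb (q n))) as [s Hsn].
{ intros n; apply (Hq n). } { intros n; apply (Hq n). } { intros n; apply (rect_ok (q n)). }
destruct (nested_point (fun n => rc (q n)) (fun n => rd (q n))) as [t Htn].
{ intros n; apply (Hq n). } { intros n; apply (Hq n). } { intros n; apply (rect_ok (q n)). }
assert (W : forall n, rb (q n) - ra (q n) = (s1 - s0) * / 2 ^ n /\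
   rd (q n) - rc (q n) = (t1 - t0) * / 2 ^ n /\ beta s0 s1 t0 t1 <= 4 ^ n * rbeta (q n)).
{ induction n as [|n [I1 [I2 I3]]].
  - unfold q, q0, rbeta; simpl. repeat split; lra.
  - destruct (Hq n) as [_ [_ [_ [_ [J1 [J2 J3]]]]]].
    assert (P2 : 0 < 2 ^ n) by (apply pow_lt; lra).
    assert (P4 : 0 < 4 ^ n) by (apply pow_lt; lra).
    rewrite J1, J2, I1, I2. simpl. repeat split; try (field; lra).
    apply Rle_trans with (1 := I3). rewrite (Rmult_comm 4), Rmult_assoc.
    apply Rmult_le_compat_l; [lra|exact J3]. }
apply Rnot_lt_le; intros Hpos.
set (L := (s1 - s0) + (t1 - t0)).
assert (HL : 0 <= L) by (unfold L; lra).
(* Makes e L^2 at most half of the supposedly positive value; the added 1 covers a degenerate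
   rectangle with L = 0. *)
set (e := beta s0 s1 t0 t1 / (2 * (L ^ 2 + 1))).
assert (HL2 : 0 <= L ^ 2) by (apply pow_le; exact HL).
assert (He : 0 < e) by (apply Rdiv_lt_0_compat; lra).
assert (Hs0 := Hsn 0%nat). assert (Ht0 := Htn 0%nat). simpl in Hs0, Ht0.
destruct (beta_local s t Hs0 Ht0 e He) as [r [Hr K]].
assert (HN : exists n, L * / 2 ^ n < r).
{ destruct (pow_lt_1_zero (/ 2) ltac:(rewrite Rabs_pos_eq; lra) (r / (L + 1))) as [n Hn].
  { apply Rdiv_lt_0_compat; lra. }
  exists n. specialize (Hn n (le_n n)). rewrite pow_inv in Hn.
  assert (P2 : 0 < / 2 ^ n) by (apply Rinv_0_lt_compat, pow_lt; lra).
  rewrite Rabs_pos_eq in Hn by lra.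
  apply Rle_lt_trans with ((L + 1) * / 2 ^ n); [apply Rmult_le_compat_r; lra|].
  apply Rlt_le_trans with ((L + 1) * (r / (L + 1))); [apply Rmult_lt_compat_l; lra|].
  apply Req_le; field; lra. }
destruct HN as [n Hn]. destruct (W n) as [W1 [W2 W3]].
assert (P2 : 0 < / 2 ^ n) by (apply Rinv_0_lt_compat, pow_lt; lra).
assert (S1 : (s1 - s0) * / 2 ^ n <= L * / 2 ^ n) by (apply Rmult_le_compat_r; unfold L; lra).
assert (S2 : (t1 - t0) * / 2 ^ n <= L * / 2 ^ n) by (apply Rmult_le_compat_r; unfold L; lra).
destruct (rect_ok (q n)) as [R1 [R2 [R3 [R4 [R5 R6]]]]].
assert (B := K _ _ _ _ R1 (Hsn n) R3 R4 (Htn n) R6 ltac:(lra) ltac:(lra)).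
fold (rbeta (q n)) in B. rewrite W1, W2 in B.
replace ((s1 - s0) * / 2 ^ n + (t1 - t0) * / 2 ^ n) with (L * / 2 ^ n) in B by (unfold L; ring).
assert (P4 : 0 < 4 ^ n) by (apply pow_lt; lra).
assert (F : beta s0 s1 t0 t1 <= e * L ^ 2).
{ apply Rle_trans with (1 := W3).
  apply Rle_trans with (4 ^ n * (e * (L * / 2 ^ n) ^ 2)); [apply Rmult_le_compat_l; lra|].
  replace 4 with (2 * 2) by ring. rewrite Rpow_mult_distr. apply Req_le. field.
  apply pow_nonzero; lra. }
assert (G : e * L ^ 2 <= beta s0 s1 t0 t1 / 2).
{ replace (beta s0 s1 t0 t1 / 2) with (e * (L ^ 2 + 1)) by (unfold e; field; lra).
  apply Rmult_le_compat_l; lra. }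
lra.
Qed.

End Bisection.

Definition cdiffable (f : C -> C) (z : C) : Prop := exists l, cdiff f z l.

Lemma rdiff_lipschitz (f df : R -> C) (a b M : R) : a <= b ->
  (forall t, a <= t <= b -> rdiff f t (df t)) -> rcont_on df a b ->
  (forall t, a <= t <= b -> Cmod (df t) <= M) -> Cmod (f b - f a) <= M * (b - a).
Proof.
intros Hab Hf Hdf HM. rewrite <- (cint_derive f df a b Hab Hf Hdf), Rmult_comm.
apply cint_norm_le; assumption.
Qed.

(** * Boundary integrals over parametrised rectangles *)

Section Goursat.

Variables gam gs gt : R -> R -> C.
Hypothesis gam_s : forall s t, rdiff (fun s => gam s t) s (gs s t).
Hypothesis gam_t : forall s t, rdiff (fun t => gam s t) t (gt s t).
Hypothesis gs_cont : forall s t, rcont (fun s => gs s t) s.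
Hypothesis gt_cont : forall s t, rcont (fun t => gt s t) t.

(* The contour integral of g along the image under gam of the boundary of
   the rectangle [a, b] x [c, d]. *)
Definition bdint (g : C -> C) (a b c d : R) : C :=
  (cint (fun s => g (gam s c) * gs s c) a b + cint (fun t => g (gam b t) * gt b t) c d
   - cint (fun s => g (gam s d) * gs s d) a b - cint (fun t => g (gam a t) * gt a t) c d)%C.

Definition diffable_on (g : C -> C) (a b c d : R) : Prop :=
  forall s t, a <= s <= b -> c <= t <= d -> cdiffable g (gam s t).

Lemma horizontal_edge_cont (g : C -> C) (a b t : R) :
  (forall s, a <= s <= b -> cdiffable g (gam s t)) ->
  rcont_on (fun s => g (gam s t) * gs s t)%C a b.
Proof.
intros H s Hs. apply rcont_mult; [|apply gs_cont].
destruct (H s Hs) as [l Hl].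
apply (rcont_comp g (fun s => gam s t) s l Hl). exact (rdiff_rcont _ _ _ (gam_s s t)).
Qed.

Lemma vertical_edge_cont (g : C -> C) (a b s : R) :
  (forall t, a <= t <= b -> cdiffable g (gam s t)) ->
  rcont_on (fun t => g (gam s t) * gt s t)%C a b.
Proof.
intros H t Ht. apply rcont_mult; [|apply gt_cont].
destruct (H t Ht) as [l Hl].
apply (rcont_comp g (fun t => gam s t) t l Hl). exact (rdiff_rcont _ _ _ (gam_t s t)).
Qed.

Lemma bdint_split (g : C -> C) (a m b c n d : R) : a <= m -> m <= b -> c <= n -> n <= d ->
  diffable_on g a b c d ->
  bdint g a b c d = (bdint g a m c n + bdint g a m n d + bdint g m b c n + bdint g m b n d)%C.
Proof.
intros Ham Hmb Hcn Hnd H. unfold bdint.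
rewrite <- (cint_Chasles (fun s => g (gam s c) * gs s c)%C a m b),
  <- (cint_Chasles (fun s => g (gam s d) * gs s d)%C a m b),
  <- (cint_Chasles (fun t => g (gam b t) * gt b t)%C c n d),
  <- (cint_Chasles (fun t => g (gam a t) * gt a t)%C c n d); try assumption.
- ring.
- apply vertical_edge_cont; intros t Ht; apply H; lra.
- apply vertical_edge_cont; intros t Ht; apply H; lra.
- apply horizontal_edge_cont; intros s Hs; apply H; lra.
- apply horizontal_edge_cont; intros s Hs; apply H; lra.
Qed.

(** The edge integrals are increments of G between the corners and cancel. It is applied to affine
    integrands, whose primitives are entire. *)
Lemma bdint_primitive (G g : C -> C) (a b c d : R) : a <= b -> c <= d ->
  (forall z, cdiff G z (g z)) -> (forall z, cdiffable g z) -> bdint g a b c d = 0%C.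
Proof.
intros Hab Hcd HG Hg. unfold bdint.
assert (Es : forall t, cint (fun s => g (gam s t) * gs s t)%C a b = (G (gam b t) - G (gam a t))%C).
{ intros t. apply (cint_derive (fun s => G (gam s t)) _ a b Hab).
  - intros s _. apply (rdiff_comp G (fun s => gam s t)); [apply HG|apply gam_s].
  - apply horizontal_edge_cont; intros s _; apply Hg. }
assert (Et : forall s, cint (fun t => g (gam s t) * gt s t)%C c d = (G (gam s d) - G (gam s c))%C).
{ intros s. apply (cint_derive (fun t => G (gam s t)) _ c d Hcd).
  - intros t _. apply (rdiff_comp G (fun t => gam s t)); [apply HG|apply gam_t].
  - apply vertical_edge_cont; intros t _; apply Hg. }
rewrite !Es, !Et. ring.
Qed.

Lemma bdint_plus (g h : C -> C) (a b c d : R) : a <= b -> c <= d ->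
  diffable_on g a b c d -> diffable_on h a b c d ->
  bdint (fun z => g z + h z)%C a b c d = (bdint g a b c d + bdint h a b c d)%C.
Proof.
intros Hab Hcd Hg Hh. unfold bdint.
assert (Es : forall t, c <= t <= d -> cint (fun s => (g (gam s t) + h (gam s t)) * gs s t)%C a b
  = (cint (fun s => g (gam s t) * gs s t) a b + cint (fun s => h (gam s t) * gs s t) a b)%C).
{ intros t Ht. rewrite <- cint_plus; [|exact Hab| |].
  - apply cint_ext; [exact Hab|intros s _; ring].
  - apply horizontal_edge_cont; intros s Hs; apply Hg; assumption.
  - apply horizontal_edge_cont; intros s Hs; apply Hh; assumption. }
assert (Et : forall s, a <= s <= b -> cint (fun t => (g (gam s t) + h (gam s t)) * gt s t)%C c d
  = (cint (fun t => g (gam s t) * gt s t) c d + cint (fun t => h (gam s t) * gt s t) c d)%C).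
{ intros s Hs. rewrite <- cint_plus; [|exact Hcd| |].
  - apply cint_ext; [exact Hcd|intros t _; ring].
  - apply vertical_edge_cont; intros t Ht; apply Hg; assumption.
  - apply vertical_edge_cont; intros t Ht; apply Hh; assumption. }
rewrite !Es, !Et by lra. ring.
Qed.

Lemma bdint_norm_le (g : C -> C) (a b c d M K : R) : a <= b -> c <= d ->
  diffable_on g a b c d ->
  (forall s t, a <= s <= b -> c <= t <= d -> Cmod (g (gam s t)) <= K /\ Cmod (gs s t) <= M /\ Cmod (gt s t) <= M) ->
  Cmod (bdint g a b c d) <= 2 * ((b - a) + (d - c)) * (K * M).
Proof.
intros Hab Hcd Hg HB. unfold bdint.
assert (Es : forall t, c <= t <= d -> Cmod (cint (fun s => g (gam s t) * gs s t)%C a b) <= (b - a) * (K * M)).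
{ intros t Ht. apply cint_norm_le; [exact Hab| |].
  - apply horizontal_edge_cont; intros s Hs; apply Hg; assumption.
  - intros s Hs. rewrite Cmod_mult. apply Rmult_le_compat; try apply Cmod_ge_0; apply HB; assumption. }
assert (Et : forall s, a <= s <= b -> Cmod (cint (fun t => g (gam s t) * gt s t)%C c d) <= (d - c) * (K * M)).
{ intros s Hs. apply cint_norm_le; [exact Hcd| |].
  - apply vertical_edge_cont; intros t Ht; apply Hg; assumption.
  - intros t Ht. rewrite Cmod_mult. apply Rmult_le_compat; try apply Cmod_ge_0; apply HB; assumption. }
assert (E1 := Es c ltac:(lra)). assert (E2 := Es d ltac:(lra)).
assert (E3 := Et a ltac:(lra)). assert (E4 := Et b ltac:(lra)).
eapply Rle_trans; [apply Cmod_minus_le|].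
eapply Rle_trans; [apply Rplus_le_compat_r, Cmod_minus_le|].
eapply Rle_trans; [apply Rplus_le_compat_r, Rplus_le_compat_r, Cmod_triangle|]. lra.
Qed.

Variables (s0 s1 t0 t1 M : R).
Hypotheses (Hs01 : s0 <= s1) (Ht01 : t0 <= t1).
Hypothesis speed : forall s t, s0 <= s <= s1 -> t0 <= t <= t1 -> Cmod (gs s t) <= M /\ Cmod (gt s t) <= M.

(** Integrating the speed along one coordinate at a time shows that a small parameter rectangle has
    a small image, on which differentiability of [g] at a single point gives control. *)
Lemma gam_lipschitz (s s' t t' : R) : s0 <= s <= s1 -> s0 <= s' <= s1 -> t0 <= t <= t1 -> t0 <= t' <= t1 ->
  Cmod (gam s t - gam s' t') <= M * (Rabs (s - s') + Rabs (t - t')).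
Proof.
assert (Ls : forall s s' t, s0 <= s <= s1 -> s0 <= s' <= s1 -> t0 <= t <= t1 ->
  Cmod (gam s t - gam s' t) <= M * Rabs (s - s')).
{ assert (L : forall s s' t, s0 <= s -> s <= s' -> s' <= s1 -> t0 <= t <= t1 ->
    Cmod (gam s' t - gam s t) <= M * (s' - s)).
  { intros u u' v Hu Huu Hu' Hv.
    apply (rdiff_lipschitz (fun s => gam s v) (fun s => gs s v)); [exact Huu| | |].
    - intros x _; apply gam_s.
    - intros x _; apply gs_cont.
    - intros x Hx; apply speed; lra. }
  intros u u' v Hu Hu' Hv. destruct (Rle_dec u u').
  - rewrite Cmod_minus_sym, Rabs_minus_sym, (Rabs_pos_eq (u' - u)) by lra. apply L; lra.
  - rewrite Rabs_pos_eq by lra. apply L; lra. }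
assert (Lt : forall s t t', s0 <= s <= s1 -> t0 <= t <= t1 -> t0 <= t' <= t1 ->
  Cmod (gam s t - gam s t') <= M * Rabs (t - t')).
{ assert (L : forall s t t', s0 <= s <= s1 -> t0 <= t -> t <= t' -> t' <= t1 ->
    Cmod (gam s t' - gam s t) <= M * (t' - t)).
  { intros u v v' Hu Hv Hvv Hv'.
    apply (rdiff_lipschitz (fun t => gam u t) (fun t => gt u t)); [exact Hvv| | |].
    - intros x _; apply gam_t.
    - intros x _; apply gt_cont.
    - intros x Hx; apply speed; lra. }
  intros u v v' Hu Hv Hv'. destruct (Rle_dec v v').
  - rewrite Cmod_minus_sym, Rabs_minus_sym, (Rabs_pos_eq (v' - v)) by lra. apply L; lra.
  - rewrite Rabs_pos_eq by lra. apply L; lra. }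
intros H1 H2 H3 H4.
replace (gam s t - gam s' t')%C with ((gam s t - gam s' t) + (gam s' t - gam s' t'))%C by ring.
eapply Rle_trans; [apply Cmod_triangle|]. rewrite Rmult_plus_distr_l.
apply Rplus_le_compat; [apply Ls|apply Lt]; assumption.
Qed.

(* On a small rectangle g agrees with an affine map, whose boundary integral
   vanishes, up to an error quadratic in the side, times epsilon. *)
Theorem goursat (g : C -> C) : diffable_on g s0 s1 t0 t1 -> bdint g s0 s1 t0 t1 = 0%C.
Proof.
intros Hg. apply Cmod_eq_0. apply Rle_antisym; [|apply Cmod_ge_0].
assert (HM : 0 <= M).
{ destruct (speed s0 t0 ltac:(lra) ltac:(lra)) as [H _]. assert (K := Cmod_ge_0 (gs s0 t0)); lra. }
apply (bisection_le_0 (fun a b c d => Cmod (bdint g a b c d))); [exact Hs01|exact Ht01| |].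
- intros a b c d H1 H2 H3 H4 H5 H6 m n.
  rewrite (bdint_split g a m b c n d); try (unfold m, n; lra).
  + eapply Rle_trans; [apply Cmod_triangle|]. apply Rplus_le_compat_r.
    eapply Rle_trans; [apply Cmod_triangle|]. apply Rplus_le_compat_r. apply Cmod_triangle.
  + intros s t Hs Ht; apply Hg; lra.
- intros s t Hs Ht e He.
  destruct (Hg s t Hs Ht) as [l Hl]. set (p := gam s t) in *.
  assert (HM2 : 0 <= M * M) by (apply Rmult_le_pos; exact HM).
  (* The boundary has parameter length 2 L and speed at most M, and the affine error on it is at
     most this tolerance times M L; the product, 2 M^2 L^2 times the tolerance, stays below e
     L^2. *)
  destruct (Hl (e / (2 * (M * M) + 1))) as [r [Hr K]]; [apply Rdiv_lt_0_compat; lra|].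
  (* Sides shorter than this keep the image within r of p, by the Lipschitz bound. *)
  exists (r / (2 * M + 1)); split; [apply Rdiv_lt_0_compat; lra|].
  intros a b c d Ha Hsab Hb Hc Htcd Hd Hab Hcd.
  set (A := fun z => (g p + l * (z - p))%C). set (E := fun z => (g z - A z)%C).
  assert (dA : forall z, cdiff A z l).
  { intros z. eapply cdiff_eq; [unfold A; apply cdiff_plus; [apply cdiff_const|apply cdiff_mult;
      [apply cdiff_const|apply cdiff_plus; [apply cdiff_id|apply cdiff_const]]]|]. cbv beta. ring. }
  assert (dE : diffable_on E a b c d).
  { intros u v Hu Hv. destruct (Hg u v ltac:(lra) ltac:(lra)) as [k Hk].
    exists (k + - (1) * l + 0)%C. unfold E.
    eapply cdiff_eq; [apply cdiff_plus with (g := fun z => (- A z)%C)|].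
    - exact Hk.
    - apply (cdiff_ext_loc (fun z => - (1) * A z)%C) with 1; [lra|intros; ring|].
      apply cdiff_mult; [apply cdiff_const|apply dA].
    - cbv beta. ring. }
  assert (EB : bdint g a b c d = bdint E a b c d).
  { replace (bdint E a b c d) with (bdint A a b c d + bdint E a b c d)%C.
    - rewrite <- bdint_plus; [|lra|lra| |exact dE].
      + f_equal. apply functional_extensionality. intros z; unfold E; ring.
      + intros u v _ _; exists l; apply dA.
    - rewrite (bdint_primitive (fun z => g p * z + l * ((z - p) * (z - p)) / 2)%C A); [ring|lra|lra| |].
      + intros z. eapply cdiff_eq.
        * apply cdiff_plus; [apply cdiff_mult; [apply cdiff_const|apply cdiff_id]|].
          apply cdiff_mult; [|apply cdiff_const].
          apply cdiff_mult; [apply cdiff_const|].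
          apply cdiff_mult; (apply cdiff_plus; [apply cdiff_id|apply cdiff_const]).
        * unfold A. cbv beta. field.
      + intros z; exists l; apply dA. }
  rewrite EB. set (L := (b - a) + (d - c)).
  assert (HL : 0 <= L) by (unfold L; lra).
  eapply Rle_trans; [apply (bdint_norm_le E a b c d M (e / (2 * (M * M) + 1) * (M * L)))|].
  + lra.
  + lra.
  + exact dE.
  + intros u v Hu Hv. split; [|apply speed; lra].
    assert (Hd1 : Cmod (gam u v - p) <= M * L).
    { eapply Rle_trans; [apply gam_lipschitz; lra|]. apply Rmult_le_compat_l; [exact HM|].
      unfold L. apply Rplus_le_compat; apply Rabs_le; lra. }
    unfold E, A.
    replace (g (gam u v) - (g p + l * (gam u v - p)))%C with (g (gam u v) - g p - l * (gam u v - p))%C by ring.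
    eapply Rle_trans; [apply K|].
    * apply Rle_lt_trans with (1 := Hd1).
      apply Rle_lt_trans with (M * (2 * (r / (2 * M + 1)))); [apply Rmult_le_compat_l; unfold L; lra|].
      apply Rlt_le_trans with ((2 * M + 1) * (r / (2 * M + 1))); [|apply Req_le; field; lra].
      assert (0 < r / (2 * M + 1)) by (apply Rdiv_lt_0_compat; lra). lra.
    * apply Rmult_le_compat_l; [|exact Hd1]. left; apply Rdiv_lt_0_compat; lra.
  + fold L. assert (0 <= L ^ 2) by (apply pow_le; exact HL).
    replace (2 * L * (e / (2 * (M * M) + 1) * (M * L) * M)) with
      (e * L ^ 2 * ((2 * (M * M)) / (2 * (M * M) + 1))) by (field; lra).
    rewrite <- (Rmult_1_r (e * L ^ 2)) at 2. apply Rmult_le_compat_l; [apply Rmult_le_pos; lra|].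
    apply Rmult_le_reg_r with (2 * (M * M) + 1); [lra|].
    unfold Rdiv. rewrite Rmult_assoc, Rinv_l; lra.
Qed.

End Goursat.

(** * Circles and contour integrals over them *)

Lemma Cmod_pair_le (x y : R) : Cmod (x, y) <= Rabs x + Rabs y.
Proof.
replace ((x, y) : C) with (RtoC x + Ci * RtoC y)%C
  by (unfold RtoC, Ci, Cplus, Cmult; simpl; f_equal; ring).
eapply Rle_trans; [apply Cmod_triangle|]. rewrite Cmod_mult, Cmod_Ci, !Cmod_R. lra.
Qed.

Lemma is_derive_expand (f : R -> R) (t l e : R) : is_derive f t l -> 0 < e ->
  exists d, 0 < d /\ forall s, Rabs (s - t) < d -> Rabs (f s - f t - (s - t) * l) <= e * Rabs (s - t).
Proof.
intros [_ H] He. destruct (H t (fun P HP => HP) (mkposreal e He)) as [d Hd].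
exists d; split; [apply cond_pos|]. intros s Hs. exact (Hd s Hs).
Qed.

Lemma rdiff_pair (f g : R -> R) (t l m : R) : is_derive f t l -> is_derive g t m ->
  rdiff (fun s => (f s, g s)) t (l, m).
Proof.
intros Hf Hg e He.
destruct (is_derive_expand f t l (e / 2) Hf ltac:(lra)) as [d1 [Hd1 K1]].
destruct (is_derive_expand g t m (e / 2) Hg ltac:(lra)) as [d2 [Hd2 K2]].
exists (Rmin d1 d2); split; [apply Rmin_pos; lra|]. intros s Hs.
assert (H1 := Rmin_l d1 d2); assert (H2 := Rmin_r d1 d2).
specialize (K1 s ltac:(lra)). specialize (K2 s ltac:(lra)).
replace ((f s, g s) - (f t, g t) - RtoC (s - t) * (l, m))%C with
  ((f s - f t - (s - t) * l, g s - g t - (s - t) * m) : C)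
  by (unfold RtoC, Cminus, Cplus, Copp, Cmult; simpl; f_equal; ring).
eapply Rle_trans; [apply Cmod_pair_le|]. lra.
Qed.

Definition ei (t : R) : C := (cos t, sin t).

Lemma circle_ei (rho t : R) : circle rho t = (RtoC rho * ei t)%C.
Proof. unfold circle, ei, RtoC, Cmult; simpl; f_equal; ring. Qed.

Lemma Cmod_ei (t : R) : Cmod (ei t) = 1.
Proof.
unfold Cmod, ei; simpl. rewrite !Rmult_1_r.
assert (H := sin2_cos2 t). unfold Rsqr in H. rewrite Rplus_comm, H. apply sqrt_1.
Qed.

Lemma Cmod_circle (rho t : R) : Cmod (circle rho t) = Rabs rho.
Proof. rewrite circle_ei, Cmod_mult, Cmod_R, Cmod_ei; ring. Qed.

Lemma rdiff_ei (t : R) : rdiff ei t (Ci * ei t)%C.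
Proof.
replace (Ci * ei t)%C with ((- sin t, cos t) : C)
  by (unfold Ci, ei, Cmult; simpl; f_equal; ring).
apply rdiff_pair; auto_derive; trivial; ring.
Qed.

Lemma ei_2PI : ei (2 * PI) = ei 0.
Proof. unfold ei. rewrite cos_2PI, sin_2PI, cos_0, sin_0; reflexivity. Qed.

Lemma rdiff_affine (a b : C) (t : R) : rdiff (fun s => a + RtoC s * b)%C t b.
Proof.
intros e He; exists 1; split; [lra|]; intros s _.
replace (a + s * b - (a + t * b) - (s - t)%R * b)%C with (RtoC 0)
  by (rewrite RtoC_minus; ring).
rewrite Cmod_0; apply Rmult_le_pos; [lra|apply Rabs_pos].
Qed.

Lemma rdiff_eq (f : R -> C) (t : R) (l m : C) : rdiff f t l -> l = m -> rdiff f t m.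
Proof. intros H <-; exact H. Qed.

Lemma rdiff_ext (f g : R -> C) (t : R) (l : C) : (forall s, f s = g s) -> rdiff f t l -> rdiff g t l.
Proof.
intros E H e He. destruct (H e He) as [d [Hd K]]. exists d; split; [exact Hd|].
intros s Hs. rewrite <- !E. apply K, Hs.
Qed.

Lemma rdiff_arc (a b : C) (t : R) : rdiff (fun s => a + b * ei s)%C t (b * (Ci * ei t))%C.
Proof.
apply (rdiff_comp (fun z => a + b * z)%C ei t b).
- eapply cdiff_eq; [apply cdiff_plus; [apply cdiff_const|
    apply cdiff_mult; [apply cdiff_const|apply cdiff_id]]|]. cbv beta; ring.
- apply rdiff_ei.
Qed.

Lemma rdiff_circle (rho t : R) : rdiff (circle rho) t (Ci * circle rho t)%C.
Proof.
apply (rdiff_ext (fun s => 0 + RtoC rho * ei s)%C).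
- intros s; rewrite circle_ei; ring.
- eapply rdiff_eq; [apply rdiff_arc|]. rewrite circle_ei; ring.
Qed.

Lemma rcont_circle (rho t : R) : rcont (circle rho) t.
Proof. exact (rdiff_rcont _ _ _ (rdiff_circle rho t)). Qed.

(* i times this is the contour integral of g over the circle. *)
Definition circ_int (g : C -> C) (c : C) (rho : R) : C :=
  cint (fun t => circle rho t * g (c + circle rho t))%C 0 (2 * PI).

Lemma circ_cont (g : C -> C) (c : C) (rho t : R) : cdiffable g (c + circle rho t) ->
  rcont (fun t => g (c + circle rho t))%C t.
Proof.
intros [l Hl]. apply (rcont_comp g (fun t => c + circle rho t)%C t l Hl).
apply rcont_plus; [apply rcont_const|apply rcont_circle].
Qed.

Lemma circ_int_cont (g : C -> C) (c : C) (rho : R) : (forall t, cdiffable g (c + circle rho t)) ->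
  forall t, rcont (fun t => circle rho t * g (c + circle rho t))%C t.
Proof. intros H t. apply rcont_mult; [apply rcont_circle|apply circ_cont, H]. Qed.

Lemma PI2_pos : 0 <= 2 * PI.
Proof. assert (H := PI_RGT_0); lra. Qed.

(** Interpolating centre and radius linearly sweeps out the image of [0, 1] x [0, 2 PI]. Goursat
    annihilates the boundary integral, the edges t = 0 and t = 2 PI cancel because they run over the
    same points, and the other two edges are the circles, each with a factor i. *)
Theorem circ_int_homotopy (g : C -> C) (c0 c1 : C) (r0 r1 : R) :
  (forall s t, 0 <= s <= 1 -> cdiffable g (c0 + RtoC s * (c1 - c0) + circle (r0 + s * (r1 - r0)) t)) ->
  circ_int g c0 r0 = circ_int g c1 r1.
Proof.
intros H.
set (rad := fun s => r0 + s * (r1 - r0)).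
set (gam := fun s t => (c0 + RtoC s * (c1 - c0) + circle (rad s) t)%C).
set (gs := fun _ t : R => (c1 - c0 + RtoC (r1 - r0) * ei t)%C).
set (gt := fun s t => (Ci * circle (rad s) t)%C).
(* Bounds both partial derivatives: the speeds of centre and radius in the direction s, the radius,
   at most |r0| + |r1 - r0|, in the direction t. *)
set (M := Cmod (c1 - c0) + Rabs (r1 - r0) + Rabs r0).
assert (M1 := Cmod_ge_0 (c1 - c0)). assert (M2 := Rabs_pos (r1 - r0)). assert (M3 := Rabs_pos r0).
assert (G : bdint gam gs gt g 0 1 0 (2 * PI) = 0%C).
{ apply goursat with M.
  - intros s t. apply (rdiff_ext (fun s => c0 + RtoC r0 * ei t + RtoC s * (gs 0%R t))%C).
    + intros u. unfold gam, gs, rad. rewrite circle_ei, RtoC_plus, RtoC_mult. ring.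
    + eapply rdiff_eq; [apply rdiff_affine|]. reflexivity.
  - intros s t. apply (rdiff_ext (fun t => c0 + RtoC s * (c1 - c0) + RtoC (rad s) * ei t)%C).
    + intros u. unfold gam. rewrite circle_ei. ring.
    + eapply rdiff_eq; [apply rdiff_arc|]. unfold gt. rewrite circle_ei; ring.
  - intros s t. exact (rcont_const (gs 0%R t) s).
  - intros s t. exact (rcont_scal Ci _ t (rcont_circle (rad s) t)).
  - lra.
  - apply PI2_pos.
  - intros s t Hs Ht. unfold gs, gt. split.
    + eapply Rle_trans; [apply Cmod_triangle|]. rewrite Cmod_mult, Cmod_R, Cmod_ei. unfold M; lra.
    + rewrite Cmod_mult, Cmod_Ci, Cmod_circle. unfold rad.
      assert (T := Rabs_triang r0 (s * (r1 - r0))). rewrite Rabs_mult, (Rabs_pos_eq s) in T by lra.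
      assert (s * Rabs (r1 - r0) <= 1 * Rabs (r1 - r0)) by (apply Rmult_le_compat_r; lra).
      unfold M; lra.
  - intros s t Hs _. apply H; exact Hs. }
unfold bdint in G.
assert (E0 : cint (fun s => g (gam s 0) * gs s 0)%C 0 1 = cint (fun s => g (gam s (2 * PI)%R) * gs s (2 * PI)%R)%C 0 1).
{ apply cint_ext; [lra|]. intros s _. unfold gam, gs. rewrite !circle_ei, ei_2PI. reflexivity. }
assert (E1 : cint (fun t => g (gam 1 t) * gt 1 t)%C 0 (2 * PI) = (Ci * circ_int g c1 r1)%C).
{ assert (R1 : rad 1 = r1) by (unfold rad; ring).
  assert (P : forall t, gam 1 t = (c1 + circle r1 t)%C) by (intros t; unfold gam; rewrite R1; ring).
  unfold circ_int. rewrite <- cint_scal.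
  - apply cint_ext; [apply PI2_pos|]. intros t _. rewrite P; unfold gt; rewrite R1; ring.
  - apply PI2_pos.
  - intros t _. apply circ_int_cont. intros u. rewrite <- P. apply H; lra. }
assert (E2 : cint (fun t => g (gam 0 t) * gt 0 t)%C 0 (2 * PI) = (Ci * circ_int g c0 r0)%C).
{ assert (R1 : rad 0 = r0) by (unfold rad; ring).
  assert (P : forall t, gam 0 t = (c0 + circle r0 t)%C) by (intros t; unfold gam; rewrite R1; ring).
  unfold circ_int. rewrite <- cint_scal.
  - apply cint_ext; [apply PI2_pos|]. intros t _. rewrite P; unfold gt; rewrite R1; ring.
  - apply PI2_pos.
  - intros t _. apply circ_int_cont. intros u. rewrite <- P. apply H; lra. }
rewrite E0, E1, E2 in G.
assert (K : (Ci * (circ_int g c1 r1 - circ_int g c0 r0) = 0)%C).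
{ rewrite <- G. ring. }
assert (HC : Ci <> 0%C) by (apply Cmod_neq; rewrite Cmod_Ci; lra).
replace (circ_int g c0 r0) with (circ_int g c1 r1 - / Ci * (Ci * (circ_int g c1 r1 - circ_int g c0 r0)))%C
  by (field; exact HC).
rewrite K; ring.
Qed.

Lemma circ_int_ext (f g : C -> C) (c : C) (rho : R) :
  (forall t, f (c + circle rho t) = g (c + circle rho t))%C -> circ_int f c rho = circ_int g c rho.
Proof.
intros H. apply cint_ext; [apply PI2_pos|]. intros t _. rewrite H; reflexivity.
Qed.

Lemma circ_int_scal (a : C) (g : C -> C) (c : C) (rho : R) : (forall t, cdiffable g (c + circle rho t)) ->
  circ_int (fun z => a * g z)%C c rho = (a * circ_int g c rho)%C.
Proof.
intros H. unfold circ_int. rewrite <- cint_scal.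
- apply cint_ext; [apply PI2_pos|]. intros t _. ring.
- apply PI2_pos.
- intros t _. apply circ_int_cont, H.
Qed.

Lemma circ_int_plus (f g : C -> C) (c : C) (rho : R) :
  (forall t, cdiffable f (c + circle rho t)) -> (forall t, cdiffable g (c + circle rho t)) ->
  circ_int (fun z => f z + g z)%C c rho = (circ_int f c rho + circ_int g c rho)%C.
Proof.
intros Hf Hg. unfold circ_int. rewrite <- cint_plus.
- apply cint_ext; [apply PI2_pos|]. intros t _. ring.
- apply PI2_pos.
- intros t _. apply circ_int_cont, Hf.
- intros t _. apply circ_int_cont, Hg.
Qed.

(** The parameters 0 and 2 PI give the same point of the circle. This is why integration by parts
    leaves no boundary term. *)
Lemma circ_int_derive (g dg : C -> C) (c : C) (rho : R) :
  (forall t, cdiff g (c + circle rho t) (dg (c + circle rho t)%C)) ->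
  (forall t, cdiffable dg (c + circle rho t)) -> circ_int dg c rho = 0%C.
Proof.
intros Hg Hdg.
assert (HC : Ci <> 0%C) by (apply Cmod_neq; rewrite Cmod_Ci; lra).
assert (E : (Ci * circ_int dg c rho = 0)%C).
{ unfold circ_int. rewrite <- cint_scal;
    [|apply PI2_pos|intros t _; apply circ_int_cont, Hdg].
  rewrite (cint_derive (fun t => g (c + circle rho t)%C)).
  - rewrite !circle_ei, ei_2PI. ring.
  - apply PI2_pos.
  - intros t _. eapply rdiff_eq.
    + apply (rdiff_comp g (fun t => c + circle rho t)%C); [apply Hg|].
      apply (rdiff_ext (fun s => c + RtoC rho * ei s)%C).
      * intros s; rewrite circle_ei; reflexivity.
      * apply rdiff_arc.
    + rewrite !circle_ei. ring.
  - intros t _. apply rcont_scal, circ_int_cont, Hdg. }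
replace (circ_int dg c rho) with (/ Ci * (Ci * circ_int dg c rho))%C by (field; exact HC).
rewrite E; ring.
Qed.

Lemma cdiffable_mult (f g : C -> C) (z : C) : cdiffable f z -> cdiffable g z ->
  cdiffable (fun w => f w * g w)%C z.
Proof. intros [l Hl] [m Hm]. eexists; apply cdiff_mult; eassumption. Qed.

Lemma cdiffable_plus (f g : C -> C) (z : C) : cdiffable f z -> cdiffable g z ->
  cdiffable (fun w => f w + g w)%C z.
Proof. intros [l Hl] [m Hm]. eexists; apply cdiff_plus; eassumption. Qed.

Lemma cdiffable_const (a z : C) : cdiffable (fun _ => a) z.
Proof. eexists; apply cdiff_const. Qed.

Lemma cdiff_inv_sub (a z : C) : z <> a -> cdiff (fun w => / (w - a))%C z (- / ((z - a) * (z - a)))%C.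
Proof.
intros H. eapply cdiff_eq.
- apply (cdiff_comp (fun w => / w)%C (fun w => w - a)%C).
  + apply cdiff_inv. intros E; apply H.
    replace z with (z - a + a)%C by ring. rewrite E; ring.
  + apply cdiff_plus; [apply cdiff_id|apply cdiff_const].
- cbv beta. ring.
Qed.

Lemma Cmod_le_all_eq_0 (z : C) : (forall e, 0 < e -> Cmod z <= e) -> z = 0%C.
Proof.
intros H. apply Cmod_eq_0, Rle_antisym; [|apply Cmod_ge_0].
apply Rnot_lt_le; intros Hp. specialize (H (Cmod z / 2) ltac:(lra)); lra.
Qed.

Definition holo_disc (phi : C -> C) (r : R) : Prop := forall z, Cmod z < r -> cdiffable phi z.

(** * Cauchy's formula and higher derivatives *)

(* The circle |z| = rho is deformed, through circles around intermediate centres,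
   into small circles around a. *)
Lemma cauchy_formula (phi : C -> C) (r rho : R) (a : C) : holo_disc phi r ->
  Cmod a < rho -> rho < r ->
  circ_int (fun z => phi z * / (z - a))%C 0 rho = (RtoC (2 * PI) * phi a)%C.
Proof.
intros Hphi Ha Hr. assert (Ha0 := Cmod_ge_0 a).
set (g := fun z => (phi z * / (z - a))%C).
assert (Hg : forall z, Cmod z < r -> z <> a -> cdiffable g z).
{ intros z Hz Hza. apply cdiffable_mult; [apply Hphi, Hz|]. eexists; apply cdiff_inv_sub, Hza. }
assert (E : forall e, 0 < e -> Cmod (circ_int g 0 rho - RtoC (2 * PI) * phi a) <= 2 * PI * e).
{ intros e He.
  destruct (Hphi a ltac:(lra)) as [l Hl].
  destruct (cdiff_cont phi a l Hl e He) as [d [Hd K]].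
  (* Small enough for [phi] to vary by less than e on the circle about [a], and for that circle to
     stay inside |z| < rho. *)
  set (eps := Rmin (d / 2) ((rho - Cmod a) / 2)).
  assert (E1 := Rmin_l (d / 2) ((rho - Cmod a) / 2)).
  assert (E2 := Rmin_r (d / 2) ((rho - Cmod a) / 2)). fold eps in E1, E2.
  assert (He0 : 0 < eps) by (apply Rmin_pos; lra).
  assert (Hca : forall t, Cmod (a + circle eps t - a) = eps).
  { intros t. replace (a + circle eps t - a)%C with (circle eps t) by ring.
    rewrite Cmod_circle. apply Rabs_pos_eq; lra. }
  assert (Hca0 : forall t, circle eps t <> 0%C).
  { intros t. apply Cmod_neq. rewrite Cmod_circle, Rabs_pos_eq; lra. }
  assert (Hcr : forall t, Cmod (a + circle eps t) < r).
  { intros t. eapply Rle_lt_trans; [apply Cmod_triangle|]. rewrite Cmod_circle, Rabs_pos_eq; lra. }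
  rewrite (circ_int_homotopy g 0 a rho eps).
  - replace (RtoC (2 * PI) * phi a)%C with (cint (fun _ => phi a) 0 (2 * PI))
      by (rewrite cint_const, Rminus_0_r; reflexivity).
    assert (Er : circ_int g a eps = cint (fun t => phi (a + circle eps t)%C) 0 (2 * PI)).
    { apply cint_ext; [apply PI2_pos|]. intros t _. unfold g.
      replace (a + circle eps t - a)%C with (circle eps t) by ring. field. apply Hca0. }
    assert (Hcp : forall t, rcont (fun t => phi (a + circle eps t)%C) t).
    { intros t. apply circ_cont. apply Hphi, Hcr. }
    rewrite Er.
    replace (cint (fun t => phi (a + circle eps t)%C) 0 (2 * PI) - cint (fun _ => phi a) 0 (2 * PI))%C
      with (cint (fun t => phi (a + circle eps t) + - phi a)%C 0 (2 * PI)).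
    + eapply Rle_trans; [apply cint_norm_le with (M := e)|].
      * apply PI2_pos.
      * intros t _. apply rcont_plus; [apply Hcp|apply rcont_const].
      * intros t _. left. apply K. rewrite Hca. lra.
      * lra.
    + rewrite cint_plus; [|apply PI2_pos|intros t _; apply Hcp|intros t _; apply rcont_const].
      rewrite !cint_const. ring.
  - intros s t Hs.
    set (rs := rho + s * (eps - rho)).
    assert (Hrs : 0 < rs).
    { unfold rs. assert (s * (rho - eps) <= 1 * (rho - eps)) by (apply Rmult_le_compat_r; lra). lra. }
    replace (0 + RtoC s * (a - 0))%C with (RtoC s * a)%C by ring.
    apply Hg.
    + eapply Rle_lt_trans; [apply Cmod_triangle|].
      rewrite Cmod_mult, Cmod_R, Cmod_circle, !Rabs_pos_eq by lra.
      assert (s * (Cmod a + eps - rho) <= 0) by (assert (0 <= s * (rho - Cmod a - eps)) by (apply Rmult_le_pos; lra); lra).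
      unfold rs; lra.
    + intros Eq.
      (* An intermediate circle through [a] would force (1 - s)(rho - |a|) + s eps = 0, a sum of
         nonnegative terms that cannot vanish together. *)
      assert (Eq2 : circle rs t = (RtoC (1 - s) * a)%C).
      { rewrite RtoC_minus. replace (circle rs t) with (RtoC s * a + circle rs t - RtoC s * a)%C by ring.
        rewrite Eq. ring. }
      assert (Eq3 := f_equal Cmod Eq2). rewrite Cmod_mult, Cmod_R, Cmod_circle, !Rabs_pos_eq in Eq3 by lra.
      assert (A1 : 0 <= (1 - s) * (rho - Cmod a)) by (apply Rmult_le_pos; lra).
      assert (A2 : 0 <= s * eps) by (apply Rmult_le_pos; lra).
      assert (A3 : (1 - s) * (rho - Cmod a) + s * eps = 0) by (unfold rs in Eq3; lra).
      destruct (Rle_dec s (1 / 2)).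
      * assert (1 / 2 * (rho - Cmod a) <= (1 - s) * (rho - Cmod a)) by (apply Rmult_le_compat_r; lra). lra.
      * assert (1 / 2 * eps <= s * eps) by (apply Rmult_le_compat_r; lra). lra. }
assert (HP := PI_RGT_0).
assert (Z : (circ_int g 0 rho - RtoC (2 * PI) * phi a = 0)%C).
{ apply Cmod_le_all_eq_0. intros e He. replace e with (2 * PI * (e / (2 * PI))) by (field; lra).
  apply E. apply Rdiv_lt_0_compat; lra. }
replace (circ_int g 0 rho) with (circ_int g 0 rho - RtoC (2 * PI) * phi a + RtoC (2 * PI) * phi a)%C by ring.
rewrite Z; ring.
Qed.

(** Differentiation under the integral sign: a quadratic remainder uniform in t integrates to a
    quadratic remainder. *)
Lemma cint_param_cdiff (F : R -> C -> C) (D : R -> C) (z : C) (a b d K : R) : a <= b -> 0 < d -> 0 <= K ->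
  (forall w, Cmod (w - z) < d -> rcont_on (fun t => F t w) a b) -> rcont_on D a b ->
  (forall t w, a <= t <= b -> Cmod (w - z) < d ->
     Cmod (F t w - F t z - D t * (w - z)) <= K * Cmod (w - z) ^ 2) ->
  cdiff (fun w => cint (fun t => F t w) a b) z (cint D a b).
Proof.
intros Hab Hd HK HF HD H.
assert (Hz : Cmod (z - z) < d).
{ replace (z - z)%C with (RtoC 0) by ring. rewrite Cmod_0; exact Hd. }
apply cdiff_quadratic with d ((b - a) * K); [exact Hd|apply Rmult_le_pos; lra|].
intros w Hw.
assert (C1 : rcont_on (fun t => - (1) * F t z)%C a b) by (intros t Ht; apply rcont_scal, HF; assumption).
assert (C2 : rcont_on (fun t => - (w - z) * D t)%C a b) by (intros t Ht; apply rcont_scal, HD; assumption).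
replace (cint (fun t => F t w) a b - cint (fun t => F t z) a b - cint D a b * (w - z))%C
  with (cint (fun t => F t w + (- (1) * F t z + - (w - z) * D t))%C a b).
- rewrite Rmult_assoc. apply cint_norm_le; [exact Hab| |].
  + intros t Ht. apply rcont_plus; [apply HF; assumption|apply rcont_plus; [apply C1|apply C2]; exact Ht].
  + intros t Ht.
    replace (F t w + (- (1) * F t z + - (w - z) * D t))%C with (F t w - F t z - D t * (w - z))%C by ring.
    apply H; assumption.
- rewrite cint_plus; [|exact Hab|apply HF; exact Hw|].
  2: { intros t Ht. apply rcont_plus; [apply C1|apply C2]; exact Ht. }
  rewrite cint_plus by assumption. rewrite !cint_scal; try assumption; [ring|apply HF; exact Hz].
Qed.

(** * Cauchy transforms and their first two derivatives *)

Section CauchyTransform.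

Variables (u : R -> C) (rho : R).
Hypothesis density_cont : forall t, rcont u t.

(** Cauchy transforms of the density u: [ctrans2] and [ctrans3] are the first and second derivatives
    of [ctrans1]. Two are enough to show that a derivative is again differentiable, and iteration
    does the rest. *)
Definition ctrans1 (w : C) : C := cint (fun t => u t * / (circle rho t - w))%C 0 (2 * PI).
Definition ctrans2 (w : C) : C :=
  cint (fun t => u t * (/ (circle rho t - w) * / (circle rho t - w)))%C 0 (2 * PI).
Definition ctrans3 (w : C) : C :=
  cint (fun t => u t * (RtoC 2 * (/ (circle rho t - w) * / (circle rho t - w) * / (circle rho t - w))))%C 0 (2 * PI).

Lemma density_bounded : exists B, 0 <= B /\ forall t, 0 <= t <= 2 * PI -> Cmod (u t) <= B.
Proof.
destruct (continuity_ab_maj (fun t => Cmod (u t)) 0 (2 * PI) PI2_pos) as [t0 [Ht0 _]].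
- intros t _. intros e He. destruct (density_cont t e He) as [d [Hd K]].
  exists d; split; [exact Hd|]. intros s [_ Hs]. specialize (K s Hs).
  eapply Rle_lt_trans; [|exact K]. unfold dist; simpl; unfold Rdist.
  apply Rabs_le. assert (A := Cmod_minus_ge (u s) (u t)). assert (B := Cmod_minus_ge (u t) (u s)).
  rewrite Cmod_minus_sym in B. lra.
- exists (Cmod (u t0)); split; [apply Cmod_ge_0|exact Ht0].
Qed.

Lemma kernel_cont (w : C) (t : R) : Cmod w < rho -> rcont (fun t => / (circle rho t - w))%C t.
Proof.
intros Hw. apply (rcont_comp (fun z => / (z - w))%C (circle rho) t (- / ((circle rho t - w) * (circle rho t - w)))%C).
- apply cdiff_inv_sub. intros E. assert (E2 := Cmod_circle rho t). rewrite E in E2.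
  assert (H := Cmod_ge_0 w). rewrite Rabs_pos_eq in E2; lra.
- apply rcont_circle.
Qed.

Lemma kernel_bound (w : C) (t d : R) : 0 < d -> Cmod w <= rho - d ->
  Cmod (/ (circle rho t - w)) <= / d /\ (circle rho t - w <> 0)%C.
Proof.
intros Hd Hw.
assert (Hw0 := Cmod_ge_0 w).
assert (H : d <= Cmod (circle rho t - w)).
{ assert (A := Cmod_minus_ge (circle rho t) w). rewrite Cmod_circle, Rabs_pos_eq in A; lra. }
assert (H0 : (circle rho t - w <> 0)%C) by (apply Cmod_neq; lra).
split; [|exact H0].
rewrite Cmod_inv by exact H0. apply Rinv_le_contravar; lra.
Qed.

Lemma Cmod_minus_near (z w : C) (d : R) : Cmod (w - z) < d -> Cmod w < Cmod z + d.
Proof. intros H. assert (A := Cmod_minus_ge w z). lra. Qed.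

Lemma ctrans1_cdiff (z : C) : Cmod z < rho -> cdiff ctrans1 z (ctrans2 z).
Proof.
intros Hz. destruct density_bounded as [B [HB0 HB]].
(* Half the distance from z to the circle: points within d of z are still at distance at least d
   from it, so the bound 1/d serves both kernels. *)
set (d := (rho - Cmod z) / 2). assert (Hd : 0 < d) by (unfold d; lra).
assert (Hid : 0 <= / d) by (left; apply Rinv_0_lt_compat, Hd).
apply (cint_param_cdiff (fun t w => u t * / (circle rho t - w))%C _ z 0 (2 * PI) d (B * (/ d * (/ d * / d)))).
- apply PI2_pos.
- exact Hd.
- repeat apply Rmult_le_pos; assumption.
- intros w Hw t _. apply rcont_mult; [apply density_cont|apply kernel_cont].
  apply Cmod_minus_near in Hw. unfold d in Hw; lra.
- intros t _. apply rcont_mult; [apply density_cont|apply rcont_mult; apply kernel_cont; exact Hz].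
- intros t w Ht Hw. apply Cmod_minus_near in Hw.
  destruct (kernel_bound w t d Hd) as [P Pn]; [unfold d in *; lra|].
  destruct (kernel_bound z t d Hd) as [Q Qn]; [unfold d in *; lra|].
  set (p := (/ (circle rho t - w))%C) in *. set (q := (/ (circle rho t - z))%C) in *.
  replace (u t * p - u t * q - u t * (q * q) * (w - z))%C with
    ((u t * (p * (q * q))) * ((w - z) * (w - z)))%C by (unfold p, q; field; split; assumption).
  rewrite !Cmod_mult. simpl; rewrite Rmult_1_r.
  apply Rmult_le_compat_r; [apply Rmult_le_pos; apply Cmod_ge_0|].
  assert (P0 := Cmod_ge_0 p). assert (Q0 := Cmod_ge_0 q).
  repeat apply Rmult_le_compat; try apply Rmult_le_pos; try apply Rmult_le_pos; try apply Cmod_ge_0; try assumption.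
  apply HB; exact Ht.
Qed.

Lemma ctrans2_cdiff (z : C) : Cmod z < rho -> cdiff ctrans2 z (ctrans3 z).
Proof.
intros Hz. destruct density_bounded as [B [HB0 HB]].
set (d := (rho - Cmod z) / 2). assert (Hd : 0 < d) by (unfold d; lra).
assert (Hid : 0 <= / d) by (left; apply Rinv_0_lt_compat, Hd).
apply (cint_param_cdiff (fun t w => u t * (/ (circle rho t - w) * / (circle rho t - w)))%C _ z 0 (2 * PI) d
   (B * (/ d * (/ d * / d) * (3 * / d)))).
- apply PI2_pos.
- exact Hd.
- repeat apply Rmult_le_pos; try assumption; lra.
- intros w Hw t _. apply rcont_mult; [apply density_cont|].
  apply Cmod_minus_near in Hw.
  apply rcont_mult; apply kernel_cont; unfold d in Hw; lra.
- intros t _. apply rcont_mult; [apply density_cont|].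
  apply rcont_scal, rcont_mult; [apply rcont_mult|]; apply kernel_cont; exact Hz.
- intros t w Ht Hw. apply Cmod_minus_near in Hw.
  destruct (kernel_bound w t d Hd) as [P Pn]; [unfold d in *; lra|].
  destruct (kernel_bound z t d Hd) as [Q Qn]; [unfold d in *; lra|].
  set (p := (/ (circle rho t - w))%C) in *. set (q := (/ (circle rho t - z))%C) in *.
  (* With p and q the kernels at w and z, p - q = (w - z) p q; used twice, this factors the
     remainder as p q^2 (p + 2 q) (w - z)^2. *)
  replace (u t * (p * p) - u t * (q * q) - u t * (RtoC 2 * (q * q * q)) * (w - z))%C with
    ((u t * (p * (q * q) * (p + RtoC 2 * q))) * ((w - z) * (w - z)))%C by (unfold p, q; field; split; assumption).
  rewrite !Cmod_mult. simpl; rewrite Rmult_1_r.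
  apply Rmult_le_compat_r; [apply Rmult_le_pos; apply Cmod_ge_0|].
  assert (P0 := Cmod_ge_0 p). assert (Q0 := Cmod_ge_0 q).
  assert (S : Cmod (p + RtoC 2 * q) <= 3 * / d).
  { eapply Rle_trans; [apply Cmod_triangle|]. rewrite Cmod_mult, Cmod_R, Rabs_pos_eq by lra. lra. }
  repeat apply Rmult_le_compat; repeat apply Rmult_le_pos; try apply Cmod_ge_0; try assumption.
  apply HB; exact Ht.
Qed.

End CauchyTransform.

(** Cauchy's formula on a circle between |z| and r writes [phi] near z as a Cauchy transform, which
    can be differentiated twice. By iteration, phi^(m) is a genuine derivative throughout the
    disc. *)
Lemma holo_disc_derive (phi : C -> C) (r : R) : holo_disc phi r ->
  holo_disc (C_derive phi) r.
Proof.
intros H z Hz.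
set (rho := (Cmod z + r) / 2). assert (Hz0 := Cmod_ge_0 z).
assert (Hrho : Cmod z < rho < r) by (unfold rho; lra).
set (u := fun t => (circle rho t * phi (circle rho t))%C).
assert (Hu : forall t, rcont u t).
{ intros t. apply rcont_mult; [apply rcont_circle|].
  destruct (H (circle rho t)) as [l Hl]; [rewrite Cmod_circle, Rabs_pos_eq; lra|].
  apply (rcont_comp phi (circle rho) t l Hl). apply rcont_circle. }
assert (HP := PI_RGT_0).
assert (HP0 : RtoC (2 * PI) <> 0%C) by (apply Cmod_neq; rewrite Cmod_R, Rabs_pos_eq; lra).
assert (E1 : forall w, Cmod w < rho -> (/ RtoC (2 * PI) * ctrans1 u rho w)%C = phi w).
{ intros w Hw.
  assert (F := cauchy_formula phi r rho w H Hw ltac:(lra)).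
  assert (G : circ_int (fun z => phi z * / (z - w))%C 0 rho = ctrans1 u rho w).
  { apply cint_ext; [apply PI2_pos|]. intros t _. unfold u.
    replace (0 + circle rho t)%C with (circle rho t) by ring. ring. }
  rewrite <- G, F. field. exact HP0. }
assert (E2 : forall w, Cmod w < rho -> cdiff phi w (/ RtoC (2 * PI) * ctrans2 u rho w)%C).
{ intros w Hw. apply (cdiff_ext_loc (fun w => / RtoC (2 * PI) * ctrans1 u rho w)%C) with (rho - Cmod w).
  - lra.
  - intros v Hv. apply E1. apply Cmod_minus_near in Hv. lra.
  - eapply cdiff_eq; [apply cdiff_mult; [apply cdiff_const|apply ctrans1_cdiff; assumption]|]. cbv beta; ring. }
exists (/ RtoC (2 * PI) * ctrans3 u rho z)%C.
apply (cdiff_ext_loc (fun w => / RtoC (2 * PI) * ctrans2 u rho w)%C) with (rho - Cmod z).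
- lra.
- intros v Hv. symmetry. apply cdiff_derive, E2. apply Cmod_minus_near in Hv. lra.
- eapply cdiff_eq; [apply cdiff_mult; [apply cdiff_const|apply ctrans2_cdiff; [exact Hu|lra]]|]. cbv beta; ring.
Qed.

Lemma C_derive_n_S (phi : C -> C) (m : nat) : C_derive_n phi (S m) = C_derive (C_derive_n phi m).
Proof. reflexivity. Qed.

Lemma holo_disc_derive_n (phi : C -> C) (r : R) (m : nat) : holo_disc phi r ->
  holo_disc (C_derive_n phi m) r.
Proof.
intros H; induction m as [|m IH]; [exact H|]. rewrite C_derive_n_S. apply holo_disc_derive, IH.
Qed.

Lemma cdiff_derive_n (phi : C -> C) (r : R) (m : nat) (z : C) : holo_disc phi r -> Cmod z < r ->
  cdiff (C_derive_n phi m) z (C_derive_n phi (S m) z).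
Proof.
intros H Hz. destruct (holo_disc_derive_n phi r m H z Hz) as [l Hl].
rewrite C_derive_n_S, (cdiff_derive _ _ _ Hl). exact Hl.
Qed.

Lemma minus_plus_cancel (G : AbelianGroup) (a b : G) : plus (minus a b) b = a.
Proof. unfold minus. rewrite <- plus_assoc, plus_opp_l, plus_zero_r. reflexivity. Qed.

(** * The resolvent *)

Section Resolvent.

Variables (X : CompleteNormedModule C_AbsRing) (T : blop X X).
Hypothesis specT : spectrum_in_closed_disc T.

Let Rs (z : C) : blop X X := resolvent z T.

(** [spectrum] is a negated existential, so |z| > 1 yields an inverse classically, and [epsilon]
    then returns one. *)
Lemma resolvent_inverse (z : C) : 1 < Cmod z -> is_inverse (Rs z) (minus (scal z (blop_id X)) T).
Proof.
intros Hz. unfold Rs, resolvent. apply epsilon_spec.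
apply NNPP; intros H. assert (K := specT z H). lra.
Qed.

Lemma resolvent_right (z : C) (y : X) : 1 < Cmod z -> minus (scal z (Rs z y)) (T (Rs z y)) = y.
Proof.
intros Hz. destruct (resolvent_inverse z Hz) as [_ H].
exact (f_equal (fun A : blop X X => A y) H).
Qed.

Lemma resolvent_left (z : C) (y : X) : 1 < Cmod z -> Rs z (minus (scal z y) (T y)) = y.
Proof.
intros Hz. destruct (resolvent_inverse z Hz) as [H _].
exact (f_equal (fun A : blop X X => A y) H).
Qed.

Lemma blop_scal_app (Y Z : NormedModule C_AbsRing) (A : blop Y Z) (c : C) (v : Y) : A (scal c v) = scal c (A v).
Proof. apply (linear_scal _ (blop_linear A)). Qed.

Lemma blop_plus_app (Y Z : NormedModule C_AbsRing) (A : blop Y Z) (u v : Y) : A (plus u v) = plus (A u) (A v).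
Proof. apply (linear_plus _ (blop_linear A)). Qed.

(** Apply R(w) to y = (w - T) R(z) y + (z - w) R(z) y. In this form R(w) acts on the vector R(z) y,
    which does not move with w; this suits inductions on the power. *)
Lemma resolvent_identity (z w : C) (y : X) : 1 < Cmod z -> 1 < Cmod w ->
  Rs w y = plus (Rs z y) (scal (z - w)%C (Rs w (Rs z y))).
Proof.
intros Hz Hw.
rewrite <- (blop_scal_app _ _ (Rs w)).
assert (E : plus (minus (scal w (Rs z y)) (T (Rs z y))) (scal (z - w)%C (Rs z y)) = y).
{ rewrite <- (resolvent_right z y Hz) at 4.
  assert (D : scal z (Rs z y) = plus (scal w (Rs z y)) (scal (z - w)%C (Rs z y))).
  { transitivity (scal (w + (z - w))%C (Rs z y)); [f_equal; ring|].
    exact (scal_distr_r (K := C_Ring) w (z - w)%C (Rs z y)). }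
  rewrite D. unfold minus. rewrite <- !plus_assoc. f_equal. apply plus_comm. }
rewrite <- E at 1. rewrite blop_plus_app, resolvent_left by exact Hw. reflexivity.
Qed.

Let pw (z : C) (j : nat) (y : X) : X := blop_pow (Rs z) j y.

Lemma pow_S_app (A : blop X X) (j : nat) (y : X) : blop_pow A (S j) y = A (blop_pow A j y).
Proof. reflexivity. Qed.

Lemma pow_S_app_r (A : blop X X) (j : nat) (y : X) : blop_pow A (S j) y = blop_pow A j (A y).
Proof.
revert y; induction j as [|j IH]; intros y; [reflexivity|].
rewrite pow_S_app, IH. reflexivity.
Qed.

Lemma pow_norm_le (A : blop X X) (M : R) (j : nat) (y : X) : 0 <= M -> (forall y, norm (A y) <= M * norm y) ->
  norm (blop_pow A j y) <= M ^ j * norm y.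
Proof.
intros HM H; induction j as [|j IH]; [simpl; lra|].
rewrite pow_S_app. eapply Rle_trans; [apply H|]. simpl. rewrite Rmult_assoc.
apply Rmult_le_compat_l; assumption.
Qed.

(** Invertibility at w is already known from the spectrum, so the resolvent identity bounds |R(w)|
    by |R(z)| + |w - z| |R(w)| |R(z)|, and the last term is absorbed once |w - z| |R(z)| <= 1/2. *)
Lemma resolvent_locally_bounded (z : C) : 1 < Cmod z -> exists d, 0 < d /\ forall w, Cmod (w - z) < d ->
  1 < Cmod w /\ opnorm (Rs w) <= 2 * opnorm (Rs z).
Proof.
intros Hz. assert (H0 := opnorm_ge_0 (Rs z)).
assert (Hp : 0 < / (2 * (opnorm (Rs z) + 1))) by (apply Rinv_0_lt_compat; lra).
exists (Rmin (Cmod z - 1) (/ (2 * (opnorm (Rs z) + 1)))). split; [apply Rmin_pos; lra|].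
intros w Hw.
assert (H1 := Rmin_l (Cmod z - 1) (/ (2 * (opnorm (Rs z) + 1)))).
assert (H2 := Rmin_r (Cmod z - 1) (/ (2 * (opnorm (Rs z) + 1)))).
assert (Hw1 : 1 < Cmod w).
{ assert (A := Cmod_minus_ge z w). rewrite Cmod_minus_sym in A. lra. }
split; [exact Hw1|].
assert (Hw0 := opnorm_ge_0 (Rs w)).
assert (K : opnorm (Rs w) <= opnorm (Rs z) + 1 / 2 * opnorm (Rs w)).
{ apply opnorm_le; [lra|]. intros y. rewrite (resolvent_identity z w y Hz Hw1) at 1.
  eapply Rle_trans; [apply norm_triangle|]. rewrite norm_scal_C, Rmult_plus_distr_r.
  apply Rplus_le_compat; [apply opnorm_bound|].
  apply Rle_trans with (Cmod (z - w) * (opnorm (Rs w) * (opnorm (Rs z) * norm y))).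
  - apply Rmult_le_compat_l; [apply Cmod_ge_0|]. eapply Rle_trans; [apply opnorm_bound|].
    apply Rmult_le_compat_l; [exact Hw0|apply opnorm_bound].
  - assert (Hy := norm_ge_0 y). rewrite Cmod_minus_sym.
    assert (L : Cmod (w - z) * opnorm (Rs z) <= 1 / 2).
    { apply Rle_trans with (/ (2 * (opnorm (Rs z) + 1)) * (opnorm (Rs z) + 1)).
      - apply Rmult_le_compat; try lra. apply Cmod_ge_0.
      - apply Req_le; field; lra. }
    replace (Cmod (w - z) * (opnorm (Rs w) * (opnorm (Rs z) * norm y)))
      with ((Cmod (w - z) * opnorm (Rs z)) * (opnorm (Rs w) * norm y)) by ring.
    rewrite (Rmult_assoc (1 / 2)). apply Rmult_le_compat_r; [apply Rmult_le_pos; assumption|exact L]. }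
lra.
Qed.

Lemma resolvent_pow_bound (z : C) : 1 < Cmod z -> exists d, 0 < d /\ forall w, Cmod (w - z) < d ->
  1 < Cmod w /\ forall j y, norm (pw w j y) <= (2 * opnorm (Rs z)) ^ j * norm y.
Proof.
intros Hz. destruct (resolvent_locally_bounded z Hz) as [d [Hd K]].
exists d; split; [exact Hd|]; intros w Hw. destruct (K w Hw) as [K1 K2]. split; [exact K1|].
intros j y. assert (H0 := opnorm_ge_0 (Rs z)). apply pow_norm_le; [lra|].
intros v. eapply Rle_trans; [apply opnorm_bound|]. apply Rmult_le_compat_r; [apply norm_ge_0|exact K2].
Qed.

Lemma resolvent_scal (z : C) (v : X) : 1 < Cmod z -> scal z (Rs z v) = plus v (T (Rs z v)).
Proof.
intros Hz. transitivity (plus (minus (scal z (Rs z v)) (T (Rs z v))) (T (Rs z v))).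
- symmetry; apply minus_plus_cancel.
- f_equal. exact (resolvent_right z v Hz).
Qed.

(** From z R(z) v = v + T R(z) v. The decay evaluates integrals over large circles and removes the
    boundary term at infinity in the descent. *)
Lemma resolvent_infinity (z : C) (v : X) : 1 < Cmod z -> opnorm T < Cmod z ->
  norm (resolvent z T v) <= / (Cmod z - opnorm T) * norm v.
Proof.
intros Hz HT. fold (Rs z).
assert (F : Cmod z * norm (Rs z v) <= norm v + opnorm T * norm (Rs z v)).
{ rewrite <- norm_scal_C, resolvent_scal by exact Hz.
  apply Rle_trans with (1 := norm_triangle (V := X) v (T (Rs z v))). apply Rplus_le_compat_l, opnorm_bound. }
apply Rmult_le_reg_l with (Cmod z - opnorm T); [lra|].
rewrite <- Rmult_assoc, Rinv_r by lra. lra.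
Qed.

(** * Matrix coefficients of resolvent powers *)

Variable x' : dual X.

Lemma dual_bound (y : X) : Cmod (x' y) <= norm x' * norm y.
Proof. exact (opnorm_bound x' y). Qed.

(** The f_j of the overview, with the vector as an argument because each induction on j trades y for
    R(z) y. *)
Definition rmat (j : nat) (y : X) (z : C) : C := x' (blop_pow (resolvent z T) j y).

Lemma dual_plus (u v : X) : x' (plus u v) = (x' u + x' v)%C.
Proof. exact (blop_plus_app _ _ x' u v). Qed.

Lemma dual_scal (c : C) (u : X) : x' (scal c u) = (c * x' u)%C.
Proof. exact (blop_scal_app _ _ x' c u). Qed.

(* All differentiability of z |-> rmat j y z follows from this recursion on j. *)
Lemma rmat_S_diff (j : nat) (y : X) (z w : C) : 1 < Cmod z -> 1 < Cmod w ->
  rmat (S j) y w = ((z - w) * rmat (S j) (Rs z y) w + rmat j (Rs z y) w)%C.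
Proof.
intros Hz Hw. unfold rmat. fold (Rs w).
rewrite !pow_S_app_r. rewrite (resolvent_identity z w y Hz Hw) at 1.
rewrite blop_plus_app, blop_scal_app, dual_plus, dual_scal. ring.
Qed.

Lemma rmat_S_app (j : nat) (y : X) (z : C) : rmat (S j) y z = rmat j (Rs z y) z.
Proof. unfold rmat. rewrite pow_S_app_r. reflexivity. Qed.

(** Induction on j for all vectors at once: in the recursion z - w multiplies a coefficient that is
    bounded near z, and the rest is the previous case at R(z) y. *)
Lemma rmat_lipschitz (j : nat) (y : X) (z : C) : 1 < Cmod z -> exists d K, 0 < d /\ 0 <= K /\
  forall w, Cmod (w - z) < d -> 1 < Cmod w /\ Cmod (rmat j y w - rmat j y z) <= K * Cmod (w - z).
Proof.
intros Hz. destruct (resolvent_pow_bound z Hz) as [d0 [Hd0 B]].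
revert y; induction j as [|j IH]; intros y.
- exists d0, 0. split; [exact Hd0|]. split; [lra|]. intros w Hw. split; [apply B, Hw|].
  unfold rmat; simpl. replace (x' y - x' y)%C with (RtoC 0) by ring. rewrite Cmod_0; lra.
- destruct (IH (Rs z y)) as [d [K [Hd [HK H]]]].
  set (y1 := Rs z y) in *.
  assert (H0 := opnorm_ge_0 (Rs z)). assert (Hn := norm_ge_0 y1). assert (Hx := norm_ge_0 x').
  assert (HB : 0 <= norm x' * ((2 * opnorm (Rs z)) ^ S j * norm y1)).
  { apply Rmult_le_pos; [exact Hx|]. apply Rmult_le_pos; [apply pow_le; lra|exact Hn]. }
  exists (Rmin d d0), (K + norm x' * ((2 * opnorm (Rs z)) ^ S j * norm y1)).
  split; [apply Rmin_pos; assumption|]. split; [lra|]. intros w Hw.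
  assert (M1 := Rmin_l d d0); assert (M2 := Rmin_r d d0).
  destruct (B w ltac:(lra)) as [Hw1 Bw]. split; [exact Hw1|].
  rewrite (rmat_S_diff j y z w Hz Hw1), (rmat_S_app j y z). fold y1.
  replace ((z - w) * rmat (S j) y1 w + rmat j y1 w - rmat j y1 z)%C
    with ((rmat j y1 w - rmat j y1 z) + (z - w) * rmat (S j) y1 w)%C by ring.
  eapply Rle_trans; [apply Cmod_triangle|]. rewrite Rmult_plus_distr_r, Cmod_mult.
  apply Rplus_le_compat; [apply H; lra|]. rewrite Cmod_minus_sym, Rmult_comm.
  apply Rmult_le_compat_r; [apply Cmod_ge_0|].
  eapply Rle_trans; [apply dual_bound|]. apply Rmult_le_compat_l; [exact Hx|apply Bw].
Qed.

(** In the recursion at w, the product of z - w with a Lipschitz coefficient has a quadratic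
    remainder and contributes -1 times f_(j+2) at z; the induction hypothesis contributes -j times
    the same, which makes -(j + 1). *)
Lemma rmat_cdiff (j : nat) (y : X) (z : C) : 1 < Cmod z ->
  cdiff (rmat j y) z (- INR j * rmat (S j) y z)%C.
Proof.
intros Hz. revert y; induction j as [|j IH]; intros y.
- simpl. apply (cdiff_ext_loc (fun _ => x' y)) with 1; [lra|reflexivity|].
  eapply cdiff_eq; [apply cdiff_const|]. ring.
- set (y1 := Rs z y).
  destruct (rmat_lipschitz (S j) y1 z Hz) as [d [K [Hd [HK H]]]].
  apply (cdiff_ext_loc (fun w => (z - w) * rmat (S j) y1 w + rmat j y1 w)%C) with d; [exact Hd| |].
  + intros w Hw. symmetry; apply rmat_S_diff; [exact Hz|apply H, Hw].
  + eapply cdiff_eq; [apply cdiff_plus; [|apply IH]|].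
    * apply (cdiff_quadratic _ z (- rmat (S j) y1 z)%C d K Hd HK).
      intros w Hw. destruct (H w Hw) as [_ L].
      replace ((z - w) * rmat (S j) y1 w - (z - z) * rmat (S j) y1 z - - rmat (S j) y1 z * (w - z))%C
        with (- ((w - z) * (rmat (S j) y1 w - rmat (S j) y1 z)))%C by ring.
      rewrite Cmod_opp, Cmod_mult. simpl.
      apply Rle_trans with (Cmod (w - z) * (K * Cmod (w - z))); [|apply Req_le; ring].
      apply Rmult_le_compat_l; [apply Cmod_ge_0|exact L].
    * rewrite (rmat_S_app (S j) y z). fold y1. rewrite S_INR, RtoC_plus. ring.
Qed.

Lemma rmat_cdiffable (j : nat) (y : X) (z : C) : 1 < Cmod z -> cdiffable (rmat j y) z.
Proof. intros Hz; eexists; apply rmat_cdiff, Hz. Qed.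

Lemma rmat_infinity (j : nat) (y : X) (z : C) : 1 < Cmod z -> opnorm T < Cmod z ->
  Cmod (rmat j y z) <= norm x' * ((/ (Cmod z - opnorm T)) ^ j * norm y).
Proof.
intros Hz HT. eapply Rle_trans; [apply dual_bound|].
apply Rmult_le_compat_l; [apply norm_ge_0|].
apply pow_norm_le; [left; apply Rinv_0_lt_compat; lra|].
intros v. apply resolvent_infinity; assumption.
Qed.

End Resolvent.

(** * From (GFS)_m to the calculus *)

Section Calculus.

Variables (X : CompleteNormedModule C_AbsRing) (T : blop X X).
Hypothesis specT : spectrum_in_closed_disc T.

Lemma minus_plus_l (G : AbelianGroup) (a b : G) : minus (plus a b) a = b.
Proof.
unfold minus. rewrite (plus_comm a b), <- plus_assoc.
transitivity (plus b zero); [f_equal; exact (plus_opp_r a)|apply plus_zero_r].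
Qed.

Lemma norm_scal_minus_le (V : NormedModule C_AbsRing) (c d : C) (u v : V) :
  norm (minus (scal c u) (scal d v)) <= Cmod (c - d) * norm u + Cmod d * norm (minus u v).
Proof.
rewrite <- !norm_scal_C.
replace (minus (scal c u) (scal d v)) with (plus (scal (c - d)%C u) (scal d (minus u v)));
  [exact (norm_triangle (K := C_AbsRing) (V := V) (scal (c - d)%C u) (scal d (minus u v)))|].
transitivity (plus (minus (scal c u) (scal d u)) (minus (scal d u) (scal d v))).
- f_equal.
  + exact (scal_minus_distr_r (K := C_Ring) c d u).
  + exact (scal_minus_distr_l (K := C_Ring) d u v).
- symmetry. apply minus_trans.
Qed.

(** Operator-norm continuity, since the Riesz-Dunford integral is a Riemann integral in B(X). *)
Lemma resolvent_continuous (z : C) : 1 < Cmod z -> forall e, 0 < e -> exists d, 0 < d /\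
  forall w, Cmod (w - z) < d -> opnorm (minus (resolvent w T) (resolvent z T)) <= e.
Proof.
intros Hz e He. destruct (resolvent_locally_bounded X T specT z Hz) as [d [Hd K]].
set (N := opnorm (resolvent z T)) in *. assert (HN : 0 <= N) by apply opnorm_ge_0.
assert (HN2 : 0 <= 2 * N * N) by (apply Rmult_le_pos; lra).
assert (Hp : 0 < e / (2 * N * N + 1)) by (apply Rdiv_lt_0_compat; lra).
exists (Rmin d (e / (2 * N * N + 1))); split; [apply Rmin_pos; assumption|].
intros w Hw. assert (M1 := Rmin_l d (e / (2 * N * N + 1))); assert (M2 := Rmin_r d (e / (2 * N * N + 1))).
destruct (K w ltac:(lra)) as [Hw1 Kw].
apply opnorm_le; [lra|]. intros y.
change (minus (resolvent w T) (resolvent z T) y) with (minus (resolvent w T y) (resolvent z T y)).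
rewrite (resolvent_identity X T specT z w y Hz Hw1).
assert (Hy := norm_ge_0 y).
replace (minus (plus (resolvent z T y) (scal (z - w)%C (resolvent w T (resolvent z T y)))) (resolvent z T y))
  with (scal (z - w)%C (resolvent w T (resolvent z T y))) by (symmetry; apply minus_plus_l).
rewrite norm_scal_C, Cmod_minus_sym.
apply Rle_trans with (e / (2 * N * N + 1) * (2 * N * (N * norm y))).
- apply Rmult_le_compat; [apply Cmod_ge_0|apply norm_ge_0|lra|].
  eapply Rle_trans; [apply opnorm_bound|]. apply Rmult_le_compat; [apply opnorm_ge_0|apply norm_ge_0|exact Kw|apply opnorm_bound].
- replace (e / (2 * N * N + 1) * (2 * N * (N * norm y))) with (e * norm y * (2 * N * N / (2 * N * N + 1))) by (field; lra).
  rewrite <- (Rmult_1_r (e * norm y)) at 2. apply Rmult_le_compat_l; [apply Rmult_le_pos; lra|].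
  apply Rmult_le_reg_r with (2 * N * N + 1); [lra|]. unfold Rdiv. rewrite Rmult_assoc, Rinv_l; lra.
Qed.

(** Ensures that the integral in [derivative_calculus] exists, so that the total function [RInt]
    returns its actual value. *)
Lemma integrand_continuous (c : R -> C) (rho t : R) : 1 < rho -> rcont c t ->
  continuous (U := V_R (bounded_op X)) (fun t => scal (c t) (resolvent (circle rho t) T)) t.
Proof.
intros Hrho Hc.
apply (proj2 (filterlim_locally_ball_norm (K := R_AbsRing) (U := V_R (bounded_op X)) _ _)).
intros [e He].
set (z := circle rho t). assert (Hz : 1 < Cmod z) by (unfold z; rewrite Cmod_circle, Rabs_pos_eq; lra).
set (N := opnorm (resolvent z T)). assert (HN : 0 <= N) by apply opnorm_ge_0.
assert (Hct := Cmod_ge_0 (c t)).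
destruct (resolvent_locally_bounded X T specT z Hz) as [d1 [Hd1 K1]].
destruct (resolvent_continuous z Hz (e / 2 / (Cmod (c t) + 1))) as [d2 [Hd2 K2]].
{ apply Rdiv_lt_0_compat; lra. }
destruct (Hc (e / 2 / (2 * N + 1))) as [d3 [Hd3 K3]].
{ apply Rdiv_lt_0_compat; lra. }
destruct (rcont_circle rho t (Rmin d1 d2)) as [d4 [Hd4 K4]]; [apply Rmin_pos; assumption|].
exists (mkposreal (Rmin d3 d4) (Rmin_pos _ _ Hd3 Hd4)). intros s Hs.
change (Rabs (s - t) < Rmin d3 d4) in Hs.
assert (M1 := Rmin_l d1 d2); assert (M2 := Rmin_r d1 d2).
assert (M3 := Rmin_l d3 d4); assert (M4 := Rmin_r d3 d4).
specialize (K3 s ltac:(lra)). specialize (K4 s ltac:(lra)). fold z in K4.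
destruct (K1 _ (Rlt_le_trans _ _ _ K4 M1)) as [_ B1].
assert (B2 := K2 _ (Rlt_le_trans _ _ _ K4 M2)).
change (opnorm (minus (scal (c s) (resolvent (circle rho s) T)) (scal (c t) (resolvent z T))) < e).
eapply Rle_lt_trans; [exact (norm_scal_minus_le (blop_NormedModule X X) (c s) (c t) _ _)|].
change (Cmod (c s - c t) * opnorm (resolvent (circle rho s) T) + Cmod (c t) * opnorm (minus (resolvent (circle rho s) T) (resolvent z T)) < e).
assert (S1 : Cmod (c s - c t) * opnorm (resolvent (circle rho s) T) <= e / 2 / (2 * N + 1) * (2 * N)).
{ apply Rmult_le_compat; [apply Cmod_ge_0|apply opnorm_ge_0|lra|exact B1]. }
assert (S2 : Cmod (c t) * opnorm (minus (resolvent (circle rho s) T) (resolvent z T)) <= Cmod (c t) * (e / 2 / (Cmod (c t) + 1))).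
{ apply Rmult_le_compat_l; assumption. }
assert (P1 : 0 < e / 2 / (2 * N + 1)) by (apply Rdiv_lt_0_compat; lra).
assert (P2 : 0 < e / 2 / (Cmod (c t) + 1)) by (apply Rdiv_lt_0_compat; lra).
assert (Q1 : e / 2 / (2 * N + 1) * (2 * N + 1) = e / 2) by (field; lra).
assert (Q2 : (Cmod (c t) + 1) * (e / 2 / (Cmod (c t) + 1)) = e / 2) by (field; lra).
lra.
Qed.

Lemma eval_linear (x : X) (x' : dual X) : is_linear (U := bounded_op X) (V := C_CompleteNormedModule) (fun A : blop X X => x' (A x)).
Proof.
split.
- intros A B. exact (dual_plus X x' (A x) (B x)).
- intros c A. exact (dual_scal X x' c (A x)).
- exists (norm x' * norm x + 1). assert (H1 := norm_ge_0 x'). assert (H2 := norm_ge_0 x).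
  assert (H3 : 0 <= norm x' * norm x) by (apply Rmult_le_pos; assumption).
  split; [lra|]. intros A.
  change (Cmod (x' (A x)) <= (norm x' * norm x + 1) * opnorm A).
  assert (HA := opnorm_ge_0 A).
  eapply Rle_trans; [apply dual_bound|].
  apply Rle_trans with (norm x' * (opnorm A * norm x)); [apply Rmult_le_compat_l; [exact H1|apply opnorm_bound]|].
  lra.
Qed.

(** A |-> x'(A x) is a bounded functional on B(X) and passes under the integral, which reduces the
    calculus to scalar contour integrals. The factor z of the definition is hidden in [circ_int]. *)
Lemma calculus_matrix_coef (m : nat) (phi : C -> C) (r rho : R) (x : X) (x' : dual X) :
  holo_disc phi r -> 1 < rho -> rho < r ->
  x' (derivative_calculus m phi rho T x)
  = (/ RtoC (2 * PI) * circ_int (fun z => C_derive_n phi m z * rmat X T x' 1 x z) 0 rho)%C.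
Proof.
intros Hphi H1 Hr.
assert (Hpi := PI_RGT_0).
set (f := fun t => scal (circle rho t * C_derive_n phi m (circle rho t))%C (resolvent (circle rho t) T) : bounded_op X).
assert (HI : is_RInt (V := V_R (bounded_op X)) f 0 (2 * PI) (RInt (V := V_R (bounded_op X)) f 0 (2 * PI))).
{ apply (RInt_correct (V := V_R (bounded_op X))). apply (ex_RInt_continuous (V := V_R (bounded_op X))).
  intros t _. apply integrand_continuous; [exact H1|].
  apply rcont_mult; [apply rcont_circle|].
  apply (rcont_comp _ _ _ _ (cdiff_derive_n phi r m (circle rho t) Hphi ltac:(rewrite Cmod_circle, Rabs_pos_eq; lra))).
  apply rcont_circle. }
assert (HL := is_RInt_linear (bounded_op X) C_CompleteNormedModule _ _ _ _ _ (eval_linear x x') HI).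
apply cint_unique in HL.
unfold derivative_calculus. fold f.
change (x' (scal (RtoC (/ (2 * PI))) (RInt (V := V_R (bounded_op X)) f 0 (2 * PI) x))
  = (/ RtoC (2 * PI) * circ_int (fun z => C_derive_n phi m z * rmat X T x' 1 x z) 0 rho)%C).
rewrite dual_scal, RtoC_inv by lra.
f_equal. transitivity (cint (fun t => x' (f t x)) 0 (2 * PI)); [symmetry; exact HL|].
apply cint_ext; [apply PI2_pos|]. intros t _.
replace (0 + circle rho t)%C with (circle rho t) by ring.
unfold f, rmat.
change (x' (scal (circle rho t * C_derive_n phi m (circle rho t))%C (resolvent (circle rho t) T x)) =
  (circle rho t * (C_derive_n phi m (circle rho t) * x' (resolvent (circle rho t) T x)))%C).
rewrite dual_scal. symmetry; apply Cmult_assoc.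
Qed.

Lemma Cmod_origin_circle (rho t : R) : 0 <= rho -> Cmod (0 + circle rho t) = rho.
Proof. intros H. rewrite Cplus_0_l, Cmod_circle, Rabs_pos_eq; trivial. Qed.

(** The product phi^(k) f_j has derivative phi^(k+1) f_j - j phi^(k) f_(j+1), and this integrates to
    0 over the circle. *)
Lemma circ_int_by_parts (phi : C -> C) (r rho : R) (x : X) (x' : dual X) (k j : nat) :
  holo_disc phi r -> 1 < rho -> rho < r ->
  circ_int (fun z => C_derive_n phi (S k) z * rmat X T x' j x z)%C 0 rho
  = (INR j * circ_int (fun z => C_derive_n phi k z * rmat X T x' (S j) x z) 0 rho)%C.
Proof.
intros Hphi H1 Hr.
assert (Hc : forall t, Cmod (0 + circle rho t) = rho) by (intros t; apply Cmod_origin_circle; lra).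
assert (Dphi : forall k t, cdiffable (C_derive_n phi k) (0 + circle rho t)).
{ intros l t. apply (holo_disc_derive_n phi r l Hphi). rewrite Hc; exact Hr. }
assert (Dr : forall j t, cdiffable (rmat X T x' j x) (0 + circle rho t)).
{ intros l t. apply rmat_cdiffable; [exact specT|]. rewrite Hc; exact H1. }
rewrite <- circ_int_scal by (intros t; apply cdiffable_mult; trivial).
assert (Z : circ_int (fun z => C_derive_n phi (S k) z * rmat X T x' j x z
   + - (1) * (INR j * (C_derive_n phi k z * rmat X T x' (S j) x z)))%C 0 rho = 0%C).
{ apply (circ_int_derive (fun z => C_derive_n phi k z * rmat X T x' j x z)%C).
  - intros t. eapply cdiff_eq.
    + apply cdiff_mult; [apply (cdiff_derive_n phi r k _ Hphi); rewrite Hc; exact Hr|].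
      apply rmat_cdiff; [exact specT|]. rewrite Hc; exact H1.
    + cbv beta. ring.
  - intros t. apply cdiffable_plus; [apply cdiffable_mult; trivial|].
    apply cdiffable_mult; [apply cdiffable_const|].
    apply cdiffable_mult; [apply cdiffable_const|apply cdiffable_mult; trivial]. }
rewrite circ_int_plus in Z.
- rewrite circ_int_scal in Z.
  + match goal with |- ?a = ?b => replace a with (a + - (1) * b + b)%C by ring end. rewrite Z. ring.
  + intros t. apply cdiffable_mult; [apply cdiffable_const|apply cdiffable_mult; trivial].
- intros t. apply cdiffable_mult; trivial.
- intros t. apply cdiffable_mult; [apply cdiffable_const|].
  apply cdiffable_mult; [apply cdiffable_const|apply cdiffable_mult; trivial].
Qed.

(** Each integration by parts raises j, hence the induction for all j; factorials on both sides
    avoid a quotient. The case j = 0, k = m is the one applied. *)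
Lemma circ_int_by_parts_iter (phi : C -> C) (r rho : R) (x : X) (x' : dual X) (k j : nat) :
  holo_disc phi r -> 1 < rho -> rho < r ->
  (INR (fact j) * circ_int (fun z => C_derive_n phi k z * rmat X T x' (S j) x z) 0 rho)%C
  = (INR (fact (j + k)) * circ_int (fun z => phi z * rmat X T x' (S (j + k)) x z) 0 rho)%C.
Proof.
intros Hphi H1 Hr. revert j; induction k as [|k IH]; intros j.
- rewrite Nat.add_0_r. reflexivity.
- rewrite (circ_int_by_parts phi r rho x x' k (S j) Hphi H1 Hr).
  replace (j + S k)%nat with (S j + k)%nat by lia. rewrite <- IH.
  rewrite Cmult_assoc. f_equal. rewrite <- RtoC_mult, <- mult_INR. f_equal. f_equal.
  simpl. lia.
Qed.

(** * The supremum norm on H^infty *)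

Lemma Hinf_holo (r : R) (phi : C -> C) : Hinf r phi -> holo_disc phi r.
Proof. intros [H _] z Hz. apply ex_derive_cdiff, H, Hz. Qed.

(** The bound on [phi] and its value at 0 exclude both infinities, where [real] would return a
    default. *)
Lemma Hinf_norm_lub (r : R) (phi : C -> C) : 0 < r -> Hinf r phi ->
  is_lub_Rbar (fun v : R => exists z : C, Cmod z < r /\ v = Cmod (phi z)) (Hinf_norm r phi).
Proof.
intros Hr [_ [M HM]]. unfold Hinf_norm.
set (E := fun v : R => _). assert (HL := Lub_Rbar_correct E).
assert (Hub : is_ub_Rbar E M) by (intros v [z [Hz ->]]; apply HM, Hz).
assert (H0 : E (Cmod (phi 0%C))) by (exists 0%C; rewrite Cmod_0; split; trivial).
destruct (Lub_Rbar E) as [l| |] eqn:EL; [exact HL| |].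
- destruct (proj2 HL _ Hub).
- destruct (proj1 HL _ H0).
Qed.

Lemma Hinf_norm_ge (r : R) (phi : C -> C) (z : C) : 0 < r -> Hinf r phi -> Cmod z < r ->
  Cmod (phi z) <= Hinf_norm r phi.
Proof.
intros Hr H Hz. apply (proj1 (Hinf_norm_lub r phi Hr H) (Cmod (phi z))). exists z; split; trivial.
Qed.

Lemma Hinf_norm_le (r : R) (phi : C -> C) (M : R) : 0 < r -> Hinf r phi ->
  (forall z, Cmod z < r -> Cmod (phi z) <= M) -> Hinf_norm r phi <= M.
Proof.
intros Hr H HM. apply (proj2 (Hinf_norm_lub r phi Hr H) M).
intros v [z [Hz ->]]; apply HM, Hz.
Qed.

Lemma Hinf_norm_pos (r : R) (phi : C -> C) : 0 < r -> Hinf r phi -> 0 <= Hinf_norm r phi.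
Proof.
intros Hr H. eapply Rle_trans; [apply Cmod_ge_0|apply (Hinf_norm_ge r phi 0 Hr H)].
rewrite Cmod_0; exact Hr.
Qed.

Lemma ex_RInt_Cmod (f : R -> C) (a b : R) : a <= b -> rcont_on f a b -> ex_RInt (fun t => Cmod (f t)) a b.
Proof.
intros Hab H. apply (ex_RInt_continuous (V := R_CompleteNormedModule)). intros t Ht.
rewrite Rmin_left, Rmax_right in Ht by exact Hab.
apply (continuous_comp f (fun z : VC => Cmod z)).
- apply rcont_continuous, H, Ht.
- exact (filterlim_norm (K := R_AbsRing) (V := VC) (f t)).
Qed.

Lemma rmat_circ_cont (x : X) (x' : dual X) (j : nat) (rho t : R) : 1 < rho ->
  rcont (fun t => rmat X T x' j x (circle rho t)) t.
Proof.
intros H1. eapply rcont_comp; [|apply rcont_circle].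
apply rmat_cdiff; [exact specT|]. rewrite Cmod_circle, Rabs_pos_eq; lra.
Qed.

Theorem GFS_matrix_bound (m : nat) : GFS m T -> exists K, 0 < K /\
  forall (r : R) (phi : C -> C), 1 < r -> Hinf r phi -> forall rho, 1 < rho < r -> forall (x : X) (x' : dual X),
  Cmod (x' (derivative_calculus m phi rho T x)) <= K / (r - 1) ^ m * Hinf_norm r phi * norm x * norm x'.
Proof.
intros [_ [K [HK HG]]].
assert (Hpi := PI_RGT_0).
assert (H2m : 0 < 2 ^ m) by (apply pow_lt; lra).
assert (Hf : 0 < INR (fact m)) by (apply lt_0_INR, lt_O_fact).
exists (INR (fact m) * K * 2 ^ m). split; [repeat apply Rmult_lt_0_compat; assumption|].
intros r phi Hr Hphi rho Hrho x x'.
assert (Hh := Hinf_holo r phi Hphi).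
rewrite (calculus_matrix_coef m phi r rho x x' Hh (proj1 Hrho) (proj2 Hrho)).
assert (P := circ_int_by_parts_iter phi r rho x x' m 0 Hh (proj1 Hrho) (proj2 Hrho)).
simpl (fact 0) in P. simpl (INR 1) in P. rewrite Cmult_1_l in P. simpl (0 + m)%nat in P.
rewrite P.
(* The radius in the calculus may lie anywhere in (1, r), even close to 1, where (GFS)_m is weak.
   Moving to the midpoint costs only a factor 2^m, since rho' - 1 = (r - 1)/2. *)
set (rho' := (1 + r) / 2). assert (Hrho' : 1 < rho' < r) by (unfold rho'; lra).
rewrite (circ_int_homotopy _ 0 0 rho rho').
2: { intros s t Hs. set (q := rho + s * (rho' - rho)).
  assert (Hq : 1 < q < r).
  { unfold q. replace (rho + s * (rho' - rho)) with ((1 - s) * rho + s * rho') by ring.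
    destruct (Rle_dec rho rho').
    - assert (0 <= s * (rho' - rho) <= rho' - rho) by (split; [apply Rmult_le_pos; lra|]; rewrite <- (Rmult_1_l (rho' - rho)) at 2; apply Rmult_le_compat_r; lra). lra.
    - assert (0 <= s * (rho - rho') <= rho - rho') by (split; [apply Rmult_le_pos; lra|]; rewrite <- (Rmult_1_l (rho - rho')) at 2; apply Rmult_le_compat_r; lra). lra. }
  replace (0 + RtoC s * (0 - 0) + circle q t)%C with (circle q t) by ring.
  apply cdiffable_mult.
  - apply Hh. rewrite Cmod_circle, Rabs_pos_eq; lra.
  - apply rmat_cdiffable; [exact specT|]. rewrite Cmod_circle, Rabs_pos_eq; lra. }
set (I := circ_int _ 0 rho').
assert (HN := Hinf_norm_pos r phi ltac:(lra) Hphi).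
assert (HI : Cmod I <= rho' * Hinf_norm r phi * (K / ((rho' + 1) * (rho' - 1) ^ m) * norm x * norm x')).
{ specialize (HG rho' x x' (proj1 Hrho')).
  assert (Cr := fun t => rmat_circ_cont x x' (S m) rho' t (proj1 Hrho')).
  assert (EX : ex_RInt (fun t => Cmod (rmat X T x' (S m) x (circle rho' t))) 0 (2 * PI)).
  { apply ex_RInt_Cmod; [apply PI2_pos|]. intros t _; apply Cr. }
  (* The integrand of [circ_int] carries |z| = rho', which the rho' + 1 in the denominator of
     (GFS)_m later compensates. *)
  apply Rle_trans with (RInt (fun t => (rho' * Hinf_norm r phi) * Cmod (rmat X T x' (S m) x (circle rho' t))) 0 (2 * PI)).
  - apply cint_norm_le_int.
    + apply PI2_pos.
    + intros t _. apply (circ_int_cont (fun z => phi z * rmat X T x' (S m) x z)%C 0 rho'). intros u. apply cdiffable_mult.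
      * apply Hh. rewrite Cmod_origin_circle; lra.
      * apply rmat_cdiffable; [exact specT|]. rewrite Cmod_origin_circle; lra.
    + exact (ex_RInt_scal (V := R_NormedModule) _ _ _ (rho' * Hinf_norm r phi) EX).
    + intros t _. rewrite Cplus_0_l, !Cmod_mult, Cmod_circle, Rabs_pos_eq, <- Rmult_assoc by lra.
      apply Rmult_le_compat_r; [apply Cmod_ge_0|]. apply Rmult_le_compat_l; [lra|].
      apply Hinf_norm_ge; [lra|exact Hphi|]. rewrite Cmod_circle, Rabs_pos_eq; lra.
  - assert (ES : RInt (fun t => (rho' * Hinf_norm r phi) * Cmod (rmat X T x' (S m) x (circle rho' t))) 0 (2 * PI)
      = (rho' * Hinf_norm r phi) * RInt (fun t => Cmod (rmat X T x' (S m) x (circle rho' t))) 0 (2 * PI)).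
    { exact (RInt_scal (V := R_CompleteNormedModule) _ _ _ (rho' * Hinf_norm r phi) EX). }
    rewrite ES. apply Rmult_le_compat_l; [apply Rmult_le_pos; lra|].
    rewrite Nat.add_1_r in HG. exact HG. }
rewrite !Cmod_mult, Cmod_inv, !Cmod_R by (apply Cmod_neq; rewrite Cmod_R, Rabs_pos_eq; lra).
rewrite !Rabs_pos_eq by lra.
assert (Hx := norm_ge_0 x). assert (Hx' := norm_ge_0 x').
assert (E1 : rho' - 1 = (r - 1) / 2) by (unfold rho'; lra).
assert (Hpm : 0 < (r - 1) ^ m) by (apply pow_lt; lra).
assert (E2 : (rho' - 1) ^ m = (r - 1) ^ m / 2 ^ m).
{ rewrite E1. unfold Rdiv. rewrite Rpow_mult_distr, pow_inv. reflexivity. }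
set (B := K * 2 ^ m / (r - 1) ^ m * Hinf_norm r phi * norm x * norm x').
assert (HB : 0 <= B).
{ unfold B. repeat apply Rmult_le_pos; try assumption; try lra. left; apply Rinv_0_lt_compat; exact Hpm. }
assert (HI2 : Cmod I <= B).
{ apply Rle_trans with (1 := HI). rewrite E2.
  replace (rho' * Hinf_norm r phi * (K / ((rho' + 1) * ((r - 1) ^ m / 2 ^ m)) * norm x * norm x'))
    with (B * (rho' / (rho' + 1))) by (unfold B; field; repeat split; lra).
  rewrite <- (Rmult_1_r B) at 2. apply Rmult_le_compat_l; [exact HB|].
  apply Rmult_le_reg_r with (rho' + 1); [lra|]. unfold Rdiv. rewrite Rmult_assoc, Rinv_l; lra. }
replace (INR (fact m) * K * 2 ^ m / (r - 1) ^ m * Hinf_norm r phi * norm x * norm x') with (1 * (INR (fact m) * B))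
  by (unfold B; field; lra).
apply Rmult_le_compat.
- left; apply Rinv_0_lt_compat; lra.
- apply Rmult_le_pos; [lra|apply Cmod_ge_0].
- rewrite <- Rinv_1. apply Rinv_le_contravar; [lra|]. assert (H := PI2_1). lra.
- apply Rmult_le_compat_l; lra.
Qed.

End Calculus.

(** * The Hahn-Banach theorem *)

Section HahnBanach.

Variable V : NormedModule C_AbsRing.

Lemma scal_plus_r (c : C) (u v : V) : scal c (plus u v) = plus (scal c u) (scal c v).
Proof. exact (scal_distr_l (K := C_Ring) c u v). Qed.

Lemma scal_plus_l (c d : C) (u : V) : scal (c + d)%C u = plus (scal c u) (scal d u).
Proof. exact (scal_distr_r (K := C_Ring) c d u). Qed.

Lemma scal_scal (c d : C) (u : V) : scal c (scal d u) = scal (c * d)%C u.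
Proof. exact (scal_assoc (K := C_Ring) c d u). Qed.

Lemma scal_1 (u : V) : scal (RtoC 1) u = u.
Proof. exact (scal_one (K := C_Ring) u). Qed.

Lemma scal_0 (u : V) : scal (RtoC 0) u = zero.
Proof. exact (scal_zero_l (K := C_Ring) u). Qed.

Lemma plus_swap (a b c d : V) : plus (plus a b) (plus c d) = plus (plus a c) (plus b d).
Proof.
rewrite <- !plus_assoc. f_equal. rewrite !plus_assoc. f_equal. apply plus_comm.
Qed.

Lemma norm_scal_R (t : R) (u : V) : norm (scal (RtoC t) u) = Rabs t * norm u.
Proof. rewrite norm_scal_C, Cmod_R; reflexivity. Qed.

Variable y : V.

(* Graphs of real-linear functionals dominated by the norm and equal to the norm of y at y;
   the empty graph is allowed, because the union of the empty chain must be one. *)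
Definition dominated_graph (A : V * R -> Prop) : Prop :=
  (forall u v a b, A (u, a) -> A (v, b) -> A (plus u v, a + b)) /\
  (forall t u a, A (u, a) -> A (scal (RtoC t) u, t * a)) /\
  (forall u a, A (u, a) -> a <= norm u) /\
  (forall p, A p -> A (y, norm y)).

(** Any two points of the union of a chain lie in a common member, so the four conditions pass to
    unions and Zorn's lemma applies. *)
Lemma maximal_graph : exists A, dominated_graph A /\
  forall B, (forall p, A p -> B p) -> dominated_graph B -> forall p, B p -> A p.
Proof.
destruct (classical_sets.Zorn_bigcup (P := dominated_graph)) as [A [HA Hmax]].
- intros F HF Htot.
  assert (Hchain : forall A B, F A -> F B -> (forall p, A p -> B p) \/ (forall p, B p -> A p)) by exact Htot.
  split; [|split; [|split]].
  + intros u v a b [A FA Au] [B FB Bv].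
    destruct (Hchain A B FA FB) as [S|S].
    * exists B; [exact FB|]. apply (proj1 (HF B FB)); [apply S; exact Au|exact Bv].
    * exists A; [exact FA|]. apply (proj1 (HF A FA)); [exact Au|apply S; exact Bv].
  + intros t u a [A FA Au]. exists A; [exact FA|]. apply (HF A FA); exact Au.
  + intros u a [A FA Au]. apply (HF A FA); exact Au.
  + intros p [A FA Au]. exists A; [exact FA|]. apply (proj2 (proj2 (proj2 (HF A FA))) p); exact Au.
- exists A; split; [exact HA|]. intros B AB HB p Bp.
  apply NNPP; intros Hn. apply (Hmax B); [|exact HB].
  split; [exact AB|]. intros BA. apply Hn, BA, Bp.
Qed.

(** The seed of the extension: through maximality it forces a maximal graph to be nonempty. *)
Lemma line_graph : dominated_graph (fun p => exists t, p = (scal (RtoC t) y, t * norm y)).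
Proof.
split; [|split; [|split]].
- intros u v a b [s Es] [t Et]. injection Es as -> ->. injection Et as -> ->.
  exists (s + t). rewrite RtoC_plus, scal_plus_l. f_equal. ring.
- intros s u a [t Et]. injection Et as -> ->. exists (s * t).
  rewrite RtoC_mult, scal_scal. f_equal. ring.
- intros u a [t Et]. injection Et as -> ->. rewrite norm_scal_R.
  apply Rmult_le_compat_r; [apply norm_ge_0|apply Rle_abs].
- intros p _. exists 1. rewrite scal_1, Rmult_1_l. reflexivity.
Qed.

(** For (u, a) and (v, b) in A, a + b <= |u + v| <= |u - x0| + |v + x0|, so each lower bound lies
    below each upper bound; alpha is the supremum of the lower ones. *)
Lemma extension_value (A : V * R -> Prop) (x0 : V) : dominated_graph A -> (exists p, A p) ->
  exists alpha, forall u a, A (u, a) -> a - norm (minus u x0) <= alpha /\ alpha <= norm (plus u x0) - a.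
Proof.
intros [HAp [HAs [HAn HAy]]] [[u0 a0] Hu0].
assert (K : forall u a v b, A (u, a) -> A (v, b) -> a - norm (minus u x0) <= norm (plus v x0) - b).
{ intros u a v b Hu Hv. assert (H := HAn _ _ (HAp _ _ _ _ Hu Hv)).
  assert (E : plus u v = plus (minus u x0) (plus v x0)).
  { rewrite (plus_comm v x0). unfold minus. rewrite <- (plus_assoc u).
    f_equal. rewrite plus_assoc.
    transitivity (plus zero v); [symmetry; apply plus_zero_l|f_equal; symmetry; exact (plus_opp_l x0)]. }
  rewrite E in H. assert (T : norm (plus (minus u x0) (plus v x0)) <= norm (minus u x0) + norm (plus v x0)) by apply (norm_triangle (V := V)).
  assert (T2 := Rle_trans _ _ _ H T). lra. }
destruct (completeness (fun r => exists u a, A (u, a) /\ r = a - norm (minus u x0))) as [alpha [H1 H2]].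
- exists (norm (plus u0 x0) - a0). intros r [u [a [Hu ->]]]. apply K; assumption.
- exists (a0 - norm (minus u0 x0)), u0, a0; split; trivial.
- exists alpha. intros u a Hu. split.
  + apply H1. exists u, a; split; trivial.
  + apply H2. intros r [v [b [Hv ->]]]. apply K; assumption.
Qed.

Lemma extension_dominated (A : V * R -> Prop) (x0 : V) (alpha : R) : dominated_graph A ->
  (forall u a, A (u, a) -> a - norm (minus u x0) <= alpha /\ alpha <= norm (plus u x0) - a) ->
  dominated_graph (fun p => exists u a t, A (u, a) /\ p = (plus u (scal (RtoC t) x0), a + t * alpha)).
Proof.
intros [HAp [HAs [HAn HAy]]] Hal.
split; [|split; [|split]].
- intros u1 u2 a1 a2 [v [b [s [Hv E1]]]] [w [c [t [Hw E2]]]]. injection E1 as -> ->. injection E2 as -> ->.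
  exists (plus v w), (b + c), (s + t). split; [apply HAp; assumption|].
  rewrite plus_swap, RtoC_plus, scal_plus_l. f_equal. ring.
- intros s u1 a1 [v [b [t [Hv E1]]]]. injection E1 as -> ->.
  exists (scal (RtoC s) v), (s * b), (s * t). split; [apply HAs; assumption|].
  rewrite scal_plus_r, scal_scal, RtoC_mult. f_equal. ring.
- intros u1 a1 [u [a [t [Hu E1]]]]. injection E1 as -> ->.
  (* Dividing by |t| leads back to the bounds on alpha: the lower one for t < 0, the upper one for t
     > 0. *)
  destruct (Rtotal_order t 0) as [Ht|[Ht|Ht]].
  + assert (Hs : 0 < - t) by lra.
    destruct (Hal _ _ (HAs (/ - t) _ _ Hu)) as [L _].
    assert (E : plus u (scal (RtoC t) x0) = scal (RtoC (- t)) (minus (scal (RtoC (/ - t)) u) x0)).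
    { transitivity (plus (scal (RtoC (- t)) (scal (RtoC (/ - t)) u)) (scal (RtoC (- t)) (opp x0))).
      - rewrite scal_scal, <- RtoC_mult, Rinv_r, scal_1 by lra. f_equal.
        rewrite (scal_opp_r (K := C_Ring) (V := V)).
        rewrite <- (scal_opp_l (K := C_Ring) (V := V)). f_equal.
        change (RtoC t = - RtoC (- t))%C. rewrite RtoC_opp; ring.
      - symmetry; apply scal_plus_r. }
    rewrite E, norm_scal_R, Rabs_pos_eq by lra.
    assert (G : forall n, / - t * a - n <= alpha -> a + t * alpha <= - t * n).
    { intros n Hle. apply (Rmult_le_compat_l (- t)) in Hle; [|lra].
      replace (- t * (/ - t * a - n)) with (a - - t * n) in Hle by (field; lra). lra. }
    apply G; exact L.
  + subst t. rewrite scal_0, plus_zero_r, Rmult_0_l, Rplus_0_r. apply HAn, Hu.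
  + destruct (Hal _ _ (HAs (/ t) _ _ Hu)) as [_ L].
    assert (E : plus u (scal (RtoC t) x0) = scal (RtoC t) (plus (scal (RtoC (/ t)) u) x0)).
    { rewrite scal_plus_r, scal_scal, <- RtoC_mult, Rinv_r, scal_1 by lra. reflexivity. }
    rewrite E, norm_scal_R, Rabs_pos_eq by lra.
    assert (G : forall n, alpha <= n - / t * a -> a + t * alpha <= t * n).
    { intros n Hle. apply (Rmult_le_compat_l t) in Hle; [|lra].
      replace (t * (n - / t * a)) with (t * n - a) in Hle by (field; lra). lra. }
    apply G; exact L.
- intros p [u [a [t [Hu _]]]].
  exists y, (norm y), 0. split; [apply (HAy _ Hu)|].
  rewrite scal_0, plus_zero_r, Rmult_0_l, Rplus_0_r. reflexivity.
Qed.

Lemma real_hahn_banach : exists f : V -> R,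
  (forall u v, f (plus u v) = f u + f v) /\ (forall t u, f (scal (RtoC t) u) = t * f u) /\
  (forall u, f u <= norm u) /\ f y = norm y.
Proof.
destruct maximal_graph as [A [HA Hmax]].
assert (Hne : exists p, A p).
(* An empty A would be contained in [line_graph], so by maximality it would contain (y, |y|). *)
{ apply NNPP; intros Hn. apply Hn. exists (y, norm y). apply (Hmax _ (fun p Hp => False_ind _ (Hn (ex_intro _ p Hp))) line_graph).
  exists 1. rewrite scal_1, Rmult_1_l; reflexivity. }
assert (Htotal : forall x, exists a, A (x, a)).
{ intros x0. destruct (extension_value A x0 HA Hne) as [alpha Hal].
  exists alpha. destruct Hne as [[u a] Hu].
  assert (H00 := proj1 (proj2 HA) 0 u a Hu). rewrite scal_0, Rmult_0_l in H00.
  (* The extension by x0 contains A, hence is contained in A, and (x0, alpha) belongs to it. *)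
  refine (Hmax _ _ (extension_dominated A x0 alpha HA Hal) (x0, alpha) _).
  - intros [v b] Hp. exists v, b, 0. split; [exact Hp|].
    rewrite scal_0, plus_zero_r, Rmult_0_l, Rplus_0_r. reflexivity.
  - exists zero, 0, 1. split; [exact H00|]. rewrite scal_1, plus_zero_l. f_equal. ring. }
destruct HA as [HAp [HAs [HAn HAy]]].
(* Domination forces single values: (x, a) and (x, b) give (0, a - b), so a - b <= 0, and
   symmetrically. *)
assert (Hfun : forall x a b, A (x, a) -> A (x, b) -> a = b).
{ assert (L : forall x a b, A (x, a) -> A (x, b) -> a <= b).
  { intros x a b Ha Hb. assert (H := HAn _ _ (HAp _ _ _ _ Ha (HAs (-1) _ _ Hb))).
    replace (plus x (scal (RtoC (-1)) x)) with (zero : V) in H.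
    - rewrite norm_zero in H. lra.
    - rewrite <- (scal_1 x) at 1. rewrite <- scal_plus_l, <- RtoC_plus.
      replace (1 + -1) with 0 by ring. rewrite scal_0; reflexivity. }
  intros x a b Ha Hb. apply Rle_antisym; apply (L x); assumption. }
set (f := fun x => proj1_sig (constructive_indefinite_description _ (Htotal x))).
assert (Hf : forall x, A (x, f x)) by (intros x; exact (proj2_sig (constructive_indefinite_description _ (Htotal x)))).
exists f. split; [|split; [|split]].
- intros u v. apply (Hfun (plus u v)); [apply Hf|apply HAp; apply Hf].
- intros t u. apply (Hfun (scal (RtoC t) u)); [apply Hf|apply HAs; apply Hf].
- intros u. apply HAn, Hf.
- apply (Hfun y); [apply Hf|apply (HAy _ (Hf y))].
Qed.

(** The real functional f is the real part of the complex functional u |-> f(u) - i f(i u). Rotating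
    u by the conjugate phase of its value makes that value equal to its modulus, so the bound on f
    carries over. *)
Theorem hahn_banach : exists x' : blop V C_NormedModule, opnorm x' <= 1 /\ norm y <= Cmod (x' y).
Proof.
destruct real_hahn_banach as [f [Hp [Hs [Hn Hy]]]].
set (g := fun u => (RtoC (f u) - Ci * RtoC (f (scal Ci u)))%C).
assert (HCi : (Ci * Ci = RtoC (-1))%C) by (unfold Ci, Cmult, RtoC; simpl; f_equal; ring).
assert (gp : forall u v, g (plus u v) = (g u + g v)%C).
{ intros u v. unfold g. rewrite scal_plus_r, !Hp, !RtoC_plus. ring. }
assert (gi : forall u, g (scal Ci u) = (Ci * g u)%C).
{ intros u. unfold g. rewrite scal_scal, HCi, Hs, RtoC_mult.
  transitivity (RtoC (f (scal Ci u)) - RtoC (-1) * Ci * RtoC (f u))%C; [ring|].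
  transitivity (Ci * RtoC (f u) - (Ci * Ci) * RtoC (f (scal Ci u)))%C; [|ring].
  rewrite HCi. replace (RtoC (-1)) with (- (1))%C
    by (unfold RtoC, Copp; simpl; f_equal; ring). ring. }
assert (gr : forall t u, g (scal (RtoC t) u) = (RtoC t * g u)%C).
{ intros t u. unfold g. rewrite Hs, scal_scal, (Cmult_comm Ci (RtoC t)), <- scal_scal, Hs, !RtoC_mult. ring. }
assert (gs : forall c u, g (scal c u) = (c * g u)%C).
{ intros [p q] u.
  replace ((p, q) : C) with (RtoC p + RtoC q * Ci)%C
    by (unfold RtoC, Ci, Cplus, Cmult; simpl; f_equal; ring).
  rewrite scal_plus_l, gp, <- scal_scal, !gr, gi. ring. }
assert (gRe : forall u, f u = fst (g u)).
{ intros u. unfold g, RtoC, Ci, Cminus, Cplus, Copp, Cmult; simpl. ring. }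
assert (gn : forall u, Cmod (g u) <= norm u).
{ intros u. destruct (Req_dec (Cmod (g u)) 0) as [H|H]; [rewrite H; apply norm_ge_0|].
  assert (H0 := Cmod_ge_0 (g u)).
  set (c := (Cconj (g u) / RtoC (Cmod (g u)))%C).
  assert (Hnz : RtoC (Cmod (g u)) <> 0%C) by (intros E; apply H, RtoC_inj; exact E).
  assert (Hc : Cmod c = 1).
  { unfold c. rewrite Cmod_div, Cmod_conj, Cmod_R, Rabs_pos_eq by trivial. field; exact H. }
  assert (Hg : g (scal c u) = RtoC (Cmod (g u))).
  { rewrite gs. unfold c.
    transitivity ((g u * Cconj (g u)) / RtoC (Cmod (g u)))%C; [field; exact Hnz|].
    rewrite <- Cmod2_conj. simpl. rewrite Rmult_1_r, RtoC_mult. field; exact Hnz. }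
  assert (E := gRe (scal c u)). rewrite Hg in E. simpl in E.
  rewrite <- E. eapply Rle_trans; [apply Hn|]. rewrite norm_scal_C, Hc. lra. }
assert (HL : is_linear (U := V) (V := C_NormedModule) g).
{ split; [exact gp|exact gs|]. exists 1. split; [lra|]. intros u. rewrite Rmult_1_l. apply gn. }
exists (Blop HL). split.
- apply opnorm_le; [lra|]. intros u. rewrite Rmult_1_l. apply gn.
- change (norm y <= Cmod (g y)). rewrite <- Hy, gRe.
  apply Rle_trans with (1 := Rle_abs _). apply re_le_Cmod.
Qed.

End HahnBanach.

(** * Riemann sums of the Poisson kernel *)

Fixpoint csum (f : nat -> C) (n : nat) : C :=
  match n with O => 0%C | S k => (csum f k + f k)%C end.

Fixpoint rsum (f : nat -> R) (n : nat) : R :=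
  match n with O => 0 | S k => rsum f k + f k end.

Lemma csum_ext (f g : nat -> C) (n : nat) : (forall j, (j < n)%nat -> f j = g j) -> csum f n = csum g n.
Proof.
intros H; induction n as [|n IH]; [reflexivity|]. simpl. rewrite IH, H; auto.
Qed.

Lemma csum_plus (f g : nat -> C) (n : nat) : csum (fun j => f j + g j)%C n = (csum f n + csum g n)%C.
Proof. induction n as [|n IH]; simpl; [ring|]. rewrite IH; ring. Qed.

Lemma csum_scal (c : C) (f : nat -> C) (n : nat) : csum (fun j => c * f j)%C n = (c * csum f n)%C.
Proof. induction n as [|n IH]; simpl; [ring|]. rewrite IH; ring. Qed.

Lemma csum_first (f : nat -> C) (n : nat) : csum f (S n) = (f 0%nat + csum (fun j => f (S j)) n)%C.
Proof.
induction n as [|n IH]; [simpl; ring|].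
change (csum f (S (S n))) with (csum f (S n) + f (S n))%C. rewrite IH. simpl. ring.
Qed.

Lemma csum_0 (f : nat -> C) (n : nat) : (forall j, (j < n)%nat -> f j = 0%C) -> csum f n = 0%C.
Proof. intros H; induction n as [|n IH]; simpl; [reflexivity|]. rewrite IH, H; auto; ring. Qed.

Lemma csum_swap (f : nat -> nat -> C) (n p : nat) :
  csum (fun j => csum (f j) p) n = csum (fun k => csum (fun j => f j k) n) p.
Proof.
induction n as [|n IH]; simpl.
- symmetry; apply csum_0; reflexivity.
- rewrite IH. symmetry. apply csum_plus.
Qed.

Lemma csum_norm_le (f : nat -> C) (g : nat -> R) (n : nat) : (forall j, Cmod (f j) <= g j) ->
  Cmod (csum f n) <= rsum g n.
Proof.
intros H; induction n as [|n IH]; simpl; [rewrite Cmod_0; lra|].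
eapply Rle_trans; [apply Cmod_triangle|]. specialize (H n); lra.
Qed.

Lemma rsum_const (c : R) (n : nat) : rsum (fun _ => c) n = INR n * c.
Proof. induction n as [|n IH]; [simpl; ring|]. rewrite S_INR. simpl. rewrite IH; ring. Qed.

Lemma rsum_scal (c : R) (f : nat -> R) (n : nat) : rsum (fun j => c * f j) n = c * rsum f n.
Proof. induction n as [|n IH]; simpl; [ring|]. rewrite IH; ring. Qed.

Lemma rsum_plus (f g : nat -> R) (n : nat) : rsum (fun j => f j + g j) n = rsum f n + rsum g n.
Proof. induction n as [|n IH]; simpl; [ring|]. rewrite IH; ring. Qed.

Lemma rsum_ext (f g : nat -> R) (n : nat) : (forall j, f j = g j) -> rsum f n = rsum g n.
Proof. intros H; induction n as [|n IH]; simpl; [reflexivity|]. rewrite IH, H; reflexivity. Qed.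

Lemma csum_RtoC (f : nat -> R) (n : nat) : csum (fun j => RtoC (f j)) n = RtoC (rsum f n).
Proof. induction n as [|n IH]; simpl; [reflexivity|]. rewrite IH, RtoC_plus; reflexivity. Qed.

Lemma csum_Re (f : nat -> C) (n : nat) : fst (csum f n) = rsum (fun j => fst (f j)) n.
Proof. induction n as [|n IH]; simpl; [reflexivity|]. rewrite IH; reflexivity. Qed.

Lemma geometric_csum (a : C) (n : nat) : ((1 - a) * csum (fun k => Cpow a k) n = 1 - Cpow a n)%C.
Proof.
induction n as [|n IH]; simpl csum; [simpl; ring|].
rewrite Cmult_plus_distr_l, IH, Cpow_S. ring.
Qed.

Lemma ei_plus (s t : R) : ei (s + t) = (ei s * ei t)%C.
Proof. unfold ei, Cmult; simpl. rewrite cos_plus, sin_plus. f_equal; ring. Qed.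

Lemma ei_0 : ei 0 = 1%C.
Proof. unfold ei. rewrite cos_0, sin_0. reflexivity. Qed.

Lemma ei_pow (t : R) (n : nat) : Cpow (ei t) n = ei (INR n * t).
Proof.
induction n as [|n IH]; [simpl; rewrite Rmult_0_l, ei_0; reflexivity|].
rewrite Cpow_S, IH, <- ei_plus, S_INR. f_equal; ring.
Qed.

Lemma ei_neq_1 (t : R) : 0 < t < 2 * PI -> ei (- t) <> 1%C.
Proof.
intros Ht E. assert (H := f_equal fst E). simpl in H. rewrite cos_neg in H.
replace t with (2 * (t / 2)) in H by field. rewrite cos_2a_sin in H.
assert (Hs : 0 < sin (t / 2)) by (apply sin_gt_0; lra).
assert (0 < sin (t / 2) * sin (t / 2)) by (apply Rmult_lt_0_compat; exact Hs). lra.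
Qed.

(** A geometric sum of ratio b = om^k, where b^N = 1 but b <> 1 because 0 < k < N. *)
Lemma roots_of_unity_sum (N k : nat) : (0 < k < N)%nat ->
  csum (fun j => Cpow (Cpow (ei (- (2 * PI / INR N))) j) k) N = 0%C.
Proof.
intros Hk. assert (HN : 0 < INR N) by (apply lt_0_INR; lia).
assert (Hk0 : 0 < INR k) by (apply lt_0_INR; lia).
assert (HkN : INR k < INR N) by (apply lt_INR; lia).
assert (HP := PI_RGT_0).
set (om := ei (- (2 * PI / INR N))).
set (b := Cpow om k).
rewrite (csum_ext _ (fun j => Cpow b j)).
2: { intros j _. unfold b. rewrite <- !Cpow_mult_r. f_equal. lia. }
assert (Hb : b <> 1%C).
{ unfold b, om. rewrite ei_pow. replace (INR k * - (2 * PI / INR N)) with (- (2 * PI * (INR k / INR N))) by (field; lra).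
  apply ei_neq_1. assert (0 < INR k / INR N < 1).
  { split; [apply Rdiv_lt_0_compat; lra|]. apply Rmult_lt_reg_r with (INR N); [lra|].
    unfold Rdiv. rewrite Rmult_assoc, Rinv_l; lra. }
  split; [apply Rmult_lt_0_compat; lra|]. rewrite <- (Rmult_1_r (2 * PI)) at 2. apply Rmult_lt_compat_l; lra. }
assert (HbN : Cpow b N = 1%C).
{ unfold b. rewrite <- Cpow_mult_r, Nat.mul_comm, Cpow_mult_r. unfold om. rewrite ei_pow.
  replace (INR N * - (2 * PI / INR N)) with (- (2 * PI)) by (field; lra).
  replace (ei (- (2 * PI))) with (RtoC 1).
  - apply Cpow_1_l.
  - unfold ei. rewrite cos_neg, sin_neg, cos_2PI, sin_2PI, Ropp_0. reflexivity. }
assert (G := geometric_csum b N). rewrite HbN in G.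
assert (Hb1 : (1 - b <> 0)%C) by (intros E; apply Hb; replace b with (1 - (1 - b))%C by ring; rewrite E; ring).
replace (csum (fun k => Cpow b k) N) with (/ (1 - b) * ((1 - b) * csum (fun k => Cpow b k) N))%C by (field; exact Hb1).
rewrite G. ring.
Qed.

(** Each a = q om^j has a^N = q^N, so 1/(1 - a) is the sum of a^k over k < N divided by 1 - q^N.
    Summing over j leaves only k = 0. *)
Lemma resolvent_roots_sum (N : nat) (q : C) : (0 < N)%nat -> Cmod q < 1 ->
  csum (fun j => / (1 - q * Cpow (ei (- (2 * PI / INR N))) j))%C N = (INR N * / (1 - Cpow q N))%C.
Proof.
intros HN Hq. assert (HN0 : 0 < INR N) by (apply lt_0_INR; lia).
set (om := ei (- (2 * PI / INR N))).
assert (Hom : forall j, Cmod (Cpow om j) = 1).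
{ intros j. unfold om. rewrite ei_pow. apply Cmod_ei. }
assert (H1 : forall u, Cmod u < 1 -> (1 - u <> 0)%C).
{ intros u Hu. apply Cmod_neq. assert (A := Cmod_minus_ge 1 u). rewrite Cmod_1 in A. lra. }
assert (HqN : Cmod (Cpow q N) < 1).
{ rewrite Cmod_pow. destruct N as [|n]; [lia|]. simpl.
  assert (0 <= Cmod q) by apply Cmod_ge_0.
  assert (Cmod q ^ n <= 1) by (rewrite <- (pow1 n); apply pow_incr; lra).
  assert (0 <= Cmod q ^ n) by (apply pow_le; lra).
  apply Rle_lt_trans with (Cmod q * 1); [apply Rmult_le_compat_l; lra|lra]. }
assert (Ha : forall j, Cmod (q * Cpow om j) < 1).
{ intros j. rewrite Cmod_mult, Hom, Rmult_1_r. exact Hq. }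
assert (HomN : forall j, Cpow (Cpow om j) N = 1%C).
{ intros j. rewrite <- Cpow_mult_r, Nat.mul_comm, Cpow_mult_r.
  replace (Cpow om N) with (RtoC 1); [apply Cpow_1_l|].
  unfold om. rewrite ei_pow.
  replace (INR N * - (2 * PI / INR N)) with (- (2 * PI)) by (field; lra).
  unfold ei. rewrite cos_neg, sin_neg, cos_2PI, sin_2PI, Ropp_0. reflexivity. }
rewrite (csum_ext _ (fun j => / (1 - Cpow q N) * csum (fun k => Cpow q k * Cpow (Cpow om j) k) N)%C).
- rewrite csum_scal, csum_swap, Cmult_comm. f_equal.
  destruct N as [|n]; [lia|].
  rewrite csum_first.
  rewrite (csum_0 (fun j => csum (fun j0 => Cpow q (S j) * Cpow (Cpow om j0) (S j))%C (S n))).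
  + rewrite (csum_ext _ (fun _ => RtoC 1)) by (intros j _; simpl; ring).
    rewrite csum_RtoC, rsum_const, Rmult_1_r. ring.
  + intros k Hk. rewrite csum_scal. unfold om. rewrite roots_of_unity_sum by lia. ring.
- intros j _. assert (G := geometric_csum (q * Cpow om j)%C N).
  rewrite Cpow_mult_l, HomN, Cmult_1_r in G. rewrite <- G.
  rewrite (csum_ext (fun k => Cpow q k * Cpow (Cpow om j) k)%C (fun k => Cpow (q * Cpow om j) k)%C)
    by (intros k _; rewrite Cpow_mult_l; reflexivity).
  assert (Hne := H1 _ (Ha j)).
  assert (Hs : csum (fun k => Cpow (q * Cpow om j) k)%C N <> 0%C).
  { intros E. rewrite E, Cmult_0_r in G. apply (H1 _ HqN). symmetry; exact G. }
  field. split; assumption.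
Qed.

(* The right-hand side is the real part of (1 + a) / (1 - a). *)
Lemma poisson_Re (a : C) : Cmod a < 1 ->
  (1 - Cmod a ^ 2) * / Cmod (1 - a) ^ 2 = fst (RtoC 2 * / (1 - a) - 1)%C.
Proof.
intros Ha.
assert (Hn : 0 < Cmod (1 - a)).
{ assert (A := Cmod_minus_ge 1 a). rewrite Cmod_1 in A. lra. }
rewrite !Cmod2_alt. assert (Hn2 : 0 < Cmod (1 - a) ^ 2) by (apply pow_lt; exact Hn).
rewrite Cmod2_alt in Hn2. destruct a as [p q]. simpl in *.
field. simpl in Hn2.
replace ((1 + - p) ^ 2 + (0 + - q) ^ 2) with ((1 + - p) * ((1 + - p) * 1) + (0 + - q) * ((0 + - q) * 1)) by ring.
lra.
Qed.

(** With q = z/s, the Poisson kernel summed over the nodes equals the real part of 2 N/(1 - q^N) -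
    N. The hypothesis on N gives |1 - q^N| >= 1/2, hence at most 4 N + N. *)
Lemma poisson_sum (N : nat) (s : R) (z : C) : (0 < N)%nat -> Cmod z < s -> (Cmod z / s) ^ N <= / 2 ->
  rsum (fun j => / Cmod (circle s (INR j * (2 * PI / INR N)) - z) ^ 2) N <= 5 * INR N / (s ^ 2 - Cmod z ^ 2).
Proof.
intros HN Hz HqN. assert (Hz0 := Cmod_ge_0 z). assert (Hs : 0 < s) by lra.
assert (HN0 : 0 < INR N) by (apply lt_0_INR; lia).
assert (Hs0 : RtoC s <> 0%C) by (apply Cmod_neq; rewrite Cmod_R, Rabs_pos_eq; lra).
set (q := (z / RtoC s)%C).
assert (Eq : Cmod q = Cmod z / s) by (unfold q; rewrite Cmod_div, Cmod_R, Rabs_pos_eq by (trivial; lra); reflexivity).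
assert (Hq : Cmod q < 1).
{ rewrite Eq. apply Rmult_lt_reg_r with s; [lra|]. unfold Rdiv. rewrite Rmult_assoc, Rinv_l; lra. }
set (om := ei (- (2 * PI / INR N))).
(* With w_j the j-th node, w_j - z = w_j (1 - a_j); this explains the minus sign in [om]. *)
set (a := fun j => (q * Cpow om j)%C).
assert (Hsz : 0 < s ^ 2 - Cmod z ^ 2).
{ replace (s ^ 2 - Cmod z ^ 2) with ((s - Cmod z) * (s + Cmod z)) by ring. apply Rmult_lt_0_compat; lra. }
assert (Ha : forall j, Cmod (a j) = Cmod z / s).
{ intros j. unfold a, om. rewrite Cmod_mult, ei_pow, Cmod_ei, Rmult_1_r. exact Eq. }
assert (Et : forall j, / Cmod (circle s (INR j * (2 * PI / INR N)) - z) ^ 2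
   = / (s ^ 2 - Cmod z ^ 2) * fst (RtoC 2 * / (1 - a j) - 1)%C).
{ intros j. rewrite <- poisson_Re by (rewrite Ha, <- Eq; exact Hq). rewrite Ha.
  assert (F : (circle s (INR j * (2 * PI / INR N)) - z = RtoC s * ei (INR j * (2 * PI / INR N)) * (1 - a j))%C).
  { unfold a, om, q. rewrite circle_ei, ei_pow.
    transitivity (s * ei (INR j * (2 * PI / INR N)) - z * (ei (INR j * (2 * PI / INR N)) * ei (INR j * - (2 * PI / INR N))))%C.
    - rewrite <- ei_plus. replace (INR j * (2 * PI / INR N) + INR j * - (2 * PI / INR N)) with 0 by ring.
      rewrite ei_0. ring.
    - field. exact Hs0. }
  rewrite F, !Cmod_mult, Cmod_ei, Cmod_R, (Rabs_pos_eq s) by lra.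
  assert (Hn : 0 < Cmod (1 - a j)).
  { assert (A := Cmod_minus_ge 1 (a j)). rewrite Cmod_1, Ha, <- Eq in A. lra. }
  field. repeat split; lra. }
assert (Es : rsum (fun j => / Cmod (circle s (INR j * (2 * PI / INR N)) - z) ^ 2) N
  = / (s ^ 2 - Cmod z ^ 2) * fst (RtoC 2 * (INR N * / (1 - Cpow q N)) - INR N)%C).
{ rewrite <- (resolvent_roots_sum N q HN Hq).
  transitivity (rsum (fun j => / (s ^ 2 - Cmod z ^ 2) * fst (RtoC 2 * / (1 - a j) - 1)%C) N).
  - apply rsum_ext; exact Et.
  - rewrite rsum_scal, <- csum_Re. f_equal. f_equal.
    rewrite <- csum_scal.
    transitivity (csum (fun j => RtoC 2 * / (1 - a j) + RtoC (-1))%C N).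
    + apply csum_ext; intros j _. replace (RtoC (-1)) with (- (1))%C by (unfold RtoC, Copp; simpl; f_equal; ring). ring.
    + rewrite csum_plus, csum_RtoC, rsum_const. rewrite RtoC_mult. unfold a, om.
      replace (RtoC (-1)) with (- (1))%C by (unfold RtoC, Copp; simpl; f_equal; ring). ring. }
rewrite Es. unfold Rdiv. rewrite Rmult_comm. apply Rmult_le_compat_r; [left; apply Rinv_0_lt_compat; exact Hsz|].
apply Rle_trans with (1 := Rle_abs _). eapply Rle_trans; [apply re_le_Cmod|].
eapply Rle_trans; [apply Cmod_minus_le|]. rewrite !Cmod_mult, !Cmod_R, !Rabs_pos_eq by lra.
assert (Hn : / 2 <= Cmod (1 - Cpow q N)).
{ assert (A := Cmod_minus_ge 1 (Cpow q N)). rewrite Cmod_1, Cmod_pow, Eq in A. lra. }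
assert (Hi : Cmod (/ (1 - Cpow q N)) <= 2).
{ rewrite Cmod_inv by (apply Cmod_neq; lra). rewrite <- (Rinv_inv 2). apply Rinv_le_contravar; lra. }
assert (INR N * Cmod (/ (1 - Cpow q N)) <= INR N * 2) by (apply Rmult_le_compat_l; lra).
lra.
Qed.

(** * Powers of the Cauchy kernel *)

Lemma cdiff_kernel_pow (w z : C) (k : nat) : z <> w ->
  cdiff (fun z => Cpow (/ (w - z)) k) z (INR k * Cpow (/ (w - z)) (S k))%C.
Proof.
intros H.
assert (Hwz : (w - z <> 0)%C).
{ intros E; apply H. replace z with (w - (w - z))%C by ring. rewrite E; ring. }
assert (K : cdiff (fun z => / (w - z))%C z (/ (w - z) * / (w - z))%C).
{ eapply cdiff_eq.
  - apply (cdiff_comp (fun u => / u)%C (fun z => w - z)%C).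
    + apply cdiff_inv. exact Hwz.
    + apply cdiff_plus; [apply cdiff_const|].
      apply (cdiff_ext_loc (fun z => - (1) * z)%C) with 1; [lra|intros; ring|].
      apply cdiff_mult; [apply cdiff_const|apply cdiff_id].
  - cbv beta. field. exact Hwz. }
induction k as [|k IH].
- simpl. eapply cdiff_eq; [apply cdiff_const|]. ring.
- apply (cdiff_ext_loc (fun z => / (w - z) * Cpow (/ (w - z)) k)%C) with 1; [lra|reflexivity|].
  eapply cdiff_eq; [apply cdiff_mult; [exact K|exact IH]|]. cbv beta.
  rewrite S_INR, RtoC_plus, !Cpow_S. ring.
Qed.

Lemma cdiff_csum (f l : nat -> C -> C) (z : C) (n : nat) : (forall j, cdiff (f j) z (l j z)) ->
  cdiff (fun z => csum (fun j => f j z) n) z (csum (fun j => l j z) n).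
Proof.
intros H; induction n as [|n IH]; simpl; [apply cdiff_const|].
apply (cdiff_plus (fun z => csum (fun j => f j z) n) (f n)); [exact IH|apply H].
Qed.

Lemma circ_int_csum (f : nat -> C -> C) (c : C) (rho : R) (n : nat) :
  (forall j t, cdiffable (f j) (c + circle rho t)) ->
  circ_int (fun z => csum (fun j => f j z) n) c rho = csum (fun j => circ_int (f j) c rho) n.
Proof.
intros H; induction n as [|n IH].
- simpl. unfold circ_int. transitivity (cint (fun _ => 0%C) 0 (2 * PI)).
  + apply cint_ext; [apply PI2_pos|]. intros t _. ring.
  + rewrite cint_const. ring.
- simpl. rewrite <- IH.
  apply (circ_int_plus (fun z => csum (fun j => f j z) n) (f n)).
  + intros t. clear IH. induction n as [|n IH]; simpl; [apply cdiffable_const|].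
    apply (cdiffable_plus (fun z => csum (fun j => f j z) n) (f n)); [exact IH|apply H].
  + apply H.
Qed.

(** * From the calculus to (GFS)_m *)

Section Discretization.

Variables (X : CompleteNormedModule C_AbsRing) (T : blop X X).
Hypothesis specT : spectrum_in_closed_disc T.

(** The residue at infinity: on a large circle z R(z) x = x + T R(z) x, and the last term tends to
    0. *)
Lemma circ_int_resolvent (rho : R) (x : X) (x' : dual X) : 1 < rho ->
  circ_int (rmat X T x' 1 x) 0 rho = (RtoC (2 * PI) * x' x)%C.
Proof.
intros Hrho. assert (HP := PI_RGT_0).
assert (HT := opnorm_ge_0 T). assert (Hx := norm_ge_0 x). assert (Hx' := norm_ge_0 x').
assert (E : forall e, 0 < e -> Cmod (circ_int (rmat X T x' 1 x) 0 rho - RtoC (2 * PI) * x' x) <= 2 * PI * e).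
{ intros e He.
  set (B := norm x' * (opnorm T * norm x)). assert (HB : 0 <= B) by (repeat apply Rmult_le_pos; assumption).
  (* Makes rho' - |T| at least B/e, so that the error is at most e. *)
  set (rho' := rho + opnorm T + B / e).
  assert (HBe : 0 <= B / e) by (apply Rmult_le_pos; [exact HB|left; apply Rinv_0_lt_compat, He]).
  assert (Hrho' : 1 < rho') by (unfold rho'; lra).
  rewrite (circ_int_homotopy _ 0 0 rho rho').
  2: { intros s t Hs. apply rmat_cdiffable; [exact specT|].
    replace (0 + RtoC s * (0 - 0))%C with (RtoC 0) by ring. rewrite Cmod_origin_circle; unfold rho'.
    - assert (0 <= s * (rho + opnorm T + B / e - rho)) by (apply Rmult_le_pos; lra). lra.
    - assert (0 <= s * (rho + opnorm T + B / e - rho)) by (apply Rmult_le_pos; lra). lra. }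
  replace (RtoC (2 * PI) * x' x)%C with (cint (fun _ => x' x) 0 (2 * PI))
    by (rewrite cint_const, Rminus_0_r; reflexivity).
  unfold circ_int.
  assert (Cr : forall t, rcont (fun t => circle rho' t * rmat X T x' 1 x (0 + circle rho' t))%C t).
  { apply circ_int_cont. intros t. apply rmat_cdiffable; [exact specT|]. rewrite Cmod_origin_circle; lra. }
  match goal with |- Cmod (?a - ?b) <= _ => replace (a - b)%C
    with (cint (fun t => circle rho' t * rmat X T x' 1 x (0 + circle rho' t) + - x' x)%C 0 (2 * PI)) end.
  - eapply Rle_trans; [apply cint_norm_le with (M := e)|].
    + apply PI2_pos.
    + intros t _. apply rcont_plus; [apply Cr|apply rcont_const].
    + intros t _. rewrite Cplus_0_l.
      set (z := circle rho' t). assert (Hz : Cmod z = rho') by (unfold z; rewrite Cmod_circle, Rabs_pos_eq; lra).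
      unfold rmat. change (blop_pow (resolvent z T) 1 x) with (resolvent z T x).
      assert (Ez : (z * x' (resolvent z T x) + - x' x = x' (T (resolvent z T x)))%C).
      { transitivity (x' (scal z (resolvent z T x)) + - x' x)%C; [f_equal; symmetry; apply dual_scal|].
        rewrite (resolvent_scal X T specT z x) by (rewrite Hz; exact Hrho').
        transitivity ((x' x + x' (T (resolvent z T x))) + - x' x)%C; [|ring].
        f_equal. exact (dual_plus X x' x (T (resolvent z T x))). }
      rewrite Ez. eapply Rle_trans; [apply dual_bound|].
      assert (Rn : norm (resolvent z T x) <= / (rho' - opnorm T) * norm x).
      { rewrite <- Hz. apply resolvent_infinity; [exact specT|rewrite Hz; exact Hrho'|].
        rewrite Hz; unfold rho'; lra. }
      apply Rle_trans with (norm x' * (opnorm T * (/ (rho' - opnorm T) * norm x))).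
      * apply Rmult_le_compat_l; [exact Hx'|]. eapply Rle_trans; [apply opnorm_bound|].
        apply Rmult_le_compat_l; assumption.
      * replace (norm x' * (opnorm T * (/ (rho' - opnorm T) * norm x))) with (B * / (rho' - opnorm T))
          by (unfold B; ring).
        assert (Hd : 0 < rho' - opnorm T) by (unfold rho'; lra).
        apply Rmult_le_reg_r with (rho' - opnorm T); [exact Hd|].
        rewrite Rmult_assoc, Rinv_l, Rmult_1_r by lra.
        replace B with (e * (B / e)) at 1 by (field; lra). apply Rmult_le_compat_l; unfold rho'; lra.
    + lra.
  - rewrite cint_plus; [|apply PI2_pos|intros t _; apply Cr|intros t _; apply rcont_const].
    rewrite !cint_const. ring. }
assert (Z : (circ_int (rmat X T x' 1 x) 0 rho - RtoC (2 * PI) * x' x = 0)%C).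
{ apply Cmod_le_all_eq_0. intros e He. replace e with (2 * PI * (e / (2 * PI))) by (field; lra).
  apply E. apply Rdiv_lt_0_compat; lra. }
replace (circ_int (rmat X T x' 1 x) 0 rho)
  with (circ_int (rmat X T x' 1 x) 0 rho - RtoC (2 * PI) * x' x + RtoC (2 * PI) * x' x)%C by ring.
rewrite Z; ring.
Qed.

(** The kernel is holomorphic for |z| < |w|, so the circle shrinks to radius 0, where the factor z
    in [circ_int] vanishes. *)
Lemma circ_int_kernel_pow (rho : R) (w : C) (k : nat) : 0 <= rho -> rho < Cmod w ->
  circ_int (fun z => Cpow (/ (w - z)) k) 0 rho = 0%C.
Proof.
intros Hrho Hw.
rewrite (circ_int_homotopy _ 0 0 rho 0).
- unfold circ_int. transitivity (cint (fun _ => 0%C) 0 (2 * PI)).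
  + apply cint_ext; [apply PI2_pos|]. intros t _. rewrite circle_ei. ring.
  + rewrite cint_const. ring.
- intros s t Hs. eexists. apply cdiff_kernel_pow. intros E.
  assert (E2 := f_equal Cmod E). revert E2.
  replace (0 + RtoC s * (0 - 0))%C with (RtoC 0) by ring.
  rewrite Cmod_origin_circle.
  + assert (0 <= s * rho) by (apply Rmult_le_pos; lra). lra.
  + assert (s * rho <= 1 * rho) by (apply Rmult_le_compat_r; lra). lra.
Qed.

(* By the resolvent identity,
   (w - z)^(-k-1) R(z) = (w - z)^(-k-1) R(w) + (w - z)^(-k) R(z) R(w), and the
   first term integrates to 0. *)
Lemma circ_int_kernel_resolvent (rho : R) (w : C) (x' : dual X) (k : nat) (x : X) : 1 < rho -> rho < Cmod w ->
  circ_int (fun z => Cpow (/ (w - z)) k * rmat X T x' 1 x z)%C 0 rho = (RtoC (2 * PI) * rmat X T x' k x w)%C.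
Proof.
intros H1 Hw. revert x; induction k as [|k IH]; intros x.
- change (rmat X T x' 0 x w) with (x' x). rewrite <- (circ_int_resolvent rho x x' H1).
  apply circ_int_ext. intros t. simpl. ring.
- set (x1 := resolvent w T x).
  assert (Hc : forall t, Cmod (0 + circle rho t) = rho) by (intros t; apply Cmod_origin_circle; lra).
  assert (Hne : forall t, (0 + circle rho t)%C <> w).
  { intros t E. assert (E2 := f_equal Cmod E). rewrite Hc in E2. lra. }
  assert (Dk : forall j t, cdiffable (fun z => Cpow (/ (w - z)) j) (0 + circle rho t)).
  { intros j t. eexists; apply cdiff_kernel_pow, Hne. }
  assert (Dr : forall x t, cdiffable (rmat X T x' 1 x) (0 + circle rho t)).
  { intros v t. apply rmat_cdiffable; [exact specT|]. rewrite Hc; exact H1. }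
  rewrite (circ_int_ext _ (fun z => x' x1 * Cpow (/ (w - z)) (S k) + Cpow (/ (w - z)) k * rmat X T x' 1 x1 z)%C).
  + rewrite circ_int_plus.
    * rewrite circ_int_scal by (intros t; apply Dk).
      rewrite circ_int_kernel_pow, IH by lra. unfold x1. rewrite <- rmat_S_app. ring.
    * intros t. apply cdiffable_mult; [apply cdiffable_const|apply Dk].
    * intros t. apply cdiffable_mult; [apply Dk|apply Dr].
  + intros t. set (z := (0 + circle rho t)%C).
    assert (Hz : 1 < Cmod z) by (unfold z; rewrite Hc; exact H1).
    unfold rmat. change (blop_pow (resolvent z T) 1 x) with (resolvent z T x).
    change (blop_pow (resolvent z T) 1 x1) with (resolvent z T x1).
    rewrite (resolvent_identity X T specT w z x ltac:(lra) Hz). fold x1.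
    rewrite dual_plus, dual_scal, Cpow_S.
    assert (Hwz : (w - z <> 0)%C).
    { intros E. apply (Hne t). fold z. replace z with (w - (w - z))%C by ring. rewrite E; ring. }
    field. exact Hwz.
Qed.

Definition node (N : nat) (s : R) (j : nat) : C := circle s (INR j * (2 * PI / INR N)).

(* (GFS)_k for Riemann sums.  N0 depends only on a lower bound r0 of the radius:
   discrete_GFS_descend integrates over all radii s >= r0 with N fixed. *)
Definition discrete_GFS (k : nat) : Prop := exists K, 0 < K /\ forall r0, 1 < r0 -> exists N0, (0 < N0)%nat /\
  forall (N : nat) (s : R) (h : nat -> C) (x : X) (x' : dual X), (N0 <= N)%nat -> r0 <= s ->
  (forall j, Cmod (h j) <= 1) ->
  2 * PI / INR N * Cmod (csum (fun j => h j * rmat X T x' (S k) x (node N s j))%C N)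
  <= K / ((s + 1) * (s - 1) ^ k) * norm x * norm x'.

(** Starting from exponent 2, the m derivatives bring out the factors 2, 3, ..., m + 1. *)
Lemma rational_derive_n (w c : nat -> C) (s : R) (N m : nat) : (forall j, Cmod (w j) = s) ->
  forall z, Cmod z < s ->
  C_derive_n (fun z => csum (fun j => c j * Cpow (/ (w j - z)) 2)%C N) m z
  = (INR (fact (S m)) * csum (fun j => c j * Cpow (/ (w j - z)) (m + 2)) N)%C.
Proof.
intros Hw. induction m as [|m IH]; intros z Hz.
- change (INR (fact 1)) with 1. rewrite Cmult_1_l. reflexivity.
- rewrite C_derive_n_S. apply cdiff_derive.
  apply (cdiff_ext_loc (fun z => INR (fact (S m)) * csum (fun j => c j * Cpow (/ (w j - z)) (m + 2)) N)%C) with (s - Cmod z).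
  + lra.
  + intros v Hv. symmetry; apply IH. apply Cmod_minus_near in Hv; lra.
  + eapply cdiff_eq.
    * apply cdiff_mult; [apply cdiff_const|].
      apply (cdiff_csum (fun j z => c j * Cpow (/ (w j - z)) (m + 2))%C
        (fun j z => INR (m + 2) * (c j * Cpow (/ (w j - z)) (S (m + 2))))%C).
      intros j. eapply cdiff_eq; [apply cdiff_mult; [apply cdiff_const|apply cdiff_kernel_pow]|].
      -- intros E. rewrite E, Hw in Hz; lra.
      -- cbv beta. ring.
    * cbv beta. rewrite csum_scal, Cmult_0_l, Cplus_0_l, Cmult_assoc. f_equal.
      rewrite <- RtoC_mult, <- mult_INR. f_equal. f_equal.
      change (fact (S (S m))) with (S (S m) * fact (S m))%nat. lia.
Qed.

Lemma rational_holo (w c : nat -> C) (s : R) (N k : nat) : (forall j, Cmod (w j) = s) ->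
  holo_disc (fun z => csum (fun j => c j * Cpow (/ (w j - z)) k)%C N) s.
Proof.
intros Hw z Hz. eexists. apply (cdiff_csum (fun j z => c j * Cpow (/ (w j - z)) k)%C
  (fun j z => c j * (INR k * Cpow (/ (w j - z)) (S k)))%C).
intros j. eapply cdiff_eq; [apply cdiff_mult; [apply cdiff_const|apply cdiff_kernel_pow]|].
- intros E. rewrite E, Hw in Hz; lra.
- cbv beta. ring.
Qed.

(** Term by term, the kernel to the power m + 2 integrates against R(z) to R(w_j)^(m+2), the poles
    w_j being outside the circle of integration. *)
Lemma rational_calculus (w c : nat -> C) (s rho : R) (N m : nat) (x : X) (x' : dual X) :
  (forall j, Cmod (w j) = s) -> 1 < rho -> rho < s ->
  x' (derivative_calculus m (fun z => csum (fun j => c j * Cpow (/ (w j - z)) 2)%C N) rho T x)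
  = (INR (fact (S m)) * csum (fun j => c j * rmat X T x' (m + 2) x (w j)) N)%C.
Proof.
intros Hw H1 Hs. assert (HP := PI_RGT_0).
rewrite (calculus_matrix_coef X T specT m _ s rho x x' (rational_holo w c s N 2 Hw) H1 Hs).
assert (Hc : forall t, Cmod (0 + circle rho t) = rho) by (intros t; apply Cmod_origin_circle; lra).
assert (D : forall j t, cdiffable (fun z => Cpow (/ (w j - z)) (m + 2) * rmat X T x' 1 x z)%C (0 + circle rho t)).
{ intros j t. apply cdiffable_mult.
  - eexists; apply cdiff_kernel_pow. intros E. assert (E2 := f_equal Cmod E). rewrite Hc, Hw in E2. lra.
  - apply rmat_cdiffable; [exact specT|]. rewrite Hc; exact H1. }
rewrite (circ_int_ext _ (fun z => csum (fun j => (INR (fact (S m)) * c j) * (Cpow (/ (w j - z)) (m + 2) * rmat X T x' 1 x z)) N)%C).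
- rewrite (circ_int_csum (fun j z => (INR (fact (S m)) * c j) * (Cpow (/ (w j - z)) (m + 2) * rmat X T x' 1 x z))%C).
  + rewrite (csum_ext _ (fun j => (RtoC (2 * PI) * INR (fact (S m))) * (c j * rmat X T x' (m + 2) x (w j)))%C).
    * rewrite csum_scal. match goal with |- ?a = ?b => change (@eq C a b) end.
      field. apply Cmod_neq. rewrite Cmod_R, Rabs_pos_eq; lra.
    * intros j _. rewrite circ_int_scal by (intros t; apply D).
      rewrite circ_int_kernel_resolvent by (rewrite ?Hw; lra). ring.
  + intros j t. apply cdiffable_mult; [apply cdiffable_const|apply D].
- intros t. rewrite rational_derive_n with (s := s) by (trivial; rewrite Hc; exact Hs).
  rewrite <- csum_scal, Cmult_comm, <- csum_scal.
  apply csum_ext; intros j _. ring.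
Qed.

Lemma calculus_discrete_GFS (m : nat) : derivative_bounded_calculus m T -> discrete_GFS (S m).
Proof.
intros [K [HK HC]]. assert (HP := PI_RGT_0).
assert (H2m : 0 < 2 ^ m) by (apply pow_lt; lra).
exists (K * 2 ^ m * (20 * PI)). split; [apply Rmult_lt_0_compat; [apply Rmult_lt_0_compat; assumption|lra]|].
intros r0 Hr0.
(* For |z| < (1 + s)/2 and s >= r0, |z|/s <= (1 + 1/s)/2 <= th < 1. Hence one N with th^N <= 1/2
   serves all radii from r0 on. *)
set (th := (1 + / r0) / 2).
assert (Hir : 0 < / r0 < 1).
{ split; [apply Rinv_0_lt_compat; lra|]. apply Rmult_lt_reg_r with r0; [lra|]. rewrite Rinv_l; lra. }
destruct (pow_lt_1_zero th ltac:(unfold th; rewrite Rabs_pos_eq; lra) (/ 2) ltac:(lra)) as [N1 HN1].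
exists (S N1). split; [lia|].
intros N s h x x' HN Hs Hh.
assert (HN0 : 0 < INR N) by (apply lt_0_INR; lia).
set (rho := (1 + s) / 2). set (del := 2 * PI / INR N).
assert (Hdel : 0 < del) by (apply Rdiv_lt_0_compat; lra).
set (c := fun j => (RtoC del * h j)%C).
assert (Hc : forall j, Cmod (c j) <= del).
{ intros j. unfold c. rewrite Cmod_mult, Cmod_R, Rabs_pos_eq by lra.
  rewrite <- (Rmult_1_r del) at 2. apply Rmult_le_compat_l; [lra|apply Hh]. }
assert (Hw : forall j, Cmod (node N s j) = s) by (intros j; unfold node; rewrite Cmod_circle, Rabs_pos_eq; lra).
set (phi := fun z => csum (fun j => c j * Cpow (/ (node N s j - z)) 2)%C N).
(* The weight [del] times 5 N is 10 PI, and s^2 - |z|^2 >= (s^2 - 1)/2 for |z| <= (1 + s)/2. *)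
set (M := 20 * PI / ((s + 1) * (s - 1))).
assert (Hphi : forall z, Cmod z < rho -> Cmod (phi z) <= M).
{ intros z Hz. assert (Hz0 := Cmod_ge_0 z).
  assert (Hnz : forall j, (node N s j - z <> 0)%C).
  { intros j. apply Cmod_neq. assert (A := Cmod_minus_ge (node N s j) z). rewrite Hw in A. unfold rho in Hz; lra. }
  eapply Rle_trans; [apply (csum_norm_le _ (fun j => del * / Cmod (node N s j - z) ^ 2))|].
  - intros j. rewrite Cmod_mult, Cmod_pow, Cmod_inv, pow_inv by apply Hnz.
    apply Rmult_le_compat_r; [|apply Hc]. left; apply Rinv_0_lt_compat, pow_lt, Cmod_gt_0, Hnz.
  - rewrite rsum_scal.
    assert (Q : Cmod z / s <= th).
    { apply Rmult_le_reg_r with s; [lra|]. unfold Rdiv. rewrite Rmult_assoc, Rinv_l, Rmult_1_r by lra.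
      unfold th. assert (1 <= / r0 * s).
      { rewrite <- (Rinv_l r0) by lra. apply Rmult_le_compat_l; lra. }
      unfold rho in Hz. lra. }
    assert (QN : (Cmod z / s) ^ N <= / 2).
    { apply Rle_trans with (th ^ N).
      - apply pow_incr. split; [apply Rmult_le_pos; [lra|left; apply Rinv_0_lt_compat; lra]|exact Q].
      - left. specialize (HN1 N ltac:(lia)). rewrite Rabs_pos_eq in HN1 by (apply pow_le; unfold th; lra). exact HN1. }
    assert (PS := poisson_sum N s z ltac:(lia) ltac:(unfold rho in Hz; lra) QN).
    apply Rle_trans with (del * (5 * INR N / (s ^ 2 - Cmod z ^ 2))); [apply Rmult_le_compat_l; [lra|exact PS]|].
    assert (Hd : (s + 1) * (s - 1) / 2 <= s ^ 2 - Cmod z ^ 2).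
    { replace (s ^ 2 - Cmod z ^ 2) with ((s + Cmod z) * (s - Cmod z)) by ring.
      assert (Z2 : Cmod z ^ 2 <= rho ^ 2) by (apply pow_incr; lra).
      replace ((s + Cmod z) * (s - Cmod z)) with (s ^ 2 - Cmod z ^ 2) by ring.
      unfold rho in Z2. assert (0 <= (s - 1) * (s - 1)) by (apply Rmult_le_pos; lra).
      assert (0 <= (s - 1) * s) by (apply Rmult_le_pos; lra). lra. }
    assert (Hp : 0 < (s + 1) * (s - 1)) by (apply Rmult_lt_0_compat; lra).
    replace (del * (5 * INR N / (s ^ 2 - Cmod z ^ 2))) with (10 * PI * / (s ^ 2 - Cmod z ^ 2))
      by (unfold del; field; lra).
    unfold M. replace (20 * PI / ((s + 1) * (s - 1))) with (10 * PI * / ((s + 1) * (s - 1) / 2))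
      by (field; lra).
    apply Rmult_le_compat_l; [lra|]. apply Rinv_le_contravar; lra. }
assert (HH : Hinf rho phi).
{ split; [|exists M; exact Hphi]. intros z Hz. apply ex_derive_cdiff.
  apply (rational_holo (node N s) c s N 2 Hw). unfold rho in Hz; lra. }
(* The calculus is used for the disc of radius rho, away from the poles at radius s, and computed on
   a smaller circle. The factor 2^m comes from rho - 1 = (s - 1)/2. *)
set (rho1 := (1 + rho) / 2). assert (Hrho : 1 < rho < s) by (unfold rho; lra).
assert (Hrho1 : 1 < rho1 < rho) by (unfold rho1; lra).
assert (B := HC rho phi (proj1 Hrho) HH rho1 Hrho1).
assert (HM := Hinf_norm_le rho phi M ltac:(lra) HH Hphi).
assert (E := rational_calculus (node N s) c s rho1 N m x x' Hw ltac:(lra) ltac:(lra)).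
fold phi in E.
set (A := derivative_calculus m phi rho1 T) in *.
(* The factorial multiplies the side to be estimated, so the lower bound 1 suffices. *)
assert (F1 : 1 <= INR (fact (S m))).
{ replace 1 with (INR 1) by reflexivity. apply le_INR. assert (L := lt_O_fact (S m)). lia. }
assert (F2 : Cmod (x' (A x)) <= norm x' * (opnorm A * norm x)).
{ eapply Rle_trans; [apply dual_bound|]. apply Rmult_le_compat_l; [apply norm_ge_0|apply opnorm_bound]. }
assert (E2 : csum (fun j => c j * rmat X T x' (m + 2) x (node N s j))%C N
  = (RtoC del * csum (fun j => h j * rmat X T x' (S (S m)) x (node N s j)) N)%C).
{ rewrite <- csum_scal. apply csum_ext; intros j _. unfold c.
  replace (m + 2)%nat with (S (S m)) by lia. ring. }
rewrite E, E2, !Cmod_mult, !Cmod_R, !Rabs_pos_eq in F2 by lra.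
set (Q := del * Cmod (csum (fun j => h j * rmat X T x' (S (S m)) x (node N s j))%C N)) in *.
assert (HQ : 0 <= Q) by (apply Rmult_le_pos; [lra|apply Cmod_ge_0]).
apply Rle_trans with (norm x' * (opnorm A * norm x)).
{ apply Rle_trans with (2 := F2). rewrite <- (Rmult_1_l Q) at 1. apply Rmult_le_compat_r; assumption. }
assert (Hx := norm_ge_0 x). assert (Hx' := norm_ge_0 x').
assert (P1 : 0 < (s - 1) ^ m) by (apply pow_lt; lra).
assert (HA : opnorm A <= K * 2 ^ m / (s - 1) ^ m * M).
{ eapply Rle_trans; [exact B|].
  replace (K / (rho - 1) ^ m) with (K * 2 ^ m / (s - 1) ^ m).
  - apply Rmult_le_compat_l; [|exact HM]. apply Rmult_le_pos; [apply Rmult_le_pos; lra|left; apply Rinv_0_lt_compat, P1].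
  - replace (rho - 1) with ((s - 1) * / 2) by (unfold rho; field). rewrite Rpow_mult_distr, pow_inv. field.
    split; lra. }
apply Rle_trans with (norm x' * (K * 2 ^ m / (s - 1) ^ m * M * norm x)).
- apply Rmult_le_compat_l; [exact Hx'|]. apply Rmult_le_compat_r; assumption.
- apply Req_le. unfold M. simpl. field. repeat split; lra.
Qed.

(** * Descent in k along the rays through the nodes *)

Lemma rdiff_ray (t s : R) : rdiff (fun s => circle s t) s (ei t).
Proof.
apply (rdiff_ext (fun s => 0 + RtoC s * ei t)%C).
- intros u. rewrite circle_ei. ring.
- apply rdiff_affine.
Qed.

Lemma rdiff_plus (f g : R -> C) (t : R) (l m : C) : rdiff f t l -> rdiff g t m ->
  rdiff (fun s => f s + g s)%C t (l + m)%C.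
Proof.
intros Hf Hg e He. destruct (Hf (e / 2) ltac:(lra)) as [d1 [Hd1 K1]].
destruct (Hg (e / 2) ltac:(lra)) as [d2 [Hd2 K2]].
exists (Rmin d1 d2); split; [apply Rmin_pos; lra|]. intros s Hs.
assert (H1 := Rmin_l d1 d2); assert (H2 := Rmin_r d1 d2).
specialize (K1 s ltac:(lra)). specialize (K2 s ltac:(lra)).
replace (f s + g s - (f t + g t) - RtoC (s - t) * (l + m))%C with
  ((f s - f t - RtoC (s - t) * l) + (g s - g t - RtoC (s - t) * m))%C by ring.
eapply Rle_trans; [apply Cmod_triangle|]. lra.
Qed.

Lemma rdiff_const (a : C) (t : R) : rdiff (fun _ => a) t 0.
Proof.
apply (rdiff_ext (fun s => a + RtoC s * 0)%C); [intros; ring|]. apply rdiff_affine.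
Qed.

Lemma rdiff_csum (f l : nat -> R -> C) (s : R) (n : nat) : (forall j, rdiff (f j) s (l j s)) ->
  rdiff (fun s => csum (fun j => f j s) n) s (csum (fun j => l j s) n).
Proof.
intros H; induction n as [|n IH]; simpl; [apply rdiff_const|].
apply (rdiff_plus (fun s => csum (fun j => f j s) n) (f n)); [exact IH|apply H].
Qed.

Lemma rcont_csum (f : nat -> R -> C) (s : R) (n : nat) : (forall j, rcont (f j) s) ->
  rcont (fun s => csum (fun j => f j s) n) s.
Proof.
intros H; induction n as [|n IH]; simpl; [apply rcont_const|].
apply (rcont_plus (fun s => csum (fun j => f j s) n) (f n)); [exact IH|apply H].
Qed.

Lemma is_RInt_inv_pow (r S0 : R) (k : nat) : 1 < r -> r <= S0 -> (1 <= k)%nat ->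
  is_RInt (fun s => INR k / (s - 1) ^ S k) r S0 (/ (r - 1) ^ k - / (S0 - 1) ^ k).
Proof.
intros Hr HS Hk.
replace (/ (r - 1) ^ k - / (S0 - 1) ^ k) with (minus (- / (S0 - 1) ^ k) (- / (r - 1) ^ k))
  by (unfold minus, plus, opp; simpl; ring).
apply (is_RInt_derive (V := R_CompleteNormedModule) (fun s => - / (s - 1) ^ k)); intros s Hs;
  rewrite Rmin_left, Rmax_right in Hs by exact HS.
- assert (P : 0 < (s + - (1)) ^ k) by (apply pow_lt; lra).
  auto_derive; [apply Rgt_not_eq, P|].
  destruct k as [|k]; [lia|].
  change (Init.Nat.pred (S k)) with k. unfold Rminus.
  change ((s + - (1)) ^ S (S k)) with ((s + - (1)) * ((s + - (1)) * (s + - (1)) ^ k)).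
  change ((s + - (1)) ^ S k) with ((s + - (1)) * (s + - (1)) ^ k).
  assert (0 < (s + - (1)) ^ k) by (apply pow_lt; lra).
  field. split; lra.
- apply (ex_derive_continuous (K := R_AbsRing) (V := R_NormedModule)).
  assert (P : 0 < (s + - (1)) ^ S k) by (apply pow_lt; lra).
  auto_derive. apply Rgt_not_eq. exact P.
Qed.

(** With N and the weights h fixed while the nodes move outwards, the Riemann sum is a curve in s
    whose derivative is a Riemann sum one order higher. *)
Lemma discrete_GFS_descend (k : nat) : (1 <= k)%nat -> discrete_GFS (S k) -> discrete_GFS k.
Proof.
intros Hk [K [HK H]]. assert (HP := PI_RGT_0).
assert (HSk : 0 < INR (S k)) by (apply lt_0_INR; lia).
assert (Hk0 : 1 <= INR k) by (replace 1 with (INR 1) by reflexivity; apply le_INR; exact Hk).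
exists (INR (S k) * K). split; [apply Rmult_lt_0_compat; assumption|].
intros r0 Hr0. destruct (H r0 Hr0) as [N0 [HN0 HB]]. exists N0; split; [exact HN0|].
intros N r h x x' HN Hr Hh.
assert (HNp : 0 < INR N) by (apply lt_0_INR; lia).
set (del := 2 * PI / INR N). assert (Hdel : 0 < del) by (apply Rdiv_lt_0_compat; lra).
assert (Hx := norm_ge_0 x). assert (Hx' := norm_ge_0 x').
set (th := fun j => INR j * (2 * PI / INR N)).
set (Psi := fun s => csum (fun j => h j * rmat X T x' (S k) x (node N s j))%C N).
(* The derivative along a ray brings out its direction [ei (th j)], of modulus 1, which is absorbed
   into the weights when the hypothesis is applied. *)
set (dPsi := fun s => csum (fun j => h j * (- INR (S k) * rmat X T x' (S (S k)) x (node N s j) * ei (th j)))%C N).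
assert (Hnode : forall s j, 1 < s -> 1 < Cmod (node N s j)).
{ intros s j Hs. unfold node. rewrite Cmod_circle, Rabs_pos_eq; lra. }
assert (Cn : forall i j s, 1 < s -> rcont (fun s => rmat X T x' i x (node N s j)) s).
{ intros i j s Hs. eapply (rcont_comp (rmat X T x' i x) (fun s => node N s j)).
  - apply rmat_cdiff; [exact specT|apply Hnode, Hs].
  - exact (rdiff_rcont _ _ _ (rdiff_ray (th j) s)). }
assert (Dn : forall s, 1 < s -> rdiff Psi s (dPsi s)).
{ intros s Hs. apply (rdiff_csum (fun j s => h j * rmat X T x' (S k) x (node N s j))%C
    (fun j s => h j * (- INR (S k) * rmat X T x' (S (S k)) x (node N s j) * ei (th j)))%C).
  intros j. apply (rdiff_comp (fun z => h j * z)%C (fun s => rmat X T x' (S k) x (node N s j))).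
  - eapply cdiff_eq; [apply cdiff_mult; [apply cdiff_const|apply cdiff_id]|]. cbv beta. ring.
  - apply (rdiff_comp (rmat X T x' (S k) x) (fun s => node N s j)).
    + apply rmat_cdiff; [exact specT|apply Hnode, Hs].
    + exact (rdiff_ray (th j) s). }
assert (Cd : forall s, 1 < s -> rcont dPsi s).
{ intros s Hs. apply (rcont_csum (fun j s => h j * (- INR (S k) * rmat X T x' (S (S k)) x (node N s j) * ei (th j)))%C).
  intros j. apply rcont_scal, rcont_mult; [apply rcont_scal, Cn, Hs|apply rcont_const]. }
(* Freezes 1/(s + 1) at its largest value 1/(r + 1) and leaves room for a factor k >= 1, so that the
   bound G k/(s - 1)^(k+1) has the primitive -G/(s - 1)^k. *)
set (G := INR (S k) * K / (r + 1) * norm x * norm x' / del).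
assert (HG : 0 <= G).
{ unfold G, Rdiv. repeat apply Rmult_le_pos; try assumption; try lra; left; apply Rinv_0_lt_compat; lra. }
assert (Bd : forall s, r <= s -> Cmod (dPsi s) <= G * (INR k / (s - 1) ^ S k)).
{ intros s Hs.
  assert (B := HB N s (fun j => h j * ei (th j))%C x x' HN ltac:(lra)
    ltac:(intros j; cbv beta; rewrite Cmod_mult, Cmod_ei, Rmult_1_r; apply Hh)).
  cbv beta in B. fold del in B.
  assert (E : dPsi s = (- INR (S k) * csum (fun j => h j * ei (th j) * rmat X T x' (S (S k)) x (node N s j)) N)%C).
  { unfold dPsi. rewrite <- csum_scal. apply csum_ext; intros j _. ring. }
  rewrite E, Cmod_mult, Cmod_opp, Cmod_R, Rabs_pos_eq by lra.
  set (Q := Cmod _) in *.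
  assert (P1 : 0 < (s - 1) ^ S k) by (apply pow_lt; lra).
  apply Rmult_le_reg_l with del; [exact Hdel|].
  replace (del * (INR (S k) * Q)) with (INR (S k) * (del * Q)) by ring.
  apply Rle_trans with (INR (S k) * (K / ((s + 1) * (s - 1) ^ S k) * norm x * norm x')).
  { apply Rmult_le_compat_l; [lra|exact B]. }
  replace (del * (G * (INR k / (s - 1) ^ S k))) with (INR (S k) * (K * norm x * norm x' * / (s - 1) ^ S k * (INR k * / (r + 1))))
    by (unfold G; field; repeat split; lra).
  apply Rmult_le_compat_l; [lra|].
  replace (K / ((s + 1) * (s - 1) ^ S k) * norm x * norm x') with (K * norm x * norm x' * / (s - 1) ^ S k * / (s + 1))
    by (field; split; lra).
  apply Rmult_le_compat_l.
  - repeat apply Rmult_le_pos; try assumption; try lra. left; apply Rinv_0_lt_compat, P1.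
  - apply Rle_trans with (/ (r + 1)); [apply Rinv_le_contravar; lra|].
    rewrite <- (Rmult_1_l (/ (r + 1))) at 1. apply Rmult_le_compat_r; [left; apply Rinv_0_lt_compat; lra|exact Hk0]. }
assert (Hpk : 0 < (r - 1) ^ k) by (apply pow_lt; lra).
assert (Main : forall e, 0 < e -> Cmod (Psi r) <= G / (r - 1) ^ k + e).
{ intros e He.
  assert (HT := opnorm_ge_0 T).
  set (W := INR N * (norm x' * norm x)).
  assert (HW : 0 <= W) by (unfold W; repeat apply Rmult_le_pos; lra).
  assert (HWe : 0 <= W / e) by (apply Rmult_le_pos; [exact HW|left; apply Rinv_0_lt_compat, He]).
  (* Far enough out for the decay of the resolvent to make the sum at S0 at most e. *)
  set (S0 := r + opnorm T + 1 + W / e).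
  assert (HS0 : r <= S0) by (unfold S0; lra).
  assert (P1 : Cmod (Psi S0) <= e).
  { set (D := S0 - opnorm T). assert (HD : 1 <= D) by (unfold D, S0; lra).
    apply Rle_trans with (W * / D).
    - unfold W. replace (INR N * (norm x' * norm x) * / D) with (INR N * (norm x' * (/ D * norm x))) by ring.
      rewrite <- rsum_const. apply csum_norm_le. intros j. rewrite Cmod_mult.
      apply Rle_trans with (1 * (norm x' * (/ D * norm x))); [|lra].
      apply Rmult_le_compat; [apply Cmod_ge_0|apply Cmod_ge_0|apply Hh|].
      assert (Hn : Cmod (node N S0 j) = S0) by (unfold node; rewrite Cmod_circle, Rabs_pos_eq; lra).
      eapply Rle_trans; [apply rmat_infinity; [exact specT|rewrite Hn; lra|rewrite Hn; unfold S0; lra]|].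
      rewrite Hn. fold D. apply Rmult_le_compat_l; [exact Hx'|]. apply Rmult_le_compat_r; [exact Hx|].
      assert (HiD : 0 < / D) by (apply Rinv_0_lt_compat; lra).
      assert (HiD1 : / D <= 1) by (rewrite <- Rinv_1; apply Rinv_le_contravar; lra).
      simpl. rewrite <- (Rmult_1_r (/ D)) at 3. apply Rmult_le_compat_l; [lra|].
      rewrite <- (pow1 k). apply pow_incr; lra.
    - apply Rmult_le_reg_r with D; [lra|]. rewrite Rmult_assoc, Rinv_l, Rmult_1_r by lra.
      replace W with (e * (W / e)) at 1 by (field; lra). apply Rmult_le_compat_l; [lra|]. unfold D, S0; lra. }
  assert (P2 : Cmod (Psi S0 - Psi r) <= G / (r - 1) ^ k).
  { assert (IR := is_RInt_inv_pow r S0 k ltac:(lra) HS0 Hk).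
    assert (IR2 := is_RInt_scal (V := R_NormedModule) _ _ _ G _ IR).
    rewrite <- (cint_derive Psi dPsi r S0 HS0).
    - eapply Rle_trans; [apply (cint_norm_le_int dPsi (fun s => G * (INR k / (s - 1) ^ S k)))|].
      + exact HS0.
      + intros s Hs; apply Cd; lra.
      + eexists; exact IR2.
      + intros s Hs; apply Bd; lra.
      + assert (E := is_RInt_unique (V := R_CompleteNormedModule) _ _ _ _ IR2).
        change (RInt (fun s => G * (INR k / (s - 1) ^ S k)) r S0 = G * (/ (r - 1) ^ k - / (S0 - 1) ^ k)) in E.
        rewrite E. unfold Rdiv. apply Rmult_le_compat_l; [exact HG|].
        assert (0 < / (S0 - 1) ^ k) by (apply Rinv_0_lt_compat, pow_lt; lra). lra.
    - intros s Hs; apply Dn; lra.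
    - intros s Hs; apply Cd; lra. }
  assert (A := Cmod_minus_ge (Psi r) (Psi S0)). rewrite Cmod_minus_sym in A. lra. }
assert (Fin : Cmod (Psi r) <= G / (r - 1) ^ k) by (apply le_epsilon; exact Main).
apply Rle_trans with (del * (G / (r - 1) ^ k)).
- apply Rmult_le_compat_l; [lra|exact Fin].
- apply Req_le. unfold G. field. repeat split; lra.
Qed.

(** Uniform continuity on [0, 2 PI] bounds the integral by a Riemann sum up to e, and suitable
    weights turn its sum of moduli into the sum controlled by the hypothesis. *)
Lemma discrete_GFS_GFS (k : nat) : discrete_GFS k -> GFS k T.
Proof.
intros [K [HK H]]. split; [exact specT|]. exists K; split; [exact HK|].
intros r x x' Hr. assert (HP := PI_RGT_0).
rewrite Nat.add_1_r.
set (f := fun t => rmat X T x' (S k) x (circle r t)).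
set (g := fun t => Cmod (f t)).
change (RInt g 0 (2 * PI) <= K / ((r + 1) * (r - 1) ^ k) * norm x * norm x').
assert (Cf : forall t, rcont f t) by (intros t; apply (rmat_circ_cont X T specT); exact Hr).
assert (Ig : forall a b, a <= b -> ex_RInt g a b).
{ intros a b Hab. apply ex_RInt_Cmod; [exact Hab|]. intros t _; apply Cf. }
apply le_epsilon. intros e He.
assert (He2 : 0 < e / (2 * PI)) by (apply Rdiv_lt_0_compat; lra).
assert (Cg : forall t, 0 <= t <= 2 * PI -> continuity_pt g t).
{ intros t _ eps Heps. destruct (Cf t eps Heps) as [d [Hd Kd]].
  exists d; split; [exact Hd|]. intros s [_ Hs]. specialize (Kd s Hs).
  eapply Rle_lt_trans; [|exact Kd]. unfold dist; simpl; unfold Rdist, g.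
  apply Rabs_le. assert (A := Cmod_minus_ge (f s) (f t)). assert (B := Cmod_minus_ge (f t) (f s)).
  rewrite Cmod_minus_sym in B. lra. }
destruct (Heine_cor2 Cg (mkposreal _ He2)) as [d Hd].
destruct (H r Hr) as [N0 [HN0 HB]].
destruct (archimed_cor1 (d / (2 * PI))) as [N1 [HN1 HN1p]].
{ apply Rdiv_lt_0_compat; [apply cond_pos|lra]. }
(* At least N0 for the discrete bound, at least N1 for a mesh below the modulus of continuity. *)
set (N := (N0 + N1)%nat).
assert (HNp : 0 < INR N) by (apply lt_0_INR; unfold N; lia).
set (del := 2 * PI / INR N). assert (Hdel : 0 < del) by (apply Rdiv_lt_0_compat; lra).
assert (Hdd : del < d).
{ apply Rle_lt_trans with (2 * PI * / INR N1).
  - apply Rmult_le_compat_l; [lra|]. apply Rinv_le_contravar; [apply lt_0_INR; lia|apply le_INR; unfold N; lia].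
  - replace (pos d) with (2 * PI * (d / (2 * PI))) by (field; lra). apply Rmult_lt_compat_l; lra. }
assert (HNdel : INR N * del = 2 * PI) by (unfold del; field; lra).
assert (Step : forall n, (n <= N)%nat ->
  RInt g 0 (INR n * del) <= rsum (fun j => del * (g (INR j * del) + e / (2 * PI))) n).
{ induction n as [|n IH]; intros Hn.
  - simpl. rewrite Rmult_0_l, RInt_point. apply Rle_refl.
  - simpl rsum. specialize (IH ltac:(lia)).
    assert (Hn0 : 0 <= INR n * del) by (apply Rmult_le_pos; [apply pos_INR|lra]).
    assert (HSn : INR (S n) * del = INR n * del + del) by (rewrite S_INR; ring).
    assert (HSn2 : INR (S n) * del <= 2 * PI).
    { rewrite <- HNdel. apply Rmult_le_compat_r; [lra|]. apply le_INR; exact Hn. }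
    assert (Ch := RInt_Chasles (V := R_CompleteNormedModule) g 0 (INR n * del) (INR (S n) * del)
      (Ig _ _ Hn0) (Ig (INR n * del) (INR (S n) * del) ltac:(lra))).
    change (RInt g 0 (INR n * del) + RInt g (INR n * del) (INR (S n) * del) = RInt g 0 (INR (S n) * del)) in Ch.
    rewrite <- Ch. apply Rplus_le_compat; [exact IH|].
    assert (Cst : RInt (fun _ => g (INR n * del) + e / (2 * PI)) (INR n * del) (INR (S n) * del)
      = (INR (S n) * del - INR n * del) * (g (INR n * del) + e / (2 * PI)))
      by exact (RInt_const (V := R_CompleteNormedModule) _ _ _).
    apply Rle_trans with (RInt (fun _ => g (INR n * del) + e / (2 * PI)) (INR n * del) (INR (S n) * del));
      [|apply Req_le; etransitivity; [exact Cst|rewrite HSn; ring]].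
    apply RInt_le; [lra|apply Ig; lra|apply (ex_RInt_const (V := R_NormedModule))|].
    intros t Ht. assert (U := Hd t (INR n * del) ltac:(lra) ltac:(lra)).
    specialize (U ltac:(rewrite Rabs_pos_eq; lra)). simpl in U.
    assert (A := Rle_abs (g t - g (INR n * del))). lra. }
specialize (Step N (Nat.le_refl N)). rewrite HNdel in Step.
apply Rle_trans with (1 := Step).
rewrite rsum_scal, rsum_plus, rsum_const.
rewrite Rmult_plus_distr_l.
apply Rplus_le_compat; [|apply Req_le; unfold del; field; lra].
(* Conjugate phases at the nodes, with weight 0 where the coefficient vanishes. *)
set (h := fun j => if Req_EM_T (g (INR j * del)%R) 0 then RtoC 0 else (Cconj (f (INR j * del)%R) / RtoC (g (INR j * del)%R))%C).
assert (Hh : forall j, Cmod (h j) <= 1).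
{ intros j. unfold h. destruct (Req_EM_T _ 0) as [E|E]; [rewrite Cmod_0; lra|].
  assert (G0 := Cmod_ge_0 (f (INR j * del)%R)).
  assert (E3 : RtoC (g (INR j * del)%R) <> 0%C) by (intros E2; apply E, RtoC_inj; exact E2).
  rewrite Cmod_div, Cmod_conj, Cmod_R by exact E3.
  unfold g in *. rewrite Rabs_pos_eq by exact G0. apply Req_le. field. exact E. }
assert (Hhf : forall j, (h j * rmat X T x' (S k) x (node N r j) = RtoC (g (INR j * del)%R))%C).
{ intros j. change (rmat X T x' (S k) x (node N r j)) with (f (INR j * del)%R).
  unfold h. destruct (Req_EM_T _ 0) as [E|E]; [rewrite E; ring|].
  assert (E3 : RtoC (g (INR j * del)%R) <> 0%C) by (intros E2; apply E, RtoC_inj; exact E2).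
  transitivity (f (INR j * del)%R * Cconj (f (INR j * del)%R) / RtoC (g (INR j * del)%R))%C; [field; exact E3|].
  rewrite <- Cmod2_conj. fold (g (INR j * del)%R). simpl. rewrite Rmult_1_r, RtoC_mult. field. exact E3. }
assert (B := HB N r h x x' ltac:(unfold N; lia) (Rle_refl r) Hh).
rewrite (csum_ext _ (fun j => RtoC (g (INR j * del)%R))) in B by (intros j _; apply Hhf).
rewrite csum_RtoC, Cmod_R in B. fold del in B.
apply Rle_trans with (2 := B). apply Rmult_le_compat_l; [lra|apply Rle_abs].
Qed.

(** A norming functional is chosen for each vector phi^(m)(T) x; the constant is the one of the
    scalar estimate. *)
Lemma GFS_calculus (m : nat) : GFS m T -> derivative_bounded_calculus m T.
Proof.
intros HG. destruct (GFS_matrix_bound X T specT m HG) as [K [HK H]].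
exists K; split; [exact HK|]. intros r phi Hr Hphi rho Hrho.
assert (HN := Hinf_norm_pos r phi ltac:(lra) Hphi).
assert (Hp : 0 < (r - 1) ^ m) by (apply pow_lt; lra).
assert (HB : 0 <= K / (r - 1) ^ m * Hinf_norm r phi).
{ apply Rmult_le_pos; [|exact HN]. left; apply Rdiv_lt_0_compat; assumption. }
apply (opnorm_le (A := derivative_calculus m phi rho T) HB). intros x.
destruct (hahn_banach X (derivative_calculus m phi rho T x)) as [x' [Hx' Hy]].
apply Rle_trans with (1 := Hy).
eapply Rle_trans; [exact (H r phi Hr Hphi rho Hrho x x')|].
rewrite <- (Rmult_1_r (K / (r - 1) ^ m * Hinf_norm r phi * norm x)) at 2.
apply Rmult_le_compat_l; [|exact Hx']. apply Rmult_le_pos; [exact HB|apply norm_ge_0].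
Qed.

Lemma discrete_GFS_le (j k : nat) : (1 <= j)%nat -> (j <= k)%nat -> discrete_GFS k -> discrete_GFS j.
Proof.
intros Hj Hjk. induction Hjk as [|k Hjk IH]; [trivial|].
intros H. apply IH, discrete_GFS_descend; [lia|exact H].
Qed.

Lemma calculus_GFS (j m : nat) : (1 <= j)%nat -> (j <= S m)%nat -> derivative_bounded_calculus m T -> GFS j T.
Proof.
intros Hj Hjm H. apply discrete_GFS_GFS, (discrete_GFS_le j (S m) Hj Hjm), calculus_discrete_GFS, H.
Qed.

(** Climbs one order at a time: (GFS)_m gives the m-derivative calculus, which gives (GFS)_(m+1). *)
Lemma calculus_one_GFS (m : nat) : (1 <= m)%nat -> derivative_bounded_calculus 1 T -> GFS m T.
Proof.
intros Hm H. induction Hm as [|m Hm IH].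
- apply (calculus_GFS 1 1); auto.
- apply (calculus_GFS (S m) m); [lia|lia|]. apply GFS_calculus, IH.
Qed.

End Discretization.

Theorem theorem2p10 :
  forall (X : CompleteNormedModule C_AbsRing) (T : blop X X) (m : nat),
    spectrum_in_closed_disc T -> (1 <= m)%nat ->
    (GFS m T <-> derivative_bounded_calculus 1 T) /\
    (derivative_bounded_calculus 1 T <-> derivative_bounded_calculus m T).
Proof.
intros X T m HT Hm.
(* The way down passes through (GFS)_1; the climb from the 1-derivative calculus and the passage
   from (GFS)_m to its calculus close the cycle. *)
assert (A : derivative_bounded_calculus m T -> derivative_bounded_calculus 1 T).
{ intros H. apply (GFS_calculus X T HT), (calculus_GFS X T HT 1 m); [lia|lia|exact H]. }
assert (B := calculus_one_GFS X T HT m Hm). assert (D := GFS_calculus X T HT m).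
split; split; auto.
Qed.
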